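(* Let $k\ge 2$, and let $\mathcal{T}_h$ be a triangulation, with no singular vertices, of a connected polygonal region $\Omega\subset\mathbb{R}^2$ with no holes. Then Strang's conjecture holds on $\mathcal{T}_h$, i.e. $\dim S_h^k=\mathcal{S}_h^k$, if and only if $$\mathrm{Range}(\mathrm{div},\mathbf{V}_h^{k-1})=D_h^{k-2},$$ where $\mathrm{Range}(\mathrm{div},\mathbf{V}_h^{k-1})=\{\mathrm{div}\,\vec v:\vec v\in\mathbf{V}_h^{k-1}\}$.
   Context: A triangulation is a finite conforming triangulation (any two triangles meet in a common edge, a common vertex, or not at all). ''Polygonal region with no holes'' means a connected polygonal region bounded by a single simple closed polygon (its closure is homeomorphic to a closed disk). $P^m(T)$ is the space of bivariate polynomials of degree at most $m$ on a triangle $T$. Define $$S_h^k=\{v\in C^1(\Omega): v|_T\in P^k(T)\ \forall T\in\mathcal{T}_h\},$$ $$V_h^{k-1}=\{v\in C(\overline{\Omega}): v|_T\in P^{k-1}(T)\ \forall T\in\mathcal{T}_h\},\qquad \mathbf{V}_h^{k-1}=[V_h^{k-1}]^2,$$ $$D_h^{k-2}=\{v: v|_T\in P^{k-2}(T)\ \forall T\in\mathcal{T}_h\}$$ (no continuity is imposed in $D_h^{k-2}$; its elements are defined triangle by triangle). For $\vec v=(v_1,v_2)\in\mathbf{V}_h^{k-1}$, $\mathrm{div}\,\vec v=\partial_1v_1+\partial_2v_2$, computed on each triangle. Strang's number is $\mathcal{S}_h^k=\binom{k+2}{2}N_T-(2k+1)\mathring{N}_e+3\mathring{N}_v$, where $N_T$,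 $\mathring{N}_e$, $\mathring{N}_v$ are the numbers of triangles, interior edges and interior vertices of $\mathcal{T}_h$. A singular vertex is a vertex of the mesh that has four edges emanating from it such that these four edges lie on two lines. *)

(* Defs.v *)
From mathcomp Require Import all_boot all_order all_algebra.
From mathcomp Require Import mathcomp_extra boolp classical_sets functions.
From mathcomp Require Import reals topology normedtype derive.

Set Implicit Arguments.
Unset Strict Implicit.
Unset Printing Implicit Defensive.

Import Order.TTheory GRing.Theory Num.Theory.
Import numFieldNormedType.Exports.

Local Open Scope classical_set_scope.
Local Open Scope ring_scope.

Section Geometry.
Variable R : realType.
Implicit Types (Omega L A : set (R * R)) (a b : R * R).

Definition segment a b : set (R * R) :=
  [set (1 - t) *: a + t *: b | t in [set t : R | 0 <= t <= 1]].

Definition is_line L :=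
  exists a (d : R * R), d != 0 /\ L = [set a + t *: d | t in [set: R]].

Definition boundary A := closure A `\` A°.

(* The edges are the segments [q_i, q_(i+1)], indices taken modulo n. *)
Definition polygon n (q : 'I_n -> R * R) : set (R * R) :=
  \bigcup_(i in [set: 'I_n]) segment (q i) (q (ordS i)).

(* Two different edges may only meet in a common endpoint. *)
Definition simple_polygon n (q : 'I_n -> R * R) :=
  [/\ (3 <= n)%N, injective q &
      forall i j : 'I_n, i != j ->
        segment (q i) (q (ordS i)) `&` segment (q j) (q (ordS j)) `<=`
        [set q i; q (ordS i)] `&` [set q j; q (ordS j)]].

(* By the Jordan curve theorem, a bounded such Omega is the inside of the     *)
(* polygon; boundedness is part of [triangulation] below, where the closure   *)
(* of Omega is a finite union of triangles.                                   *)
Definition polygonal_region_no_holes Omega :=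
  [/\ open Omega, connected Omega &
      exists n (q : 'I_n -> R * R),
        simple_polygon q /\ boundary Omega = polygon q].

End Geometry.

(* A mesh is given by a finite type V of vertex labels, their positions       *)
(* p : V -> R * R, and the set Th of its triangles, each triangle being the   *)
(* set of (the labels of) its three vertices.                                 *)
Section Mesh.
Variables (R : realType) (V : finType) (p : V -> R * R) (Th : {set {set V}}).

(* The closed convex hull of the positions of the vertices in s. *)
Definition simplex (s : {set V}) : set (R * R) :=
  [set x | exists l : V -> R,
    [/\ forall v, 0 <= l v, \sum_(v in s) l v = 1 &
        x = \sum_(v in s) l v *: p v]].

Definition collinear (a b c : R * R) :=
  exists2 L, is_line L & [/\ L a, L b & L c].

Definition is_triangle (T : {set V}) :=
  exists a b c : V, T = [set a; b; c]%SET /\ ~ collinear (p a) (p b) (p c).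

(* For different triangles T1 and T2, T1 :&: T2 has at most two elements:     *)
(* its simplex is empty, a common vertex or a common edge.                    *)
Definition conforming :=
  forall T1 T2 : {set V}, T1 \in Th -> T2 \in Th -> T1 != T2 ->
    simplex T1 `&` simplex T2 = simplex (T1 :&: T2)%SET.

Definition triangulation (Omega : set (R * R)) :=
  [/\ injective p,
      finset.cover Th = [set: V]%SET,
      forall T, T \in Th -> is_triangle T,
      conforming &
      closure Omega = \bigcup_(T in [set T | T \in Th]) simplex T].

Definition edges : {set {set V}} :=
  [set e : {set V} | (#|e| == 2)%N && [exists T in Th, e \subset T]]%SET.

(* "Four edges" means that exactly four edges emanate from v. *)
Definition singular_vertex (v : V) :=
  #|[set e in edges | v \in e]%SET| = 4%N /\
  exists L1 L2 : set (R * R), [/\ is_line L1, is_line L2 &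
    forall e, e \in edges -> v \in e ->
      simplex e `<=` L1 \/ simplex e `<=` L2].

Definition interior_edges (Omega : set (R * R)) : {set {set V}} :=
  [set e in edges | `[< ~ (simplex e `<=` boundary Omega) >]]%SET.

Definition interior_vertices (Omega : set (R * R)) : {set V} :=
  [set v : V | `[< Omega (p v) >]]%SET.

Definition strang_number (Omega : set (R * R)) (k : nat) : int :=
  ('C(k + 2, 2) * #|Th|)%N%:Z
  - ((2 * k + 1) * #|interior_edges Omega|)%N%:Z
  + (3 * #|interior_vertices Omega|)%N%:Z.

End Mesh.

(* The dimension of a linear subspace W of U. *)
Definition has_dim (R : realType) (U : lmodType R) (W : set U) (n : nat) :=
  exists b : 'I_n -> U,
    [/\ forall i, W (b i),
        forall c : 'I_n -> R, \sum_i c i *: b i = 0 -> forall i, c i = 0 &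
        forall u, W u -> exists c : 'I_n -> R, u = \sum_i c i *: b i].

(* A function on a subset A of the plane is represented by its extension by   *)
(* zero to R * R, so that equality of functions on A is plain equality.       *)
Section Spaces.
Variables (R : realType) (V : finType) (p : V -> R * R) (Th : {set {set V}}).
Variable Omega : set (R * R).
Implicit Types (A : set (R * R)) (v : R * R -> R).

Definition function_on A v := forall x, ~ A x -> v x = 0.

Definition polynomial_on (m : nat) A v :=
  exists c : nat -> nat -> R, forall x, A x ->
    v x = \sum_(i < m.+1) \sum_(j < m.+1 | (i + j <= m)%N)
            c i j * x.1 ^+ i * x.2 ^+ j.

Definition partial1 v : R * R -> R := fun x => 'D_(1, 0) v x.
Definition partial2 v : R * R -> R := fun x => 'D_(0, 1) v x.

Definition C1_on A v :=
  forall x, A x ->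
    [/\ derivable v x (1, 0), derivable v x (0, 1),
        {for x, continuous (partial1 v)} & {for x, continuous (partial2 v)}].

(* Triangles are closed, so elements of S_h^k are functions on the closure    *)
(* of Omega.                                                                  *)
Definition Sh (k : nat) : set (R * R -> R) :=
  [set v | [/\ function_on (closure Omega) v, C1_on Omega v &
    forall T, T \in Th -> polynomial_on k (simplex p T) v]].

Definition Vh (m : nat) : set (R * R -> R) :=
  [set v | [/\ function_on (closure Omega) v,
    {within closure Omega, continuous v} &
    forall T, T \in Th -> polynomial_on m (simplex p T) v]].

(* The open triangles are pairwise disjoint: a family of polynomials, one for *)
(* each triangle, is the same thing as a single function on their union.      *)
Definition open_triangles : set (R * R) :=
  \bigcup_(T in [set T | T \in Th]) (simplex p T)°.

Definition Dh (m : nat) : set (R * R -> R) :=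
  [set w | function_on open_triangles w /\
    forall T, T \in Th -> polynomial_on m (simplex p T)° w].

Definition divh (v : (R * R -> R) * (R * R -> R)) : R * R -> R :=
  (fun x => partial1 v.1 x + partial2 v.2 x) \_ open_triangles.

Definition strang_conjecture (k : nat) :=
  exists2 d, has_dim (Sh k) d & d%:Z = strang_number p Th Omega k.

End Spaces.

(* Main.v *)
(* The rotated gradient u |-> (d_2 u, - d_1 u) maps S_h^k onto the kernel of
   the divergence on V_h^(k-1) x V_h^(k-1), with the constants as its kernel;
   onto, because a piecewise polynomial field of zero divergence is the rotated
   gradient of a polynomial on each triangle, and the additive constants can be
   matched across the edges: Omega being simply connected, every closed
   1-cochain of the mesh is exact.  By rank-nullity,
     dim S_h^k = 1 + 2 dim V_h^(k-1) - rank div.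
   Counting Bernstein monomials of degree m = k - 1 by their supports gives
   dim V_h^m = #V + (m - 1) #E + C(m - 1, 2) #T, and with Euler's formula
   Strang's number turns out to be 1 + 2 dim V_h^m - dim D_h^(m-1).  Hence the
   conjecture holds if and only if div has full rank.
   That Omega has no holes is used through winding numbers: for a 1-cycle z
   of the mesh, the number F T of turns of z around T defines a 2-chain F, and
   z minus the boundary of F is a cycle supported on the boundary polygon. *)
Require Import Defs.
From mathcomp Require Import all_boot all_order all_algebra.
From mathcomp Require Import boolp classical_sets functions.
From mathcomp Require Import reals topology normedtype derive.
From mathcomp Require Import ring lra zify.

Set Implicit Arguments.
Unset Strict Implicit.
Unset Printing Implicit Defensive.
Import Order.TTheory GRing.Theory Num.Theory.
Import numFieldNormedType.Exports.
Local Open Scope classical_set_scope.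
Local Open Scope ring_scope.

(** * Linear algebra *)

(** The obstacle is the boundary. Functions in [Sh] are differentiable only on the open set [Omega],
    while their rotated gradients must be continuous on its closure. At a boundary vertex the
    triangles could a priori form several fans touching only in that vertex; gradients could then
    disagree from fan to fan, and boundary vertices and edges would no longer be equal in number. A
    winding number argument shows that exactly two boundary edges meet at such a vertex, and that a
    nonempty family of triangles closed under crossing edges at the vertex always reaches the same
    end of the fan. Homology is computed on chains, where winding numbers supply the coefficients,
    and is carried over to cochains by duality. The resulting exact sequence also yields Euler's
    formula. Chains are antisymmetric functions of ordered pairs of vertices, so every edge is
    counted twice; this is the origin of the factors 2 in the winding numbers. *)

Section LinearAlgebra.
Variable R : realType.

Lemma has_dim_uniq (U : lmodType R) (W : set U) m n :
  has_dim W m -> has_dim W n -> m = n.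
Proof.
have le (m1 n1 : nat) : has_dim W m1 -> has_dim W n1 -> (m1 <= n1)%N.
  move=> [b [Wb fb sb]] [b' [Wb' fb' sb']].
  pose c i := projT1 (cid (sb' _ (Wb i))).
  have cE i : b i = \sum_j c i j *: b' j by rewrite /c; case: cid.
  pose c' i := projT1 (cid (sb _ (Wb' i))).
  have cE' i : b' i = \sum_j c' i j *: b j by rewrite /c'; case: cid.
  (* Expressing each family in the other gives two matrices whose product is the identity. *)
  apply: (@mulmx1_min R _ _ (\matrix_(i, j) c i j) (\matrix_(i, j) c' i j)).
  apply/matrixP => i k; rewrite !mxE.
  under eq_bigr do rewrite !mxE.
  pose e k := \sum_j c i j * c' j k - (i == k)%:R.
  suff /(fb e)/(_ k)/eqP : \sum_k0 e k0 *: b k0 = 0.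
    by rewrite subr_eq0 => /eqP.
  under eq_bigr do rewrite scalerBl.
  rewrite sumrB; apply/eqP; rewrite subr_eq0; apply/eqP.
  transitivity (b i).
    rewrite [RHS]cE; under [RHS]eq_bigr do rewrite cE' scaler_sumr.
    rewrite exchange_big; apply: eq_bigr => l _ /=.
    by rewrite scaler_suml; apply: eq_bigr => j _; rewrite scalerA.
  rewrite (bigD1 i) //= eqxx scale1r big1 ?addr0// => j ji.
  by rewrite eq_sym (negbTE ji) scale0r.
by move=> ? ?; apply/eqP; rewrite eqn_leq !le.
Qed.

(** Linearity of [f] is only asked on [W]: the divergence is linear on piecewise polynomial fields,
    not on arbitrary functions. In coordinates [f] becomes a matrix [A] acting on row vectors, and
    [r] is its rank. *)
Lemma rank_nullity (U U' : lmodType R) (W : set U) (D : set U') (f : U -> U')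
    N M :
  (forall a u v, W u -> W v -> W (a *: u + v)) -> W 0 ->
  (forall a u v, W u -> W v -> f (a *: u + v) = a *: f u + f v) ->
  (forall u, W u -> D (f u)) ->
  (forall a u v, D u -> D v -> D (a *: u + v)) -> D 0 ->
  has_dim W N -> has_dim D M ->
  exists r, [/\ (r <= N)%N, (r <= M)%N,
    has_dim [set u | W u /\ f u = 0] (N - r) & r = M <-> f @` W = D].
Proof.
move=> WL W0 fL fD DL D0 [b [Wb fb sb]] [d [Wd fd sd]].
have f0 : f 0 = 0.
  have := fL 1 0 0 W0 W0; rewrite !scale1r addr0 => /eqP.
  by rewrite -subr_eq0 opprD addrA subrr sub0r oppr_eq0 => /eqP.
have sumW n (e : 'I_n -> U) (c : 'I_n -> R) : (forall i, W (e i)) ->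
    W (\sum_i c i *: e i) /\ f (\sum_i c i *: e i) = \sum_i c i *: f (e i).
  move=> We; apply: (big_ind2 (fun u x => W u /\ f u = x)) => //.
  - move=> u x v y [Wu <-] [Wv <-]; rewrite -[u]scale1r; split; first exact: WL.
    by rewrite fL// !scale1r.
  - move=> i _; rewrite -[c i *: e i]addr0; split; first exact: WL.
    by rewrite fL// f0 !addr0.
have sumD n (e : 'I_n -> U') (c : 'I_n -> R) : (forall i, D (e i)) ->
    D (\sum_i c i *: e i).
  move=> De; elim/big_ind : _ => [|u v Du Dv|i _] //.
  - by rewrite -[u]scale1r; exact: DL.
  - by rewrite -[c i *: e i]addr0; exact: DL.
pose a i := projT1 (cid (sd _ (fD _ (Wb i)))).
have aE i : f (b i) = \sum_j a i j *: d j by rewrite /a; case: cid.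
pose A : 'M[R]_(N, M) := \matrix_(i, j) a i j.
have fcE (c : 'rV_N) : f (\sum_i c 0 i *: b i) = \sum_j (c *m A) 0 j *: d j.
  rewrite (sumW _ _ _ Wb).2; under eq_bigr do rewrite aE scaler_sumr.
  rewrite exchange_big; apply: eq_bigr => j _ /=.
  by rewrite mxE scaler_suml; apply: eq_bigr => i _; rewrite mxE scalerA.
exists (\rank A); split; [exact: rank_leq_row|exact: rank_leq_col| |].
  (* The rows of [B], read as coordinates in the basis [b], form a basis of the kernel. *)
  rewrite -mxrank_ker; set B := row_base (kermx A).
  exists (fun l => \sum_i B l i *: b i); split => [l|c|u [Wu fu]].
  - split; first exact: (sumW _ _ _ Wb).1.
    have := fcE (row l B); under eq_bigr do rewrite mxE; move=> ->.
    have /sub_kermxP -> : (row l B <= kermx A)%MS.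
      by rewrite (submx_trans (row_sub _ _))// eq_row_base.
    by rewrite big1// => j _; rewrite mxE scale0r.
  - move=> c0; pose cv := \row_i c i.
    suff /eqP : cv *m B = 0.
      rewrite mulmx_free_eq0 ?row_base_free// => /eqP /matrixP cv0 i.
      by have := cv0 0 i; rewrite !mxE.
    apply/matrixP => i k; rewrite mxE [RHS]mxE ord1.
    under eq_bigr do rewrite mxE.
    apply: (fb (fun k => \sum_j c j * B j k)).
    rewrite -[RHS]c0; under [RHS]eq_bigr do rewrite scaler_sumr.
    rewrite [RHS]exchange_big; apply: eq_bigr => j _ /=.
    by rewrite scaler_suml; apply: eq_bigr => l _; rewrite scalerA.
  - have [c uE] := sb _ Wu; pose cv := \row_i c i.
    have uE' : u = \sum_i cv 0 i *: b i.
      by rewrite uE; apply: eq_bigr => i _; rewrite mxE.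
    have /sub_kermxP : cv *m A = 0.
      apply/matrixP => i j; rewrite ord1 [RHS]mxE.
      by apply: (fd (fun j => (cv *m A) 0 j)); rewrite -fcE -uE'.
    rewrite -(eq_row_base (kermx A)) => /submxP [E cvE].
    exists (fun l => E 0 l); rewrite uE' cvE.
    under eq_bigr do rewrite mxE scaler_suml.
    rewrite exchange_big; apply: eq_bigr => l _ /=.
    by rewrite scaler_sumr; apply: eq_bigr => i _; rewrite scalerA.
split => [rM|fW].
  apply/seteqP; split => [_ [u Wu <-]|x Dx]; first exact (fD _ Wu).
  have [c xE] := sd _ Dx; have fullA : row_full A by apply/eqP.
  have /submxP [E EA] := submx_full (\row_j c j) fullA.
  exists (\sum_i E 0 i *: b i); first exact: (sumW _ _ _ Wb).1.
  by rewrite fcE -EA xE; apply: eq_bigr => j _; rewrite mxE.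
have col j : exists c : 'rV_N, c *m A = delta_mx 0 j.
  have : (f @` W) (d j) by rewrite fW.
  move=> [u Wu fu]; have [c uE] := sb _ Wu; exists (\row_i c i).
  have uE' : u = \sum_i (\row_i c i) 0 i *: b i.
    by rewrite uE; apply: eq_bigr => i _; rewrite mxE.
  apply/matrixP => i k; rewrite ord1 [RHS]mxE eqxx /=.
  apply/eqP; rewrite -subr_eq0; apply/eqP.
  apply: (fd (fun k => (\row_i c i *m A) 0 k - (k == j)%:R)).
  under eq_bigr do rewrite scalerBl.
  rewrite sumrB -fcE -uE' fu (bigD1 j) //= eqxx scale1r big1 ?addr0 ?subrr//.
  by move=> l lj; rewrite (negbTE lj) scale0r.
apply/eqP; change (row_full A); rewrite -sub1mx; apply/row_subP => j.
have [c cA] := col j; rewrite row1 -cA; exact: submxMl.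
Qed.

(** [r] is a linear relation rather than a map; it will say that [x] is the rotated gradient of [u]
    inside the triangles. Lifts of a basis of [K], together with the generator [o] of the kernel,
    form a basis of [S]. *)
Lemma has_dim_extension (U X : lmodType R) (S : set U) (K : set X)
    (r : U -> X -> Prop) (o : U) n :
  (forall a u v, S u -> S v -> S (a *: u + v)) -> S 0 ->
  (forall a u v x y, S u -> S v -> K x -> K y -> r u x -> r v y ->
     r (a *: u + v) (a *: x + y)) ->
  K 0 -> (forall a x y, K x -> K y -> K (a *: x + y)) ->
  (forall u, S u -> exists2 x, K x & r u x) ->
  (forall x, K x -> exists2 u, S u & r u x) ->
  (forall u, S u -> r u 0 -> exists c, u = c *: o) ->
  S o -> r o 0 -> o != 0 ->
  (forall x, K x -> r 0 x -> x = 0) ->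
  has_dim K n -> has_dim S n.+1.
Proof.
move=> SL S0 rL K0 KL rt rs r0 So ro o0 rx [k [Kk fk sk]].
have r00 : r 0 0.
  have := rL (-1) _ _ _ _ So So K0 K0 ro ro.
  by rewrite !scaleN1r !addNr.
pose s i := projT1 (cid2 (rs _ (Kk i))).
have [Ss rsk] : (forall i, S (s i)) /\ (forall i, r (s i) (k i)).
  by split => i; rewrite /s; case: cid2.
have sumSK (c : 'I_n -> R) : [/\ S (\sum_i c i *: s i), K (\sum_i c i *: k i)
    & r (\sum_i c i *: s i) (\sum_i c i *: k i)].
  apply: (big_ind2 (fun u x => [/\ S u, K x & r u x])) => //.
    move=> u x v y [Su Kx rux] [Sv Ky rvy].
    rewrite -[u]scale1r -[x]scale1r; split; [exact: SL|exact: KL|exact: rL].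
  move=> i _; rewrite -[c i *: s i]addr0 -[c i *: k i]addr0.
  by split; [exact: SL|exact: KL|exact: rL].
exists (fun i => if unlift ord0 i is Some j then s j else o); split.
- by move=> i; case: unliftP.
- move=> c; rewrite big_ord_recl unlift_none.
  under eq_bigr do rewrite liftK; move=> c0.
  have [Ss' Ks' rs'] := sumSK (fun i => c (lift ord0 i)).
  have kc : forall i, c (lift ord0 i) = 0.
    apply: fk; apply: rx => //.
    have := rL (c ord0) _ _ _ _ So Ss' K0 Ks' ro rs'.
    by rewrite scaler0 add0r c0.
  move: c0; rewrite big1 ?addr0; last by move=> i _; rewrite kc scale0r.
  move=> /eqP; rewrite scaler_eq0 (negbTE o0) orbF => /eqP co i.
  by case: (unliftP ord0 i) => [j|] ->.
- move=> u Su; have [x Kx rux] := rt _ Su; have [c xE] := sk _ Kx.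
  have [Ss' Ks' rs'] := sumSK c.
  (* Subtracting the lifted combination from [u] leaves an element related to 0, hence a multiple of
     [o]. *)
  have := rL (-1) _ _ _ _ Ss' Su Ks' Kx rs' rux.
  rewrite xE !scaleN1r addNr => /(r0 _ _) []; first by rewrite -scaleN1r; exact: SL.
  move=> c0 /eqP; rewrite addrC subr_eq => /eqP uE.
  exists (fun i => if unlift ord0 i is Some j then c j else c0).
  rewrite big_ord_recl unlift_none uE; congr (_ + _).
  by apply: eq_bigr => i _; rewrite liftK.
Qed.

Lemma has_dim_setX (U X : lmodType R) (W : set U) (Y : set X) m n :
  W 0 -> Y 0 -> has_dim W m -> has_dim Y n ->
  has_dim (W `*` Y : set (U * X)%type) (m + n).
Proof.
move=> W0 Y0 [b [Wb fb sb]] [d [Wd fd sd]].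
exists (fun i => match fintype.split i with inl j => (b j, 0) | inr j => (0, d j) end).
have sE (c : 'I_(m + n) -> R) :
    \sum_i c i *: (match fintype.split i with inl j => (b j, 0) | inr j => (0, d j) end)
    = (\sum_i c (lshift n i) *: b i, \sum_i c (rshift m i) *: d i).
  rewrite big_split_ord /=.
  under eq_bigr do rewrite (unsplitK (inl _)).
  under [X in _ + X]eq_bigr do rewrite (unsplitK (inr _)).
  have E1 (P : 'I_m -> U) (c1 : 'I_m -> R) :
      \sum_i c1 i *: (P i, 0 : X) = (\sum_i c1 i *: P i, 0).
    apply: (big_rec2 (fun x y => x = (y, 0))) => // i [x1 x2] y _ [-> ->].
    by congr pair; rewrite /= ?scaler0 ?addr0.
  have E2 (P : 'I_n -> X) (c1 : 'I_n -> R) :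
      \sum_i c1 i *: (0 : U, P i) = (0, \sum_i c1 i *: P i).
    apply: (big_rec2 (fun x y => x = (0, y))) => // i [x1 x2] y _ [-> ->].
    by congr pair; rewrite /= ?scaler0 ?addr0.
  by rewrite E1 E2; congr pair; rewrite /= ?addr0 ?add0r.
split.
- by move=> i; case: (fintype.split i) => j; split=> /=.
- move=> c; rewrite sE => -[/fb cl /fd cr] i.
  by rewrite -(splitK i); case: (fintype.split i) => j /=.
- move=> [u x] [/= /sb[c ->] /sd[c' ->]].
  exists (fun i => match fintype.split i with inl j => c j | inr j => c' j end).
  rewrite sE; congr pair; apply: eq_bigr => i _.
    by rewrite (unsplitK (inl _)).
  by rewrite (unsplitK (inr _)).
Qed.

(** The columns of a cokernel matrix are test vectors [z], and a vector killed by all of them lies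
    in the span. This duality turns statements on cycles into statements on cochains. *)
Lemma fredholm (J K : finType) (B : J -> K -> R) (g : J -> R) :
  (forall z : J -> R, (forall k, \sum_j z j * B j k = 0) ->
     \sum_j z j * g j = 0) ->
  exists f : K -> R, forall j, g j = \sum_k B j k * f k.
Proof.
move=> H.
pose Bm : 'M[R]_(#|J|, #|K|) := \matrix_(i, j) B (enum_val i) (enum_val j).
pose gm : 'rV[R]_(#|J|) := \row_i g (enum_val i).
suff /submxP [F gF] : (gm <= Bm^T)%MS.
  exists (fun k => F 0 (enum_rank k)) => j.
  have := congr1 (fun M : 'rV_#|J| => M 0 (enum_rank j)) gF.
  rewrite !mxE enum_rankK => ->.
  rewrite (reindex _ (onW_bij _ (@enum_val_bij K))) /=.
  by apply: eq_bigr => k _; rewrite !mxE enum_rankK enum_valK mulrC.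
rewrite submxE; set C := cokermx _.
have BC : Bm^T *m C = 0 by apply: mulmx_coker.
apply/eqP/matrixP => i l; rewrite [RHS]mxE ord1 mxE.
have H' : \sum_j C (enum_rank j) l * g j = 0.
  apply: (H (fun j => C (enum_rank j) l)) => k.
  have /matrixP/(_ (enum_rank k) l) := BC; rewrite !mxE => BCk; rewrite -[RHS]BCk.
  rewrite (reindex _ (onW_bij _ (@enum_val_bij J))) /=.
  by apply: eq_bigr => j _; rewrite !mxE enum_rankK enum_valK mulrC.
rewrite -[RHS]H' (reindex _ (onW_bij _ (@enum_val_bij J))) /=.
by apply: eq_bigr => j _; rewrite !mxE enum_valK mulrC.
Qed.

Lemma scaleRE (a b : R) : a *: b = a * b. Proof. by []. Qed.

Lemma has_dim_ffun (I : finType) (A : {set I}) :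
  has_dim [set f : I -> R | forall i, i \notin A -> f i = 0] #|A|.
Proof.
exists (fun j i => (i == enum_val j)%:R); split.
- move=> j i /= iA; case: eqP => // ij; case/negP: iA.
  by rewrite ij; exact: enum_valP.
- move=> c /= /(congr1 (fun f => f _)) c0 i.
  have := c0 (enum_val i); rewrite fct_sumE /= (bigD1 i) //= big1.
    by rewrite scalrfctE /= scaleRE eqxx mulr1 addr0.
  move=> j ji; rewrite scalrfctE /= scaleRE (inj_eq enum_val_inj).
  by rewrite eq_sym (negbTE ji) mulr0.
- move=> f fA; exists (fun j => f (enum_val j)).
  apply/funext => i; rewrite fct_sumE /=.
  have [iA|iA] := boolP (i \in A); last first.
    rewrite fA// big1// => j _; rewrite scalrfctE /= scaleRE; case: eqP => [ij|].
      by case/negP: iA; rewrite ij; exact: enum_valP.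
    by rewrite mulr0.
  rewrite (bigD1 (enum_rank_in iA i)) //= enum_rankK_in// big1 => [|j ji].
    by rewrite scalrfctE /= scaleRE eqxx mulr1 addr0.
  rewrite scalrfctE /= scaleRE; case: eqP => [ij|]; last by rewrite mulr0.
  by case/eqP: ji; apply: enum_val_inj; rewrite enum_rankK_in -?ij.
Qed.

End LinearAlgebra.

(** * Crossing and winding numbers *)

Section Crossing.
Variable R : realType.
Implicit Types (a b c m u x y : R * R).

Definition cross u v : R := u.1 * v.2 - u.2 * v.1.
Definition dot u v : R := u.1 * v.1 + u.2 * v.2.
(** Twice the signed area of the triangle, positive when [a], [b], [c] are counterclockwise. *)
Definition orient a b c := cross (b - a) (c - a).

Lemma orientE a b c : orient a b c =
  (b.1 - a.1) * (c.2 - a.2) - (b.2 - a.2) * (c.1 - a.1).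
Proof. by []. Qed.

Lemma orient_rot a b c : orient a b c = orient b c a.
Proof. by rewrite !orientE; ring. Qed.

Lemma orient_swap a b c : orient b a c = - orient a b c.
Proof. by rewrite !orientE; ring. Qed.

(* The signed number of crossings of the oriented segment from [a] to [b]     *)
(* with the upward vertical ray from [y].                                     *)
Definition crossing a b y : R :=
  ((b.1 <= y.1 < a.1) && (0 < orient a b y))%:R -
  ((a.1 <= y.1 < b.1) && (orient a b y < 0))%:R.

Lemma crossingC a b y : crossing b a y = - crossing a b y.
Proof.
by rewrite /crossing orient_swap oppr_gt0 oppr_lt0 opprB.
Qed.

(* Indicator of the half-infinite strip above the segment from [y] to [y'],   *)
(* counted negatively when [y'] is on the right of [y].                       *)
Definition strip y y' c : R :=
  ((y'.1 < c.1 <= y.1) && (orient y y' c < 0))%:R -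
  ((y.1 < c.1 <= y'.1) && (0 < orient y y' c))%:R.

(* Crossing the boundary of the strip: a segment can only enter or leave it   *)
(* through its two vertical sides when it is separated from [y, y'].          *)
Lemma crossing_strip a b y y' n k :
  dot n y < k -> dot n y' < k -> k < dot n a -> k < dot n b ->
  crossing a b y - crossing a b y' = strip y y' b - strip y y' a.
Proof.
case: a b y y' n => [a1 a2] [b1 b2] [x1 x2] [y1 y2] [n1 n2].
rewrite /dot /= => hx hy ha hb.
have key p q r s t w : n1 * p + n2 * q < k -> k < n1 * r + n2 * s ->
    k < n1 * t + n2 * w -> t <= p < r ->
    0 < n2 * ((r - t) * (w - q) + (s - w) * (p - t)).
  move=> h1 h2 h3 /andP[tp pr].
  suff : 0 < (p - t) * (n1 * r + n2 * s - (n1 * p + n2 * q)) +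
             (r - p) * (n1 * t + n2 * w - (n1 * p + n2 * q)).
    by congr (0 < _); ring.
  apply: ltr_wpDl; first by rewrite mulr_ge0// ?subr_ge0// ltW// (lt_trans h1).
  by rewrite mulr_gt0// subr_gt0// (lt_trans h1).
have key2 p q r s t w : k < n1 * p + n2 * q -> n1 * r + n2 * s < k ->
    n1 * t + n2 * w < k -> t < p <= r ->
    0 < n2 * ((r - t) * (q - w) - (s - w) * (p - t)).
  move=> h1 h2 h3 /andP[tp pr].
  suff : 0 < (p - t) * (n1 * p + n2 * q - (n1 * r + n2 * s)) +
             (r - p) * (n1 * p + n2 * q - (n1 * t + n2 * w)).
    by congr (0 < _); ring.
  apply: ltr_pwDl; first by rewrite mulr_gt0// ?subr_gt0// (lt_trans h2).
  by rewrite mulr_ge0// subr_ge0// ltW// (lt_trans h3).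
have orE p q r s t w : orient (p, q) (r, s) (t, w) =
  (r - p) * (w - q) - (s - q) * (t - p) by [].
rewrite /crossing /strip /= !orE.
(* For [n2 > 0] the segment from [a] to [b] passes above the other one wherever their abscissas
   overlap, so every orientation test holds; for [n2 < 0] every test fails; for [n2 = 0] the
   abscissas never overlap. *)
case: (ltrgt0P n2) => n20.
- have pos (d : R) : 0 < n2 * d -> 0 < d by rewrite pmulr_rgt0.
  have E1 s t : n1 * s + n2 * t < k ->
     ((b1 <= s < a1) && (0 < (b1 - a1) * (t - a2) - (b2 - a2) * (s - a1))) =
     (b1 <= s < a1).
    move=> h; case: (boolP (b1 <= s < a1)) => //= /(key _ _ _ _ _ _ h ha hb)/pos.
    by move=> p; apply/idP; move: p; congr (0 < _); ring.
  have E2 s t : n1 * s + n2 * t < k ->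
     ((a1 <= s < b1) && ((b1 - a1) * (t - a2) - (b2 - a2) * (s - a1) < 0)) =
     (a1 <= s < b1).
    move=> h; case: (boolP (a1 <= s < b1)) => //= /(key _ _ _ _ _ _ h hb ha)/pos.
    by rewrite -oppr_gt0 => p; apply/idP; move: p; congr (0 < _); ring.
  have E3 p q : k < n1 * p + n2 * q ->
     ((y1 < p <= x1) && ((y1 - x1) * (q - x2) - (y2 - x2) * (p - x1) < 0)) =
     (y1 < p <= x1).
    move=> h; case: (boolP (y1 < p <= x1)) => //= /(key2 _ _ _ _ _ _ h hx hy)/pos.
    by rewrite -oppr_gt0 => p'; apply/idP; move: p'; congr (0 < _); ring.
  have E4 p q : k < n1 * p + n2 * q ->
     ((x1 < p <= y1) && (0 < (y1 - x1) * (q - x2) - (y2 - x2) * (p - x1))) =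
     (x1 < p <= y1).
    move=> h; case: (boolP (x1 < p <= y1)) => //= /(key2 _ _ _ _ _ _ h hy hx)/pos.
    by move=> p'; apply/idP; move: p'; congr (0 < _); ring.
  rewrite !E1// !E2// !E3// !E4//; clear.
  by case: (leP b1 x1); case: (leP a1 x1); case: (leP b1 y1); case: (leP a1 y1);
    rewrite /= ?subrr ?subr0 ?sub0r ?opprK //; lra.
- have pos (d : R) : 0 < n2 * d -> d < 0 by rewrite nmulr_rgt0.
  have E1 s t : n1 * s + n2 * t < k ->
     ((b1 <= s < a1) && (0 < (b1 - a1) * (t - a2) - (b2 - a2) * (s - a1))) =
     false.
    move=> h; case: (boolP (b1 <= s < a1)) => //= /(key _ _ _ _ _ _ h ha hb)/pos p.
    by apply/negbTE; rewrite -leNgt; apply: ltW; move: p; congr (_ < 0); ring.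
  have E2 s t : n1 * s + n2 * t < k ->
     ((a1 <= s < b1) && ((b1 - a1) * (t - a2) - (b2 - a2) * (s - a1) < 0)) =
     false.
    move=> h; case: (boolP (a1 <= s < b1)) => //= /(key _ _ _ _ _ _ h hb ha)/pos.
    rewrite -oppr_gt0 => p.
    by apply/negbTE; rewrite -leNgt; apply: ltW; move: p; congr (0 < _); ring.
  have E3 p q : k < n1 * p + n2 * q ->
     ((y1 < p <= x1) && ((y1 - x1) * (q - x2) - (y2 - x2) * (p - x1) < 0)) =
     false.
    move=> h; case: (boolP (y1 < p <= x1)) => //= /(key2 _ _ _ _ _ _ h hx hy)/pos.
    rewrite -oppr_gt0 => p'.
    by apply/negbTE; rewrite -leNgt; apply: ltW; move: p'; congr (0 < _); ring.
  have E4 p q : k < n1 * p + n2 * q ->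
     ((x1 < p <= y1) && (0 < (y1 - x1) * (q - x2) - (y2 - x2) * (p - x1))) =
     false.
    move=> h; case: (boolP (x1 < p <= y1)) => //= /(key2 _ _ _ _ _ _ h hy hx)/pos p'.
    by apply/negbTE; rewrite -leNgt; apply: ltW; move: p'; congr (_ < 0); ring.
  by rewrite !E1// !E2// !E3// !E4// !subrr.
- have no (d : R) : 0 < n2 * d -> False by rewrite n20 mul0r ltxx.
  have E1 s t : n1 * s + n2 * t < k -> (b1 <= s < a1) = false.
    by move=> h; apply/negP => /(key _ _ _ _ _ _ h ha hb)/no.
  have E2 s t : n1 * s + n2 * t < k -> (a1 <= s < b1) = false.
    by move=> h; apply/negP => /(key _ _ _ _ _ _ h hb ha)/no.
  have E3 p q : k < n1 * p + n2 * q -> (y1 < p <= x1) = false.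
    by move=> h; apply/negP => /(key2 _ _ _ _ _ _ h hx hy)/no.
  have E4 p q : k < n1 * p + n2 * q -> (x1 < p <= y1) = false.
    by move=> h; apply/negP => /(key2 _ _ _ _ _ _ h hy hx)/no.
  by rewrite !(E1 x1 x2)// !(E1 y1 y2)// !(E2 x1 x2)// !(E2 y1 y2)//
    !(E3 b1 b2)// !(E3 a1 a2)// !(E4 b1 b2)// !(E4 a1 a2)// !subrr.
Qed.

End Crossing.

(** * Separation of points from segments, and connectedness *)

Section LocallyConstant.
Variable R : realType.
Implicit Types (a b c m n u x y : R * R).

Lemma dot_continuous n : continuous (dot n).
Proof.
move=> x; rewrite /dot; apply: cvgD; apply: cvgM; try exact: cvg_cst.
- exact: cvg_fst.
- exact: cvg_snd.
Qed.

Lemma dot_near n x k : dot n x < k -> \forall y \near x, dot n y < k.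
Proof. exact: (@cvgr_lt _ _ (nbhs x) _ _ _ (@dot_continuous n x)). Qed.

(** Off the line of the segment a normal vector separates. On the line, [dot (a - y) (b - y) > 0]
    says that [y] lies beyond one end, and then [a - y] separates; in the remaining case [y] is on
    the segment. *)
Lemma segment_separation a b y : ~ segment a b y ->
  exists n k, [/\ dot n y < k, k < dot n a & k < dot n b].
Proof.
move=> aby.
have mid n : dot n y < dot n a -> dot n y < dot n b ->
    exists n k, [/\ dot n y < k, k < dot n a & k < dot n b].
  move=> ya yb; exists n, ((dot n y + Num.min (dot n a) (dot n b)) / 2).
  by case: (leP (dot n a) (dot n b)) => ?; split; lra.
have [o0|o0|o0] := ltrgt0P (orient a b y).
- apply: (mid ((b - a).2, - (b - a).1)); move: o0;
    rewrite orientE /dot /=; lra.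
- apply: (mid (- (b - a).2, (b - a).1)); move: o0;
    rewrite orientE /dot /=; lra.
have [d0|d0] := leP (dot (a - y) (b - y)) 0; last first.
  apply: (mid (a - y)); last by move: d0; rewrite /dot /=; lra.
  suff : 0 < dot (a - y) (a - y) by rewrite /dot /=; lra.
  rewrite lt_neqAle addr_ge0 -?expr2 ?sqr_ge0// andbT eq_sym.
  apply/eqP => /eqP; rewrite paddr_eq0 ?sqr_ge0// !sqrf_eq0 => /andP[/eqP e1 /eqP e2].
  by move: d0; rewrite /dot e1 e2 !mul0r addr0 ltxx.
case: aby; clear mid; move: o0 d0; rewrite orientE /dot.
case: a b y => [a1 a2] [b1 b2] [y1 y2] /= o0 d0.
have [/eqP|N0] := eqVneq ((b1 - a1) ^+ 2 + (b2 - a2) ^+ 2) 0.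
  rewrite paddr_eq0 ?sqr_ge0// !sqrf_eq0 !subr_eq0 => /andP[/eqP e1 /eqP e2].
  exists 0; first by rewrite /= lexx ler01.
  rewrite subr0 scale1r scale0r addr0.
  have /eqP : (a1 - y1) ^+ 2 + (a2 - y2) ^+ 2 = 0.
    apply/eqP; rewrite eq_le addr_ge0 ?sqr_ge0// andbT.
    by rewrite !expr2; move: d0; rewrite e1 e2.
  by rewrite paddr_eq0 ?sqr_ge0// !sqrf_eq0 !subr_eq0 => /andP[/eqP <- /eqP <-].
have Npos : 0 < (b1 - a1) ^+ 2 + (b2 - a2) ^+ 2.
  by rewrite lt_neqAle eq_sym N0 addr_ge0 ?sqr_ge0.
(* The parameter of the orthogonal projection of [y] onto the line. *)
pose t := ((y1 - a1) * (b1 - a1) + (y2 - a2) * (b2 - a2)) /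
  ((b1 - a1) ^+ 2 + (b2 - a2) ^+ 2).
exists t.
  rewrite /= divr_ge0 ?(ltW Npos)//= ?ler_pdivrMr ?mul1r//.
    suff : 0 <= (b1 - y1) ^+ 2 + (b2 - y2) ^+ 2 by rewrite !expr2; lra.
    by rewrite addr_ge0 ?sqr_ge0.
  suff : 0 <= (a1 - y1) ^+ 2 + (a2 - y2) ^+ 2 by rewrite !expr2; lra.
  by rewrite addr_ge0 ?sqr_ge0.
have tE : t * ((b1 - a1) ^+ 2 + (b2 - a2) ^+ 2) =
    (y1 - a1) * (b1 - a1) + (y2 - a2) * (b2 - a2) by rewrite /t divfK.
congr pair; rewrite /=; apply: (mulIf N0).
  suff -> : ((1 - t) *: a1 + t *: b1) * ((b1 - a1) ^+ 2 + (b2 - a2) ^+ 2) =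
      a1 * ((b1 - a1) ^+ 2 + (b2 - a2) ^+ 2) +
      (b1 - a1) * (t * ((b1 - a1) ^+ 2 + (b2 - a2) ^+ 2)).
    apply/eqP; rewrite tE -subr_eq0; apply/eqP.
    transitivity ((b2 - a2) * ((b1 - a1) * (y2 - a2) - (b2 - a2) * (y1 - a1))).
      by ring.
    by rewrite o0 mulr0.
  by rewrite !scaleRE; ring.
suff -> : ((1 - t) *: a2 + t *: b2) * ((b1 - a1) ^+ 2 + (b2 - a2) ^+ 2) =
    a2 * ((b1 - a1) ^+ 2 + (b2 - a2) ^+ 2) +
    (b2 - a2) * (t * ((b1 - a1) ^+ 2 + (b2 - a2) ^+ 2)).
  apply/eqP; rewrite tE -subr_eq0; apply/eqP.
  transitivity (- (b1 - a1) * ((b1 - a1) * (y2 - a2) - (b2 - a2) * (y1 - a1))).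
    by ring.
  by rewrite o0 mulr0.
by rewrite !scaleRE; ring.
Qed.

(** Level sets of [f] are relatively open and relatively closed in [A]. The type [K] is arbitrary
    because winding numbers, vertex data and truth values all pass through this lemma. *)
Lemma locally_constant_connected (T : topologicalType) (K : Type) (A : set T)
    (f : T -> K) :
  connected A -> (forall x : T, A x -> \forall y \near x, A y -> f y = f x) ->
  forall x y : T, A x -> A y -> f x = f y.
Proof.
move=> cA lA x y Ax Ay.
suff : [set z | A z /\ f z = f x] = A by move=> /seteqP[_ /(_ y Ay)[]].
apply: cA; first by exists x.
- exists [set z | \forall t \near z, A t -> f t = f x].
    exact: open_interior.
  apply/seteqP; split => z /= [Az fz]; split => //.
    by have := lA _ Az; rewrite fz.
  by have := nbhs_singleton fz; apply.
- exists (~` [set z | \forall t \near z, A t -> f t <> f x]).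
    apply: open_closedC; exact: open_interior.
  apply/seteqP; split => z /= [Az fz]; split => //.
    by move=> /nbhs_singleton; apply.
  apply: contrapT => fz'; apply: fz; near=> t => At.
  suff -> : f t = f z by [].
  by move: At; near: t; apply: lA.
Unshelve. all: end_near. Qed.

Lemma connected_segment a b : connected (segment a b).
Proof.
rewrite /segment; have -> : [set t : R | 0 <= t <= 1] = [set` `[(0 : R), 1]].
  by apply/seteqP; split => t; rewrite /= in_itv.
apply: connected_continuous_connected; first exact: segment_connected.
apply: continuous_subspaceT => t; apply: cvgD; apply: cvgZ; try exact: cvg_cst.
  by apply: cvgB; [exact: cvg_cst|exact: cvg_id].
exact: cvg_id.
Qed.

Lemma closed_segment a b : closed (segment a b).
Proof.
rewrite /segment; have -> : [set t : R | 0 <= t <= 1] = [set` `[(0 : R), 1]].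
  by apply/seteqP; split => t; rewrite /= in_itv.
apply: compact_closed; first exact: norm_hausdorff.
apply: continuous_compact; last exact: segment_compact.
apply: continuous_subspaceT => t; apply: cvgD; apply: cvgZ; try exact: cvg_cst.
  by apply: cvgB; [exact: cvg_cst|exact: cvg_id].
exact: cvg_id.
Qed.

Lemma near_ray m u (P : set (R * R)) : nbhs m P ->
  \forall d \near (0 : R)^'+, P (m + d *: u).
Proof.
move=> mP; have : (fun d : R => m + d *: u) @ (0 : R)^'+ --> m.
  rewrite -[X in _ --> X]addr0 -[in X in _ --> X](scale0r u).
  apply: cvgD; first exact: cvg_cst.
  by apply: cvgZr_tmp; apply: cvg_at_right_filter; exact: cvg_id.
exact.
Qed.

End LocallyConstant.

(** * Winding numbers of weighted cycles *)

Section Cycle.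
Variables (R : realType) (I : finType) (w : I -> R) (src tgt : I -> R * R).
Implicit Types (a b c m n u x y : R * R).

(** The boundary of the chain is tested against all functions of the endpoints: in this form the
    [strip] corrections cancel. *)
Definition weighted_cycle :=
  forall f : R * R -> R, \sum_i w i * (f (tgt i) - f (src i)) = 0.

Definition winding y := \sum_i w i * crossing (src i) (tgt i) y.

Hypothesis cyc : weighted_cycle.

(** Each segment of nonzero weight is separated from both [x] and a nearby [y], so its crossing
    number changes by a difference of values of [strip y x] at its ends; around a cycle these
    differences add up to zero. *)
Lemma winding_near x : (forall i, w i != 0 -> ~ segment (src i) (tgt i) x) ->
  \forall y \near x, winding y = winding x.
Proof.
move=> H; have : \forall y \near x, forall i, w i != 0 ->
    exists n k, [/\ dot n x < k, dot n y < k,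
      k < dot n (src i) & k < dot n (tgt i)].
  apply: (@filter_forall _ I (fun i y => w i != 0 -> exists n k,
    [/\ dot n x < k, dot n y < k, k < dot n (src i) & k < dot n (tgt i)]) (nbhs x) _) => i.
  have [wi0|wi] := eqVneq (w i) 0.
    by apply: nearW.
  have [n [k [h1 h2 h3]]] := segment_separation (H i wi).
  have := dot_near h1.
  by apply: filterS => y /= h _; exists n, k.
apply: filterS => y Hy; apply/eqP; rewrite -subr_eq0 -sumrB.
rewrite -[X in _ == X](cyc (strip y x)); apply/eqP; apply: eq_bigr => i _.
have [->|wi] := eqVneq (w i) 0; first by rewrite !mul0r subrr.
have [n [k [h1 h2 h3 h4]]] := Hy i wi.
by rewrite -mulrBr (crossing_strip h2 h1 h3 h4).
Qed.

(** [m] is a point inside the segment and [u] points to its left. Passing from right to left gains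
    one crossing, up to [strip] values at the ends, which cancel in a cycle. *)
Lemma crossing_jump a b t u : 0 < t < 1 ->
  let m := (1 - t) *: a + t *: b in
  0 < orient a b (m + u) ->
  \forall d \near (0 : R)^'+,
    crossing a b (m + d *: u) - crossing a b (m - d *: u) =
    1 + (strip (m + d *: u) (m - d *: u) b - strip (m + d *: u) (m - d *: u) a).
Proof.
move=> /andP[t0 t1] m.
have near1 n k : dot n m < k ->
    \forall d \near (0 : R)^'+, dot n (m + d *: u) < k /\ dot n (m - d *: u) < k.
  move=> h; apply: filterI; first exact: near_ray (dot_near h).
  have := near_ray (- u) (dot_near h).
  by apply: filterS => d; rewrite scalerN.
have orE d : orient a b (m + d *: u) = d * orient a b (m + u).
  by rewrite /m !orientE /= !scaleRE; ring.
move=> o0.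
have oN d : 0 < d -> orient a b (m - d *: u) < 0.
  by move=> d0; rewrite -scaleNr orE mulNr oppr_lt0 mulr_gt0.
have oP d : 0 < d -> 0 < orient a b (m + d *: u).
  by move=> d0; rewrite orE mulr_gt0.
have d1 k v : dot (k, 0) v = k * v.1 by rewrite /dot /= mul0r addr0.
have m1 : m.1 = a.1 + t * (b.1 - a.1) by rewrite /m /= !scaleRE; ring.
(* If the segment is not vertical, [d] is so small that both points have abscissas strictly between
   those of the ends, and the [strip] terms vanish. *)
have [ab1|ab1|ab1] := ltrgtP a.1 b.1.
- have H1 := near1 (1, 0) b.1; have H2 := near1 (-1, 0) (- a.1).
  rewrite d1 mul1r in H1; rewrite d1 mulN1r ltrN2 in H2.
  have {}H1 := H1 ltac:(rewrite m1; nra).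
  have {}H2 := H2 ltac:(rewrite m1; nra).
  near=> d; have d0 : 0 < d by [].
  have oy := oP _ d0; have oy' := oN _ d0.
  have [] : dot (1, 0) (m + d *: u) < b.1 /\ dot (1, 0) (m - d *: u) < b.1.
    by near: d; exact: H1.
  have [] : dot (-1, 0) (m + d *: u) < - a.1 /\ dot (-1, 0) (m - d *: u) < - a.1.
    by near: d; exact: H2.
  rewrite !d1 !mul1r !mulN1r !ltrN2 => h1 h2 h3 h4.
  rewrite /crossing /strip (lt_geF h3) (lt_geF h4) (lt_gtF h1) (lt_gtF h2).
  by rewrite (ltW h1) (ltW h2) h3 h4 (lt_gtF oy) oy' /=; lra.
- have H1 := near1 (1, 0) a.1; have H2 := near1 (-1, 0) (- b.1).
  rewrite d1 mul1r in H1; rewrite d1 mulN1r ltrN2 in H2.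
  have {}H1 := H1 ltac:(rewrite m1; nra).
  have {}H2 := H2 ltac:(rewrite m1; nra).
  near=> d; have d0 : 0 < d by [].
  have oy := oP _ d0; have oy' := oN _ d0.
  have [] : dot (1, 0) (m + d *: u) < a.1 /\ dot (1, 0) (m - d *: u) < a.1.
    by near: d; exact: H1.
  have [] : dot (-1, 0) (m + d *: u) < - b.1 /\ dot (-1, 0) (m - d *: u) < - b.1.
    by near: d; exact: H2.
  rewrite !d1 !mul1r !mulN1r !ltrN2 => h1 h2 h3 h4.
  rewrite /crossing /strip (lt_geF h3) (lt_geF h4) (lt_gtF h1) (lt_gtF h2).
  by rewrite (ltW h1) (ltW h2) h3 h4 (lt_gtF oy') oy /= ?andbF /=; lra.
(* A vertical segment is never crossed, so the [strip] terms must balance the 1: exactly one end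
   lies above the short segment joining the two points. *)
- near=> d; have d0 : 0 < d by [].
  have {}m1 : m.1 = a.1 by rewrite m1 ab1 subrr mulr0 addr0.
  have m2 : m.2 = a.2 + t * (b.2 - a.2) by rewrite /m /= !scaleRE; ring.
  have u2 : (b.2 - a.2) * u.1 < 0.
    by move: o0; rewrite orientE (_ : (m + u).1 = m.1 + u.1)// m1 ab1; lra.
  have sE c : c.1 = m.1 -> orient (m + d *: u) (m - d *: u) c =
      - (2 * d) * (u.1 * (c.2 - m.2)).
    move=> c1; rewrite orientE c1 (_ : (m + d *: u).1 = m.1 + d * u.1)//.
    rewrite (_ : (m + d *: u).2 = m.2 + d * u.2)//.
    rewrite (_ : (m - d *: u).2 = m.2 - d * u.2)//.
    by rewrite (_ : (m - d *: u).1 = m.1 - d * u.1)//; ring.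
  have y1 : (m + d *: u).1 = m.1 + d * u.1 by rewrite /= scaleRE.
  have y'1 : (m - d *: u).1 = m.1 - d * u.1 by rewrite /= scaleRE.
  have sE1 c : c.1 = m.1 ->
      strip (m + d *: u) (m - d *: u) c =
      ((0 < u.1) && (0 < c.2 - m.2))%:R - ((u.1 < 0) && (0 < c.2 - m.2))%:R.
    move=> c1; rewrite /strip sE// c1 y1 y'1 mulNr oppr_lt0 oppr_gt0.
    have d20 : 0 < 2 * d by rewrite mulr_gt0.
    rewrite pmulr_rgt0// pmulr_rlt0//.
    case: (ltrgt0P u.1) => hu.
    - have p0 : 0 < d * u.1 by rewrite mulr_gt0.
      have -> : (m.1 - d * u.1 < m.1 <= m.1 + d * u.1) by apply/andP; split; lra.
      have -> : (m.1 + d * u.1 < m.1 <= m.1 - d * u.1) = false.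
        by apply/negP => /andP[]; lra.
      by rewrite pmulr_rgt0.
    - have p0 : d * u.1 < 0 by rewrite nmulr_llt0.
      have -> : (m.1 + d * u.1 < m.1 <= m.1 - d * u.1) by apply/andP; split; lra.
      have -> : (m.1 - d * u.1 < m.1 <= m.1 + d * u.1) = false.
        by apply/negP => /andP[]; lra.
      by rewrite nmulr_rlt0.
    - by move: u2; rewrite hu mulr0 ltxx.
  rewrite !sE1 ?m1 ?ab1//.
  rewrite /crossing ab1.
  have no z : (b.1 <= z < b.1) = false by case: (leP b.1 z).
  rewrite !no !andFb m2.
  have -> : (0 < b.2 - (a.2 + t * (b.2 - a.2))) = (0 < b.2 - a.2).
    have -> : b.2 - (a.2 + t * (b.2 - a.2)) = (1 - t) * (b.2 - a.2) by ring.
    by rewrite pmulr_rgt0// subr_gt0.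
  have -> : (0 < a.2 - (a.2 + t * (b.2 - a.2))) = (b.2 - a.2 < 0).
    have -> : a.2 - (a.2 + t * (b.2 - a.2)) = t * (a.2 - b.2) by ring.
    by rewrite pmulr_rgt0// subr_gt0 subr_lt0.
  case: (ltrgt0P u.1) => hu /=.
  - have -> : b.2 - a.2 < 0 by move: u2; rewrite pmulr_llt0.
    case: ltP => /=; first by move: u2; nra.
    by move=> _; lra.
  - have h : 0 < b.2 - a.2 by move: u2; rewrite nmulr_llt0.
    by rewrite h (lt_gtF h) /=; lra.
  - by move: u2; rewrite hu mulr0 ltxx.
Unshelve. all: end_near. Qed.

(** [k i] is the signed number of times the [i]-th segment runs along the edge from [a] to [b]. The
    jump across the edge is thus its multiplicity in the cycle, the [strip] terms having
    cancelled. *)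
Lemma winding_jump a b t u (k : I -> R) : 0 < t < 1 ->
  let m := (1 - t) *: a + t *: b in
  0 < orient a b (m + u) ->
  (forall i, w i != 0 -> [\/ ~ segment (src i) (tgt i) m /\ k i = 0,
     [/\ src i = a, tgt i = b & k i = 1] |
     [/\ src i = b, tgt i = a & k i = -1]]) ->
  \forall d \near (0 : R)^'+,
    winding (m + d *: u) - winding (m - d *: u) = \sum_i w i * k i.
Proof.
move=> t01 m o0 Hk; have J := crossing_jump t01 o0; rewrite -/m in J.
have : \forall d \near (0 : R)^'+, forall i, w i != 0 ->
    crossing (src i) (tgt i) (m + d *: u) - crossing (src i) (tgt i) (m - d *: u)
    = k i + (strip (m + d *: u) (m - d *: u) (tgt i) -
             strip (m + d *: u) (m - d *: u) (src i)).
  apply: (@filter_forall _ I (fun i d => w i != 0 ->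
    crossing (src i) (tgt i) (m + d *: u) - crossing (src i) (tgt i) (m - d *: u)
    = k i + (strip (m + d *: u) (m - d *: u) (tgt i) -
             strip (m + d *: u) (m - d *: u) (src i)))) => i.
  have [wi0|wi] := eqVneq (w i) 0.
    by apply: nearW.
  have [[/segment_separation[n [c [h1 h2 h3]]] ->]|[-> -> ->]|[-> -> ->]] := Hk i wi.
  - have H := dot_near h1.
    have Hy := near_ray u H; have := near_ray (- u) H.
    apply: filterS2 Hy => d Hy Hy' _; rewrite add0r.
    by apply: crossing_strip h2 h3; rewrite // -scalerN.
  - by apply: filterS J.
  - apply: filterS J => d Jd _.
    by rewrite (crossingC a b) [crossing b a _]crossingC opprK; lra.
apply: filterS => d H.
rewrite /winding -sumrB -[RHS]addr0 -[X in _ = _ + X](cyc (strip (m + d *: u) (m - d *: u))).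
rewrite -big_split /=; apply: eq_bigr => i _.
have [->|wi] := eqVneq (w i) 0; first by rewrite !mul0r subrr addr0.
by rewrite -mulrBr H// mulrDr.
Qed.

End Cycle.

(** * Barycentric coordinates *)

Section Orientation.
Variable R : realType.
Implicit Types (a b c x y : R * R).

Lemma orient_collinear a b c : orient a b c = 0 -> collinear a b c.
Proof.
move=> o0.
have line a' d : d != 0 -> is_line [set a' + t *: d | t in [set: R]].
  by move=> d0; exists a', d.
have [ab|ab] := eqVneq a b.
  have [ac|ac] := eqVneq a c.
    exists [set a + t *: (1, 0) | t in [set: R]].
      by apply: line; apply/eqP => -[/eqP]; rewrite oner_eq0.
    by rewrite -ab -ac; split; exists 0 => //; rewrite scale0r addr0.
  exists [set a + t *: (c - a) | t in [set: R]].
    by apply: line; rewrite subr_eq0 eq_sym.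
  rewrite -ab; split; [exists 0|exists 0|exists 1] => //.
  - by rewrite scale0r addr0.
  - by rewrite scale0r addr0.
  - by rewrite scale1r addrC subrK.
exists [set a + t *: (b - a) | t in [set: R]].
  by apply: line; rewrite subr_eq0 eq_sym.
split; first by exists 0 => //; rewrite scale0r addr0.
  by exists 1 => //; rewrite scale1r addrC subrK.
move: o0 ab; rewrite orientE; case: a b c => [a1 a2] [b1 b2] [c1 c2] /= o0 ab.
have [b1a1|b1a1] := eqVneq (b1 - a1) 0.
  have b2a2 : b2 - a2 != 0.
    apply: contra ab; move: b1a1 => /eqP; rewrite !subr_eq0 => /eqP -> /eqP ->.
    by [].
  exists ((c2 - a2) / (b2 - a2)) => //.
  congr pair; rewrite /= scaleRE.
    move: o0; rewrite b1a1 mul0r sub0r mulr0 addr0 => /eqP.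
    by rewrite oppr_eq0 mulf_eq0 (negbTE b2a2) /= subr_eq0 => /eqP.
  by rewrite divfK// addrC subrK.
exists ((c1 - a1) / (b1 - a1)) => //.
congr pair; rewrite /= scaleRE; first by rewrite divfK// addrC subrK.
apply: (mulfI b1a1); move: o0 => /eqP; rewrite subr_eq0 => /eqP o0.
rewrite mulrDr mulrA [X in _ + X * _]mulrC divfK// [X in _ + X]mulrC -o0; ring.
Qed.

Lemma orient_neq a b c : orient a b c != 0 -> [/\ a != b, b != c & a != c].
Proof.
by rewrite orientE => o; split; apply: contraNneq o => ->; apply/eqP; ring.
Qed.

End Orientation.

Section Barycentric.
Variables (R : realType) (V : finType) (p : V -> R * R).
Implicit Types (T s : {set V}) (x y : R * R) (a b c v w : V).

Lemma vertices_neq a b c : orient (p a) (p b) (p c) != 0 ->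
  [/\ a != b, b != c & a != c].
Proof.
have neq d e : p d != p e -> d != e by apply: contraNneq => ->.
by move=> /orient_neq[/neq ? /neq ? /neq ?].
Qed.

Lemma sum_set3 (U : nmodType) a b c (F : V -> U) :
  a != b -> b != c -> a != c ->
  \sum_(v in [set a; b; c]%SET) F v = F a + F b + F c.
Proof.
move=> ab bc ac; rewrite finset.setUC big_setU1 /=; last first.
  by rewrite !inE negb_or ![c == _]eq_sym ac.
by rewrite big_setU1 ?inE//= big_set1 addrC.
Qed.

Lemma sum_set2 (U : nmodType) a b (F : V -> U) :
  a != b -> \sum_(v in [set a; b]%SET) F v = F a + F b.
Proof. by move=> ab; rewrite big_setU1 ?inE//= big_set1. Qed.

(** A ratio of areas; by [baryE] the choice made by [pick] does not matter. The default 0 outside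
    [T] lets conditions on coordinates range over all of [V]. *)
Definition bary T v x : R :=
  if [pick bc : V * V | (T == [set v; bc.1; bc.2]%SET) &&
        (orient (p v) (p bc.1) (p bc.2) != 0)] is Some (b, c)
  then orient x (p b) (p c) / orient (p v) (p b) (p c) else 0.

Lemma baryE a b c x : orient (p a) (p b) (p c) != 0 ->
  bary [set a; b; c]%SET a x = orient x (p b) (p c) / orient (p a) (p b) (p c).
Proof.
move=> o; rewrite /bary; case: pickP => [[b' c'] /= /andP[/eqP E o']|]; last first.
  by move=> /(_ (b, c)); rewrite /= eqxx o.
have [ab bc ac] := vertices_neq o.
have [ab' bc' ac'] := vertices_neq o'.
have : b \in [set a; b'; c']%SET by rewrite -E !inE eqxx orbT.
have : c \in [set a; b'; c']%SET by rewrite -E !inE eqxx orbT.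
rewrite !inE ![_ == a]eq_sym (negbTE ab) (negbTE ac) /=.
move=> /orP[]/eqP cE /orP[]/eqP bE; try by move: bc; rewrite bE cE eqxx.
  have sw z : orient z (p b') (p c') = - orient z (p c') (p b').
    by rewrite !orientE; ring.
  by rewrite bE cE !sw invrN mulrNN.
by rewrite bE cE.
Qed.

Lemma set3_rot a b c : [set a; b; c]%SET = [set b; c; a]%SET.
Proof. by rewrite [RHS]finset.setUC finset.setUA. Qed.

Lemma bary3E a b c x : orient (p a) (p b) (p c) != 0 ->
  [/\ bary [set a; b; c]%SET a x = orient x (p b) (p c) / orient (p a) (p b) (p c),
      bary [set a; b; c]%SET b x = orient x (p c) (p a) / orient (p a) (p b) (p c) &
      bary [set a; b; c]%SET c x = orient x (p a) (p b) / orient (p a) (p b) (p c)].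
Proof.
move=> o; split; first exact: baryE.
  by rewrite set3_rot baryE -?(orient_rot (p a)).
by rewrite -set3_rot baryE (orient_rot (p c)).
Qed.

Lemma bary0 T v x : v \notin T -> bary T v x = 0.
Proof.
move=> vT; rewrite /bary; case: pickP => // -[b c] /= /andP[/eqP E _].
by case/negP: vT; rewrite E !inE eqxx.
Qed.

Lemma bary_affine T v : exists n k, forall x, bary T v x = dot n x + k.
Proof.
rewrite /bary; case: pickP => [[b c] _|_]; last first.
  by exists 0, 0 => x; rewrite /dot /= !mul0r !addr0.
set o := orient _ _ _.
exists (((p b).2 - (p c).2) / o, ((p c).1 - (p b).1) / o),
  (((p b).1 * (p c).2 - (p b).2 * (p c).1) / o) => x.
by rewrite orientE /dot /=; ring.
Qed.

Lemma bary_line T v x y t :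
  bary T v ((1 - t) *: x + t *: y) = (1 - t) * bary T v x + t * bary T v y.
Proof.
have [n [k E]] := bary_affine T v; rewrite !E /dot /= !scaleRE; ring.
Qed.

Lemma bary_ray T v x y d :
  bary T v (x + d *: (y - x)) = bary T v x + d * (bary T v y - bary T v x).
Proof.
have -> : x + d *: (y - x) = (1 - d) *: x + d *: y.
  by rewrite scalerBl scale1r scalerBr addrAC addrA.
by rewrite bary_line; ring.
Qed.

Lemma bary_continuous T v : continuous (bary T v).
Proof.
have [n [k E]] := bary_affine T v.
rewrite (_ : bary T v = fun x => dot n x + k); last by apply/funext.
move=> x; apply: cvgD; first exact: dot_continuous.
exact: cvg_cst.
Qed.

Lemma near_bary_gt T v x k : k < bary T v x -> \forall y \near x, k < bary T v y.
Proof. by move=> h; apply: (cvgr_gt _ (@bary_continuous T v x)). Qed.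

Section Triangle.
Variable T : {set V}.
Hypothesis Ttri : is_triangle p T.

Lemma triangleP : exists a b c, T = [set a; b; c]%SET /\
  0 < orient (p a) (p b) (p c).
Proof.
have [a [b [c [-> nc]]]] := Ttri.
have : orient (p a) (p b) (p c) != 0 by apply/eqP => /orient_collinear.
rewrite neq_lt => /orP[o|o]; last by exists a, b, c.
exists b, a, c; split; first by rewrite [[set b; a]%SET]finset.setUC.
by rewrite orient_swap oppr_gt0.
Qed.

Lemma triangle_vertex v : v \in T -> exists b c, T = [set v; b; c]%SET /\
  0 < orient (p v) (p b) (p c).
Proof.
have [a [b [c [-> o]]]] := triangleP.
rewrite !inE -orbA => /or3P[]/eqP ->; first by exists b, c.
  by exists c, a; rewrite -orient_rot set3_rot.
by exists a, b; rewrite orient_rot -set3_rot.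
Qed.

Lemma triangle_edge v w : v \in T -> w \in T -> v != w ->
  exists c, T = [set v; w; c]%SET /\ orient (p v) (p w) (p c) != 0.
Proof.
move=> /triangle_vertex[b [c [-> o]]].
rewrite !inE -orbA => /or3P[]/eqP-> ; first by rewrite eqxx.
  by exists c; rewrite gt_eqF.
exists b; rewrite finset.setUAC -orient_rot orient_swap orient_rot.
by rewrite oppr_eq0 -orient_rot gt_eqF.
Qed.

Lemma sum_bary x : \sum_(v in T) bary T v x = 1.
Proof.
have [a [b [c [-> o]]]] := triangleP; have o0 := lt0r_neq0 o.
have [ab bc ac] := vertices_neq o0.
rewrite sum_set3//; have [-> -> ->] := bary3E x o0.
by rewrite -!mulrDl; apply: (mulIf o0); rewrite divfK// mul1r !orientE; ring.
Qed.

Lemma bary_combination x : \sum_(v in T) bary T v x *: p v = x.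
Proof.
have [a [b [c [-> o]]]] := triangleP; have o0 := lt0r_neq0 o.
have [ab bc ac] := vertices_neq o0.
rewrite sum_set3//; have [-> -> ->] := bary3E x o0.
move: o0; rewrite !orientE.
case: (p a) (p b) (p c) x => [a1 a2] [b1 b2] [c1 c2] [x1 x2] /= o0.
by congr pair; rewrite /= !scaleRE; field.
Qed.

Lemma bary_uniq (l : V -> R) x : \sum_(v in T) l v = 1 ->
  x = \sum_(v in T) l v *: p v -> forall v, v \in T -> l v = bary T v x.
Proof.
move=> l1 xE v /triangle_vertex[b [c [TE o]]]; have o0 := lt0r_neq0 o.
have [ab bc ac] := vertices_neq o0.
move: l1 xE; rewrite TE !sum_set3// baryE// => l1 ->.
apply: (mulIf o0); rewrite divfK// !orientE.
have -> : l v = 1 - l b - l c by rewrite -l1; ring.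
rewrite /= !scaleRE; ring.
Qed.

Lemma simplex_bary s x : s \subset T ->
  simplex p s x <-> (forall v, 0 <= bary T v x) /\
                    (forall v, v \notin s -> bary T v x = 0).
Proof.
move=> sT; split=> [[l [l0 l1 xE]]|[b0 bs]].
  (* The weights [l] need not vanish outside [s]; they are set to 0 there so that uniqueness of
     barycentric coordinates in [T] applies. *)
  pose l' v := if v \in s then l v else 0.
  have l'E v : v \in T -> l' v = bary T v x.
    apply: bary_uniq.
      by rewrite -l1 [LHS](big_setID s) /= (finset.setIidPr sT)
        [X in _ + X]big1 ?addr0 => [|w]; rewrite ?inE /l';
        [apply: eq_bigr => w ->|move=> /andP[/negbTE ->]].
    rewrite xE [RHS](big_setID s) /= (finset.setIidPr sT).
    rewrite [X in _ + X]big1 ?addr0 => [|w]; rewrite ?inE /l'.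
      by apply: eq_bigr => w ->.
    by move=> /andP[/negbTE ->]; rewrite scale0r.
  split => v; have [vT|vT] := boolP (v \in T).
  - by rewrite -l'E// /l'; case: ifP.
  - by rewrite bary0.
  - by move=> vs; rewrite -l'E// /l' (negbTE vs).
  - by move=> _; rewrite bary0.
exists (fun v => bary T v x); split => //.
  rewrite -(sum_bary x) [RHS](big_setID s) /= (finset.setIidPr sT).
  by rewrite [X in _ + X]big1 ?addr0// => w; rewrite inE => /andP[/bs].
rewrite -{1}(bary_combination x) [LHS](big_setID s) /= (finset.setIidPr sT).
rewrite [X in _ + X]big1 ?addr0// => w; rewrite inE => /andP[/bs ->].
by rewrite scale0r.
Qed.

Lemma triangle_bary x : simplex p T x <-> forall v, 0 <= bary T v x.
Proof.
split => [/(simplex_bary x (subxx T))[]//|b0].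
by apply/(simplex_bary x (subxx T)); split => // v; exact: bary0.
Qed.

Lemma bary_vertex v w : v \in T -> w \in T -> bary T v (p w) = (v == w)%:R.
Proof.
move=> vT wT; have E F : \sum_(u in T) (u == w)%:R *: F u = F w :> R.
  rewrite (bigD1 w)//= eqxx scale1r big1 ?addr0// => u /andP[_ /negbTE ->].
  by rewrite scale0r.
rewrite -(@bary_uniq (fun v => (v == w)%:R))//.
  rewrite -[RHS](E (fun=> 1)); apply: eq_bigr => u _.
  by rewrite scaleRE mulr1.
rewrite (bigD1 w)//= eqxx scale1r big1 ?addr0// => u /andP[_ /negbTE ->].
by rewrite scale0r.
Qed.

Lemma closed_triangle : closed (simplex p T).
Proof.
have -> : simplex p T = \bigcap_(v in [set: V]) [set x | 0 <= bary T v x].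
  apply/seteqP; split => x; first by move=> /triangle_bary b0 v _; exact: b0.
  by move=> h; apply/triangle_bary => v; exact: h.
apply: closed_bigI => v _.
have -> : [set x | 0 <= bary T v x] = bary T v @^-1` [set r | 0 <= r] by [].
by apply: closed_comp; [move=> x _; exact: bary_continuous|exact: closed_ge].
Qed.

Lemma open_triangle_bary x :
  (simplex p T)° x <-> forall v, v \in T -> 0 < bary T v x.
Proof.
split => [xi v vT|b0].
  have /triangle_bary b0 : simplex p T x by exact: interior_subset.
  rewrite lt_neqAle b0 andbT eq_sym; apply/negP => /eqP bv.
  (* If the coordinate of [v] vanished, moving away from [p v] would make it negative at once. *)
  have := near_ray (- (p v - x)) xi.
  have : \forall d \near (0 : R)^'+, 0 < d by exact: nbhs_right_gt.
  move=> h1 h2; have [d [d0 /triangle_bary/(_ v)]] := @filter_ex _ _ _ _ (filterI h1 h2).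
  rewrite scalerN -scaleNr bary_ray bv bary_vertex// eqxx add0r subr0 mulr1.
  by rewrite oppr_ge0 leNgt d0.
rewrite /interior; have : \forall y \near x, forall v, v \in T -> 0 < bary T v y.
  apply: (@filter_forall _ V (fun v y => v \in T -> 0 < bary T v y) (nbhs x) _) => v.
  case: (boolP (v \in T)) => vT; last by apply: nearW.
  by have := near_bary_gt (b0 v vT); apply: filterS.
apply: filterS => y h; apply/triangle_bary => v.
by have [/h/ltW//|vT] := boolP (v \in T); rewrite bary0.
Qed.

End Triangle.
End Barycentric.

(** * Polygonal regions *)

Section Region.
Variable R : realType.
Implicit Types (a b c m u x y : R * R).

Lemma pair_ext x y : x.1 = y.1 -> x.2 = y.2 -> x = y.
Proof. by case: x y => [? ?] [? ?] /= -> ->. Qed.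

Lemma segment_orient a b x : segment a b x -> orient a b x = 0.
Proof. by move=> [t _ <-]; rewrite orientE /= !scaleRE; ring. Qed.

Lemma segment_left a b : segment a b a.
Proof.
exists 0; first by rewrite /= lexx ler01.
by rewrite subr0 scale1r scale0r addr0.
Qed.

Lemma segment_right a b : segment a b b.
Proof.
exists 1; first by rewrite /= lexx ler01.
by rewrite subrr scale0r scale1r add0r.
Qed.

Lemma orient_normal a b : a != b -> exists u, forall t,
  0 < orient a b ((1 - t) *: a + t *: b + u).
Proof.
move=> ab; exists (- (b - a).2, (b - a).1) => t.
have : 0 < (b.1 - a.1) ^+ 2 + (b.2 - a.2) ^+ 2.
  rewrite lt_neqAle addr_ge0 ?sqr_ge0// andbT eq_sym.
  apply: contra ab; rewrite paddr_eq0 ?sqr_ge0// !sqrf_eq0 !subr_eq0.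
  by case: a b => [? ?] [? ?] /= /andP[/eqP -> /eqP ->].
by rewrite orientE /= !scaleRE => h; apply: (lt_le_trans h); rewrite !expr2; lra.
Qed.

Section Polygon.
Variables (n : nat) (q : 'I_n -> R * R).
Hypothesis sq : simple_polygon q.

Let n3 : (3 <= n)%N. Proof. by case: sq. Qed.
Let qinj : injective q. Proof. by case: sq. Qed.

Lemma ordS_neq (i : 'I_n) : ordS i != i.
Proof.
apply/eqP => /(congr1 val) /=; case: (ltngtP i.+1 n) => h.
- by rewrite modn_small// => /eqP; rewrite gtn_eqF.
- by have := ltn_ord i; rewrite ltnNge -ltnS h.
- by rewrite h modnn => i0; move: n3; rewrite -h -i0.
Qed.

Lemma polygon_cycle :
  weighted_cycle (fun=> 1) q (fun i => q (ordS i)).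
Proof.
move=> f; under eq_bigr do rewrite mul1r.
rewrite sumrB; apply/eqP; rewrite subr_eq0; apply/eqP.
by rewrite [RHS](reindex _ (onW_bij _ (@ordS_bij n))).
Qed.

Lemma polygon_relative_interior i j t : 0 < t < 1 ->
  segment (q j) (q (ordS j)) ((1 - t) *: q i + t *: q (ordS i)) -> j = i.
Proof.
move=> /andP[t0 t1] sj; apply/eqP; case: eqVneq => // ji.
have [_ _ /(_ i j)] := sq; rewrite eq_sym => /(_ ji) H.
have [|+ _] := H ((1 - t) *: q i + t *: q (ordS i)).
  by split => //; exists t; rewrite //= !ltW.
have ne : q (ordS i) - q i != 0.
  by rewrite subr_eq0; apply: contraNneq (ordS_neq i) => /qinj ->.
have -> : (1 - t) *: q i + t *: q (ordS i) = q i + t *: (q (ordS i) - q i).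
  by apply: pair_ext; rewrite /= !scaleRE; ring.
move=> [|] /eqP; rewrite -subr_eq0.
  by rewrite addrC addKr scaler_eq0 (negbTE ne) gt_eqF.
have -> : q i + t *: (q (ordS i) - q i) - q (ordS i) =
          (t - 1) *: (q (ordS i) - q i).
  by apply: pair_ext; rewrite /= !scaleRE; ring.
by rewrite scaler_eq0 (negbTE ne) subr_eq0 lt_eqF.
Qed.

(** At a vertex the two rays follow the next and the previous edge; elsewhere they are the two
    directions of the only edge through [x]. Containment in two rays is what later bounds the number
    of boundary edges at a mesh vertex. *)
Lemma polygon_germ x : polygon q x -> exists d1 d2,
  \forall y \near x, polygon q y ->
    exists2 t, 0 <= t & y = x + t *: d1 \/ y = x + t *: d2.
Proof.
move=> [i _ si].
have near_seg : \forall y \near x, forall j, segment (q j) (q (ordS j)) y ->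
    segment (q j) (q (ordS j)) x.
  apply: (@filter_forall _ _ (fun j y => segment (q j) (q (ordS j)) y ->
    segment (q j) (q (ordS j)) x) (nbhs x) _) => j.
  have [?|nx] := pselect (segment (q j) (q (ordS j)) x); first exact: nearW.
  have : nbhs x (~` segment (q j) (q (ordS j))).
    by apply: open_nbhs_nbhs; split => //; apply: closed_openC; exact: closed_segment.
  by apply: filterS.
have [[j xj]|nv] := pselect (exists j, x = q j).
  exists (q (ordS j) - q j), (q (ord_pred j) - q j).
  apply: filterS near_seg => y h [l _ sl].
  have slx := h _ sl; case: sl => t /= /andP[t0 t1] <-.
  have [lj|lj] := eqVneq l j.
    exists t => //; left; rewrite lj xj.
    by apply: pair_ext; rewrite /= !scaleRE; ring.
  have [_ _ /(_ l j lj) H] := sq.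
  have [|+ _] := H x; first by rewrite xj; split; [rewrite -xj|exact: segment_left].
  rewrite xj => -[/qinj/eqP|/qinj jl]; first by rewrite eq_sym (negbTE lj).
  exists (1 - t); first by rewrite subr_ge0.
  right; rewrite jl ordSK -jl.
  by apply: pair_ext; rewrite /= !scaleRE; ring.
have i0 j : segment (q j) (q (ordS j)) x -> j = i.
  move=> sj; apply/eqP; case: eqVneq => // ji.
  have [_ _ /(_ j i ji) H] := sq; have [|[xj|xj] _] := H x => //.
    by case: nv; exists j.
  by case: nv; exists (ordS j).
case: si => t /= /andP[t0 t1] xE.
exists (q (ordS i) - q i), (q i - q (ordS i)).
apply: filterS near_seg => y h [l _ sl].
have li := i0 _ (h _ sl); case: sl => s /= /andP[s0 s1] <-; rewrite li.
have E : (1 - s) *: q i + s *: q (ordS i) = x + (s - t) *: (q (ordS i) - q i).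
  rewrite -xE; case: (q i) (q (ordS i)) => [a1 a2] [b1 b2].
  by congr pair; rewrite /= !scaleRE; ring.
have [st|st] := leP t s.
  by exists (s - t); [rewrite subr_ge0|left].
exists (t - s); first by rewrite subr_ge0 ltW.
by right; rewrite E -(opprB (q i)) scalerN -scaleNr opprB.
Qed.

Lemma connected_polygon : connected (polygon q).
Proof.
have -> : polygon q =
    \bigcup_(i in [set i : 'I_n | (i < n)%N]) segment (q i) (q (ordS i)).
  by apply/seteqP; split => x [i _ si]; exists i => //=.
suff H k : (k <= n)%N -> (0 < k)%N ->
    connected (\bigcup_(i in [set i : 'I_n | (i < k)%N]) segment (q i) (q (ordS i))).
  by apply: H => //; apply: leq_trans n3.
elim: k => // -[|k] IH kn _.
  have -> : [set i : 'I_n | (i < 1)%N] = [set Ordinal kn].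
    apply/seteqP; split => i /=; last by move=> ->.
    by rewrite ltnS leqn0 => /eqP i0; apply/val_inj.
  rewrite bigcup_set1; exact: connected_segment.
have k1n : (k < n)%N by exact: ltnW.
have -> : [set i : 'I_n | (i < k.+2)%N] =
    [set i : 'I_n | (i < k.+1)%N] `|` [set Ordinal kn].
  apply/seteqP; split => i /=.
    rewrite ltnS leq_eqVlt => /orP[/eqP ik|]; last by left.
    by right; apply/val_inj.
  by move=> [ik|->] //=; exact: ltnW.
rewrite bigcup_setU bigcup_set1; apply: connectedU; last 2 first.
- by apply: IH => //; exact: ltnW.
- exact: connected_segment.
exists (q (Ordinal kn)); split; last exact: segment_left.
exists (Ordinal k1n) => //=.
have -> : Ordinal kn = ordS (Ordinal k1n).
  by apply/val_inj; rewrite /= modn_small.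
exact: segment_right.
Qed.

Section Inside.
Variable Omega : set (R * R).
Hypothesis (oO : open Omega) (cO : connected Omega).
Hypothesis bO : boundary Omega = polygon q.

Lemma boundary_notin x : polygon q x -> ~ Omega x.
Proof. by rewrite -bO => -[_]; rewrite (interior_id Omega).1. Qed.

Lemma closureP x : closure Omega x <-> Omega x \/ polygon q x.
Proof.
rewrite -bO; split => [cx|[ox|[]//]]; last exact: subset_closure.
have [ox|nx] := pselect (Omega x); first by left.
by right; split; rewrite ?(interior_id Omega).1.
Qed.

Lemma winding_constant x y : Omega x -> Omega y ->
  winding (fun=> 1) q (fun i => q (ordS i)) x =
  winding (fun=> 1) q (fun i => q (ordS i)) y.
Proof.
apply: locally_constant_connected cO _ _ _ => z oz.
have := winding_near polygon_cycle (x := z) _.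
move=> H; apply: filterS (H _) => [t -> //|i _ si].
by apply: boundary_notin oz; exists i.
Qed.

(* A small segment crossing one edge of the polygon changes the winding       *)
(* number by one, so it cannot have both ends in the connected set [Omega].   *)
Lemma interior_closure : (closure Omega)° `<=` Omega.
Proof.
move=> x0 x0i; have [//|x0O] := pselect (Omega x0).
have /closureP[//|[i _ si]] := interior_subset x0i.
(* [x0] is moved along its edge towards the midpoint, to a point through which no other edge
   passes. *)
have [t t01 mi] : exists2 t, 0 < t < 1 &
    (closure Omega)° ((1 - t) *: q i + t *: q (ordS i)).
  case: si => s /= /andP[s0 s1] xE.
  have : nbhs x0 (closure Omega)°.
    by apply: open_nbhs_nbhs; split => //; exact: open_interior.
  move=> /(@near_ray _ _ ((1 / 2 - s) *: (q (ordS i) - q i))) h.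
  have h0 : \forall d \near (0 : R)^'+, 0 < d by exact: nbhs_right_gt.
  have h1 : \forall d \near (0 : R)^'+, d < 1 by exact: nbhs_right_lt.
  have [d [[d0 d1] di]] := @filter_ex _ _ _ _ (filterI (filterI h0 h1) h).
  exists (s + d * (1 / 2 - s)); first by apply/andP; split; nra.
  move: di; rewrite -xE; congr (_ _); case: (q i) (q (ordS i)) => [a1 a2] [b1 b2].
  by congr pair; rewrite /= !scaleRE; ring.
have ab : q i != q (ordS i).
  by apply: contraNneq (ordS_neq i) => /qinj {2}->.
have [u /(_ t) o0] := orient_normal ab.
set m := _ + t *: _ in mi o0.
have J := winding_jump polygon_cycle (k := fun j => (j == i)%:R) t01 o0 _.
have {J} J : \forall d \near (0 : R)^'+,
    winding (fun=> 1) q (fun i => q (ordS i)) (m + d *: u) -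
    winding (fun=> 1) q (fun i => q (ordS i)) (m - d *: u) = 1.
  apply: filterS (J _) => [d ->|j _].
    rewrite (bigD1 i)//= eqxx mulr1 big1 ?addr0// => j /negbTE ->.
    by rewrite mulr0.
  have [->|ji] := eqVneq j i; first by constructor 2.
  constructor 1; split => // /(polygon_relative_interior t01) /eqP.
  by rewrite (negbTE ji).
have orE d : orient (q i) (q (ordS i)) (m + d *: u) =
    d * orient (q i) (q (ordS i)) (m + u).
  by rewrite /m !orientE /= !scaleRE; ring.
(* Near [m] the polygon stays on the line of the edge [i], so points of the closure off this line
   belong to [Omega]. *)
have off v : (forall d, 0 < d -> orient (q i) (q (ordS i)) (m + d *: v) != 0) ->
    \forall d \near (0 : R)^'+, Omega (m + d *: v).
  move=> ov; have : nbhs m [set y | closure Omega y /\ forall j, j != i ->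
      ~ segment (q j) (q (ordS j)) y].
    apply: filterI; first exact: mi.
    apply: (@filter_forall _ _ (fun j y => j != i -> ~ segment (q j) (q (ordS j)) y)
      (nbhs m) _) => j.
    have [->|ji] := eqVneq j i; first exact: nearW.
    have : nbhs m (~` segment (q j) (q (ordS j))).
      apply: open_nbhs_nbhs; split.
        by apply: closed_openC; exact: closed_segment.
      by move=> /(polygon_relative_interior t01)/eqP; rewrite (negbTE ji).
    by apply: filterS.
  move=> /(@near_ray _ _ v) h.
  have h0 : \forall d \near (0 : R)^'+, 0 < d by exact: nbhs_right_gt.
  apply: filterS2 h h0 => d [/closureP[//|[j _ sj]] /(_ j) nj] /ov.
  have [ji|/nj//] := eqVneq j i.
  by rewrite -ji segment_orient ?eqxx// ji -ji.
have h0 : \forall d \near (0 : R)^'+, Omega (m + d *: u).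
  by apply: off => d d0; rewrite orE mulf_neq0 ?gt_eqF.
have h1 : \forall d \near (0 : R)^'+, Omega (m + d *: - u).
  by apply: off => d d0; rewrite scalerN -scaleNr orE mulf_neq0 ?oppr_eq0 ?gt_eqF.
have [d [[Jd]]] := @filter_ex _ _ _ _ (filterI (filterI J h0) h1).
move=> /winding_constant H /H; rewrite scalerN => wE.
by move: Jd; rewrite wE subrr => /eqP; rewrite eq_sym oner_eq0.
Qed.

End Inside.
End Polygon.
End Region.

(** * Triangulations *)

Section Mesh.
Variables (R : realType) (V : finType) (p : V -> R * R) (Th : {set {set V}}).
Variable Omega : set (R * R).
Hypothesis tr : triangulation p Th Omega.
Hypothesis reg : polygonal_region_no_holes Omega.
Implicit Types (T s e : {set V}) (x y u : R * R) (a b c v w : V).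

Lemma mesh_inj : injective p. Proof. by case: tr. Qed.

Lemma mesh_triangle T : T \in Th -> is_triangle p T.
Proof. by case: tr => _ _ h _ _; exact: h. Qed.

Lemma closure_mesh x : closure Omega x <-> exists2 T, T \in Th & simplex p T x.
Proof.
case: tr => _ _ _ _ ->; split => [[T TT sx]|[T TT sx]]; first by exists T.
by exists T.
Qed.

Lemma vertex_mesh v : exists2 T, T \in Th & v \in T.
Proof.
case: tr => _ cov _ _ _; have : v \in [set: V]%SET by rewrite inE.
by rewrite -cov => /bigcupP[T TT vT]; exists T.
Qed.

Lemma region_open : open Omega. Proof. by case: reg. Qed.

Lemma region_connected : connected Omega. Proof. by case: reg. Qed.

Lemma region_boundary_connected : connected (boundary Omega).
Proof. by case: reg => _ _ [n [q [sq ->]]]; exact: connected_polygon. Qed.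

Lemma region_closureP x : closure Omega x <-> Omega x \/ boundary Omega x.
Proof.
case: reg => oO cO [n [q [sq bO]]]; rewrite bO.
exact: (closureP oO bO).
Qed.

Lemma region_boundary_notin x : boundary Omega x -> ~ Omega x.
Proof.
case: reg => oO cO [n [q [sq bO]]]; rewrite bO.
exact: (boundary_notin oO bO).
Qed.

Lemma region_interior_closure : (closure Omega)° `<=` Omega.
Proof.
case: reg => oO cO [n [q [sq bO]]]; exact: (interior_closure sq oO cO bO).
Qed.

Lemma region_germ x : boundary Omega x -> exists d1 d2,
  \forall y \near x, boundary Omega y ->
    exists2 t, 0 <= t & y = x + t *: d1 \/ y = x + t *: d2.
Proof.
by case: reg => oO cO [n [q [sq ->]]]; exact: polygon_germ.
Qed.

(** By conformity [x] lies in the common face; the coordinates in either triangle are those of this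
    face, and vanish outside it. *)
Lemma bary_eq T T' x v : T \in Th -> T' \in Th -> simplex p T x ->
  simplex p T' x -> bary p T v x = bary p T' v x.
Proof.
move=> TT TT' sT sT'; have [->//|TT'n] := eqVneq T T'.
case: tr => _ _ _ conf _; have := conf _ _ TT TT' TT'n.
move=> /seteqP[/(_ x (conj sT sT')) sI _].
have tT := mesh_triangle TT; have tT' := mesh_triangle TT'.
have [vI|vI] := boolP (v \in (T :&: T')%SET); last first.
  by rewrite ((simplex_bary tT x (finset.subsetIl _ _)).1 sI).2//
    ((simplex_bary tT' x (finset.subsetIr _ _)).1 sI).2.
have [l [l0 l1 xE]] := sI.
pose l' v := if v \in (T :&: T')%SET then l v else 0.
have l'E S : S \in Th -> (T :&: T' \subset S)%SET ->
    forall w, w \in S -> l' w = bary p S w x.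
  move=> SS IS; apply: bary_uniq; first exact: mesh_triangle.
    rewrite -l1 [LHS](big_setID (T :&: T')%SET) /= (finset.setIidPr IS).
    rewrite [X in _ + X]big1 ?addr0 => [|w]; rewrite ?inE /l'.
      by apply: eq_bigr => w ->.
    by move=> /andP[]; rewrite !inE => /negbTE ->.
  rewrite {1}xE [RHS](big_setID (T :&: T')%SET) /= (finset.setIidPr IS).
  rewrite [X in _ + X]big1 ?addr0 => [|w]; rewrite ?inE /l'.
    by apply: eq_bigr => w ->.
  by move=> /andP[]; rewrite !inE => /negbTE ->; rewrite scale0r.
move: vI; rewrite inE => /andP[vT vT'].
by rewrite -!l'E// ?finset.subsetIl ?finset.subsetIr.
Qed.

(** The piecewise linear hat function of [v], equal to 0 off the mesh; by [bary_eq] any triangle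
    containing [x] may be used. *)
Definition hat v x : R :=
  if [pick T in Th | `[< simplex p T x >]] is Some T then bary p T v x else 0.

(** For [x] in the mesh, the vertex set of the smallest face containing [x]. Incidence of points and
    faces becomes inclusion of finite sets. *)
Definition carrier x : {set V} := [set v | 0 < hat v x]%SET.

Lemma hatE T v x : T \in Th -> simplex p T x -> hat v x = bary p T v x.
Proof.
move=> TT sT; rewrite /hat; case: pickP => [T'|/(_ T)].
  by move=> /andP[TT' /asboolP sT']; exact: bary_eq.
by rewrite TT => /asboolP.
Qed.

Lemma hat_ge0 v x : 0 <= hat v x.
Proof.
rewrite /hat; case: pickP => // T /andP[TT /asboolP].
by move=> /(triangle_bary (mesh_triangle TT)).
Qed.

Lemma carrier_sub T x : T \in Th -> simplex p T x -> carrier x \subset T.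
Proof.
move=> TT sT; apply/fintype.subsetP => v; rewrite inE (hatE _ TT)//.
by case: (boolP (v \in T)) => // vT; rewrite bary0// ltxx.
Qed.

Lemma hat_carrier v x : v \notin carrier x -> hat v x = 0.
Proof. by rewrite inE -leNgt => h; apply/eqP; rewrite eq_le h hat_ge0. Qed.

Lemma sum_hat T x : T \in Th -> simplex p T x -> \sum_(v in T) hat v x = 1.
Proof.
move=> TT sT; rewrite -(sum_bary (mesh_triangle TT) x).
by apply: eq_bigr => v _; exact: hatE.
Qed.

Lemma simplex_carrier T s x : T \in Th -> s \subset T ->
  simplex p s x <-> closure Omega x /\ carrier x \subset s.
Proof.
move=> TT sT; have tT := mesh_triangle TT; split => [sx|[]].
  have [b0 bs] := (simplex_bary tT x sT).1 sx.
  have sTx : simplex p T x by apply/(triangle_bary tT).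
  split; first by apply/closure_mesh; exists T.
  apply/fintype.subsetP => v; rewrite inE (hatE _ TT)//.
  by case: (boolP (v \in s)) => // /bs ->; rewrite ltxx.
move=> /closure_mesh[T' TT' sT'] cs; exists (fun v => hat v x).
have tT' := mesh_triangle TT'; have cT' := carrier_sub TT' sT'.
have sums (U : nmodType) (F : V -> U) : (forall v, v \notin carrier x -> F v = 0) ->
    \sum_(v in T') F v = \sum_(v in s) F v.
  move=> F0; rewrite (big_setID (carrier x)) /= (finset.setIidPr cT') [RHS](big_setID (carrier x)) /=.
  rewrite (finset.setIidPr cs) [X in _ + X = _]big1 => [|v].
    rewrite [X in _ = _ + X]big1 => // v.
    by rewrite inE => /andP[/F0].
  by rewrite inE => /andP[/F0].
split => [v||]; first exact: hat_ge0.
  by rewrite -(sum_hat TT' sT') [RHS]sums// => v; exact: hat_carrier.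
rewrite -[LHS](bary_combination tT' x) -[RHS]sums => [|v /hat_carrier ->].
  by apply: eq_bigr => v _; rewrite (hatE _ TT').
by rewrite scale0r.
Qed.

Lemma triangle_carrier T x : T \in Th ->
  simplex p T x <-> closure Omega x /\ carrier x \subset T.
Proof. by move=> TT; exact: (simplex_carrier x TT (subxx T)). Qed.

Lemma carrier_vertex v : closure Omega (p v) /\ carrier (p v) = [set v]%SET.
Proof.
have [T TT vT] := vertex_mesh v.
have tT := mesh_triangle TT.
have sv : simplex p T (p v).
  apply/(triangle_bary tT) => w; have [wT|wT] := boolP (w \in T).
    by rewrite bary_vertex// ler0n.
  by rewrite bary0.
split; first by apply/closure_mesh; exists T.
apply/setP => w; rewrite !inE (hatE _ TT)//.
have [wT|wT] := boolP (w \in T); first by rewrite bary_vertex// ltr0n lt0b.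
by rewrite bary0// ltxx; apply/esym; apply: contraNF wT => /eqP ->.
Qed.

Lemma vertex_simplex T s v : T \in Th -> s \subset T ->
  simplex p s (p v) <-> v \in s.
Proof.
move=> TT sT; rewrite (simplex_carrier _ TT sT); have [cv ->] := carrier_vertex v.
by rewrite finset.sub1set; split => [[]|].
Qed.

Lemma carrier1 v x : closure Omega x -> carrier x = [set v]%SET -> x = p v.
Proof.
move=> /closure_mesh[T TT sT] cx; have tT := mesh_triangle TT.
have vT : v \in T by rewrite -finset.sub1set -cx carrier_sub.
have h0 w : w != v -> bary p T w x = 0.
  by move=> wv; rewrite -(hatE _ TT)// hat_carrier// cx inE.
rewrite -(bary_combination tT x) (bigD1 v)//= big1 ?addr0 => [|w /andP[_ /h0 ->]].
  have := sum_bary tT x; rewrite (bigD1 v)//= big1 ?addr0 => [->|w /andP[_ /h0 ->//]].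
  by rewrite scale1r.
by rewrite scale0r.
Qed.

Lemma carrier_neq0 x : closure Omega x -> carrier x != finset.set0.
Proof.
move=> /closure_mesh[T TT sT]; apply/eqP => c0.
have := sum_hat TT sT; rewrite big1 => [|v _].
  by move=> /eqP; rewrite eq_sym oner_eq0.
by rewrite hat_carrier// c0 inE.
Qed.

Lemma near_mesh x : \forall y \near x, forall T, T \in Th ->
  simplex p T y -> simplex p T x.
Proof.
apply: (@filter_forall _ _ (fun T y => T \in Th -> simplex p T y -> simplex p T x)
  (nbhs x) _) => T.
have [TT|TT] := boolP (T \in Th); last exact: nearW.
have [sx|nx] := pselect (simplex p T x); first exact: nearW.
have : nbhs x (~` simplex p T).
  apply: open_nbhs_nbhs; split => //; apply: closed_openC.
  exact: closed_triangle (mesh_triangle TT).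
by apply: filterS.
Qed.

Lemma triangle_card T : T \in Th -> #|T| = 3.
Proof.
move=> /mesh_triangle/triangleP[a [b [c [-> o]]]].
have [ab bc ac] := vertices_neq (lt0r_neq0 o).
by rewrite -sum1_card sum_set3.
Qed.

Lemma interior_carrier T x : T \in Th ->
  (simplex p T)° x <-> closure Omega x /\ carrier x = T.
Proof.
move=> TT; have tT := mesh_triangle TT; split => [xi|[/closure_mesh[T' TT' sT'] cx]].
  have sT := interior_subset xi; split; first by apply/closure_mesh; exists T.
  apply/eqP; rewrite finset.eqEsubset carrier_sub//; apply/fintype.subsetP => v vT.
  by rewrite inE (hatE _ TT)//; exact: (open_triangle_bary tT x).1.
have T'T : T' = T.
  apply/esym/eqP; rewrite eqEcard !triangle_card// leqnn andbT -cx.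
  exact: carrier_sub.
apply/(open_triangle_bary tT) => v vT; rewrite -(hatE v TT); last by rewrite -T'T.
by move: vT; rewrite -{1}cx inE.
Qed.

Lemma interior_region T x : T \in Th -> (simplex p T)° x -> Omega x.
Proof.
move=> TT xi; apply: region_interior_closure; move: xi; apply: interiorS => y sy.
by apply/closure_mesh; exists T.
Qed.

Lemma bary_third T a b c x : T \in Th -> T = [set a; b; c]%SET ->
  orient (p a) (p b) (p c) != 0 ->
  bary p T c x = orient (p a) (p b) x / orient (p a) (p b) (p c).
Proof.
move=> TT -> o; have [_ _ ->] := bary3E x o.
by rewrite (orient_rot x).
Qed.

Lemma triangle_orient T a b c : T \in Th -> T = [set a; b; c]%SET ->
  orient (p a) (p b) (p c) != 0.
Proof.
move=> TT TE; have := triangle_card TT.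
rewrite TE => c3; have ab : a != b.
  by apply: contra_eqN c3 => /eqP ->; rewrite finset.setUid cards2; case: (b != c).
have [c' [E o]] := triangle_edge (mesh_triangle TT) (v := a) (w := b)
  ltac:(by rewrite TE !inE eqxx) ltac:(by rewrite TE !inE eqxx orbT) ab.
have : c' \in [set a; b; c]%SET by rewrite -TE E !inE eqxx orbT.
rewrite !inE -orbA => /or3P[]/eqP cE; last by rewrite -cE.
  by move: o; rewrite cE !orientE => /eqP[]; ring.
by move: o; rewrite cE !orientE => /eqP[]; ring.
Qed.

(** [x] lies inside the edge from [a] to [b], and a positive quotient says that [u] points to the
    side of [c], whatever the orientation of the triangle. *)
Lemma triangle_enter T a b c x u : T \in Th -> T = [set a; b; c]%SET ->
  0 < bary p T a x -> 0 < bary p T b x -> orient (p a) (p b) x = 0 ->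
  0 < orient (p a) (p b) (x + u) / orient (p a) (p b) (p c) ->
  \forall d \near (0 : R)^'+, (simplex p T)° (x + d *: u).
Proof.
move=> TT TE xa xb xc ou; have o := triangle_orient TT TE.
have h0 : \forall d \near (0 : R)^'+, 0 < d by exact: nbhs_right_gt.
have ha := near_ray u (near_bary_gt xa); have hb := near_ray u (near_bary_gt xb).
apply: filterS2 h0 (filterI ha hb) => d d0 [da db].
apply/(open_triangle_bary (mesh_triangle TT)) => v.
rewrite TE !inE -orbA => /or3P[]/eqP->; rewrite -TE //.
rewrite (bary_third _ TT TE)//.
have -> : orient (p a) (p b) (x + d *: u) = d * orient (p a) (p b) (x + u).
  transitivity (d * orient (p a) (p b) (x + u) + (1 - d) * orient (p a) (p b) x).
    by rewrite !orientE /= !scaleRE; ring.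
  by rewrite xc mulr0 addr0.
by rewrite -mulrA mulr_gt0.
Qed.

Lemma carrier_edge T a b x : T \in Th -> a \in T -> b \in T -> a != b ->
  closure Omega x -> carrier x = [set a; b]%SET ->
  [/\ simplex p T x, 0 < bary p T a x, 0 < bary p T b x &
      orient (p a) (p b) x = 0].
Proof.
move=> TT aT bT ab cx ce.
have sx : simplex p T x.
  by apply/(triangle_carrier _ TT); rewrite ce finset.subUset !finset.sub1set aT.
have [c [TE o]] := triangle_edge (mesh_triangle TT) aT bT ab.
split => //.
- have : a \in carrier x by rewrite ce !inE eqxx.
  by rewrite inE (hatE _ TT).
- have : b \in carrier x by rewrite ce !inE eqxx orbT.
  by rewrite inE (hatE _ TT).
- have : bary p T c x = 0.
    rewrite -(hatE _ TT)// hat_carrier// ce !inE negb_or.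
    have [_ bc ac] := vertices_neq o.
    by rewrite ![c == _]eq_sym ac.
  rewrite (bary_third _ TT TE)// => /eqP; rewrite mulf_eq0 invr_eq0 (negbTE o).
  by rewrite orbF => /eqP.
Qed.

Lemma edge_midpoint T a b : T \in Th -> a \in T -> b \in T -> a != b ->
  forall t, 0 < t < 1 ->
  let x := (1 - t) *: p a + t *: p b in
  closure Omega x /\ carrier x = [set a; b]%SET.
Proof.
move=> TT aT bT ab t /andP[t0 t1] x; have tT := mesh_triangle TT.
have bE v : v \in T -> bary p T v x = (1 - t) * (v == a)%:R + t * (v == b)%:R.
  by move=> vT; rewrite bary_line !bary_vertex.
have sx : simplex p T x.
  apply/(triangle_bary tT) => v; have [vT|vT] := boolP (v \in T).
    by rewrite bE// addr_ge0// mulr_ge0// ?ler0n ?subr_ge0// ltW.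
  by rewrite bary0.
split; first by apply/closure_mesh; exists T.
apply/setP => v; rewrite !inE (hatE _ TT)//.
have [vT|vT] := boolP (v \in T).
  rewrite bE//; have [->|va] := eqVneq v a.
    by rewrite (negbTE ab) mulr1 mulr0 addr0 subr_gt0 t1.
  by have [_|vb] := eqVneq v b; rewrite mulr0 add0r ?mulr1 ?mulr0 ?ltxx.
rewrite bary0// ltxx; apply/esym; apply: contraNF vT.
by case/orP => /eqP ->.
Qed.

(** With both third vertices on one side, a small step from the midpoint of the edge towards [c1]
    would enter both open triangles, whereas the carrier of a point determines its open triangle. *)
Lemma triangles_opposite T1 T2 a b c1 c2 : T1 \in Th -> T2 \in Th ->
  T1 != T2 -> T1 = [set a; b; c1]%SET -> T2 = [set a; b; c2]%SET ->
  orient (p a) (p b) (p c1) / orient (p a) (p b) (p c2) < 0.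
Proof.
move=> T1T T2T T12 E1 E2.
have o1 := triangle_orient T1T E1; have o2 := triangle_orient T2T E2.
have [ab _ _] := vertices_neq o1.
rewrite ltNge le_eqVlt eq_sym mulf_eq0 invr_eq0 (negbTE o1) (negbTE o2) /=.
apply/negP => o12.
have [aT1 bT1] : a \in T1 /\ b \in T1 by rewrite E1 !inE !eqxx !orbT.
have [aT2 bT2] : a \in T2 /\ b \in T2 by rewrite E2 !inE !eqxx !orbT.
have t01 : 0 < (1 / 2 : R) < 1 by apply/andP; split; lra.
have [cx ce] := edge_midpoint T1T aT1 bT1 ab t01.
set x := _ + _ in cx ce.
have [_ xa1 xb1 xo] := carrier_edge T1T aT1 bT1 ab cx ce.
have [_ xa2 xb2 _] := carrier_edge T2T aT2 bT2 ab cx ce.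
have uE : x + (p c1 - x) = p c1 by rewrite addrC subrK.
have h1 := triangle_enter (u := p c1 - x) T1T E1 xa1 xb1 xo.
rewrite uE divff// in h1; have {}h1 := h1 ltr01.
have h2 := triangle_enter (u := p c1 - x) T2T E2 xa2 xb2 xo.
rewrite uE in h2; have {}h2 := h2 o12.
have [d [d1 d2]] := @filter_ex _ _ _ _ (filterI h1 h2).
have [_ E] := (interior_carrier _ T1T).1 d1.
have [_ E'] := (interior_carrier _ T2T).1 d2.
by move: T12; rewrite -E E' eqxx.
Qed.

(** Close to [x] each side of the edge is filled by one of the two triangles, so [x] is interior to
    the closure of [Omega], hence in [Omega]. *)
Lemma edge_interior T1 T2 a b x : T1 \in Th -> T2 \in Th -> T1 != T2 ->
  a \in T1 -> b \in T1 -> a \in T2 -> b \in T2 -> a != b ->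
  closure Omega x -> carrier x = [set a; b]%SET -> Omega x.
Proof.
move=> T1T T2T T12 aT1 bT1 aT2 bT2 ab cx ce.
have [c1 [E1 o1]] := triangle_edge (mesh_triangle T1T) aT1 bT1 ab.
have [c2 [E2 o2]] := triangle_edge (mesh_triangle T2T) aT2 bT2 ab.
have o12 := triangles_opposite T1T T2T T12 E1 E2.
have [_ xa1 xb1 xo] := carrier_edge T1T aT1 bT1 ab cx ce.
have [_ xa2 xb2 _] := carrier_edge T2T aT2 bT2 ab cx ce.
apply: region_interior_closure; rewrite /interior /=.
have H1 : \forall y \near x, 0 < bary p T1 a y /\ 0 < bary p T1 b y.
  by apply: filterI; exact: near_bary_gt.
have H2 : \forall y \near x, 0 < bary p T2 a y /\ 0 < bary p T2 b y.
  by apply: filterI; exact: near_bary_gt.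
apply: filterS2 H1 H2 => y [a1 b1] [a2 b2].
apply/closure_mesh.
have : 0 <= bary p T1 c1 y \/ 0 <= bary p T2 c2 y.
  rewrite !(bary_third y _ E1, bary_third y _ E2)//.
  have [h|h] := leP 0 (orient (p a) (p b) y / orient (p a) (p b) (p c1)).
    by left.
  right; have -> : orient (p a) (p b) y / orient (p a) (p b) (p c2) =
    (orient (p a) (p b) y / orient (p a) (p b) (p c1)) *
    (orient (p a) (p b) (p c1) / orient (p a) (p b) (p c2)).
    by rewrite mulrA divfK.
  by rewrite ltW// nmulr_rgt0.
move=> [h|h]; [exists T1|exists T2] => //; apply/(triangle_bary (mesh_triangle _)) => // v.
  have [|vT] := boolP (v \in T1); last by rewrite bary0.
  by rewrite {1}E1 !inE -orbA => /or3P[]/eqP->; rewrite // ltW.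
have [|vT] := boolP (v \in T2); last by rewrite bary0.
by rewrite {1}E2 !inE -orbA => /or3P[]/eqP->; rewrite // ltW.
Qed.

(** A small step from [x] away from the third vertex stays in [Omega] but leaves [T]. The triangle
    reached there also contains [x], since triangles are closed, and with [x] the whole edge. *)
Lemma edge_second T a b x : T \in Th -> a \in T -> b \in T -> a != b ->
  Omega x -> carrier x = [set a; b]%SET ->
  exists T', [/\ T' \in Th, T' != T, a \in T' & b \in T'].
Proof.
move=> TT aT bT ab ox ce; have cx : closure Omega x by exact: subset_closure.
have [c [E o]] := triangle_edge (mesh_triangle TT) aT bT ab.
have [_ xa xb xo] := carrier_edge TT aT bT ab cx ce.
have H1 : nbhs x Omega by apply: open_nbhs_nbhs; split => //; exact: region_open.
have H2 := near_mesh x.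
have H1' := near_ray (- (p c - x)) H1; have H2' := near_ray (- (p c - x)) H2.
have h0 : \forall d \near (0 : R)^'+, 0 < d by exact: nbhs_right_gt.
have [d [[d0 od] md]] := @filter_ex _ _ _ _ (filterI (filterI h0 H1') H2').
have /closure_mesh[T' TT' sT'] := subset_closure od.
have sx := md _ TT' sT'; exists T'; split => //.
- apply/eqP => T'T; move: sT'; rewrite T'T => /(triangle_bary (mesh_triangle TT)).
  move=> /(_ c); rewrite scalerN -scaleNr bary_ray.
  have cT : c \in T by rewrite E !inE eqxx orbT.
  rewrite (bary_vertex (mesh_triangle TT))// eqxx (bary_third x TT E)// xo mul0r.
  by rewrite add0r subr0 mulr1 oppr_ge0 leNgt d0.
- apply: (fintype.subsetP (carrier_sub TT' sx)); rewrite ce !inE eqxx//.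
- by apply: (fintype.subsetP (carrier_sub TT' sx)); rewrite ce !inE eqxx orbT.
Qed.

End Mesh.

(** * Edges of the mesh and its boundary *)

Section BoundaryEdges.
Variables (R : realType) (V : finType) (p : V -> R * R) (Th : {set {set V}}).
Variable Omega : set (R * R).
Hypothesis tr : triangulation p Th Omega.
Hypothesis reg : polygonal_region_no_holes Omega.
Implicit Types (T s e : {set V}) (x y u : R * R) (a b c v w : V).

Definition star e : {set {set V}} := [set T in Th | e \subset T]%SET.

Definition boundary_edges : {set {set V}} :=
  [set e in edges Th | #|star e| == 1]%SET.

Lemma edgeP e : reflect (exists a b T,
    [/\ e = [set a; b]%SET, a != b, T \in Th, a \in T & b \in T])
  (e \in edges Th).
Proof.
rewrite inE; apply: (iffP andP) => [[/cards2P[a [b [ab ->]]] /exists_inP[T TT]]|].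
  by rewrite finset.subUset !finset.sub1set => /andP[aT bT]; exists a, b, T.
move=> [a [b [T [-> ab TT aT bT]]]]; split; first by rewrite cards2 ab.
by apply/exists_inP; exists T; rewrite // finset.subUset !finset.sub1set aT.
Qed.

Lemma star_pair T a b : (T \in star [set a; b]%SET) = [&& T \in Th, a \in T & b \in T].
Proof. by rewrite !inE finset.subUset !finset.sub1set. Qed.

Lemma star_gt0 e : e \in edges Th -> (0 < #|star e|)%N.
Proof.
move=> /edgeP[a [b [T [-> ab TT aT bT]]]]; apply/card_gt0P; exists T.
by rewrite star_pair TT aT.
Qed.

(** A line has only two sides, and two triangles on the same edge lie on opposite ones. *)
Lemma star_le2 e : e \in edges Th -> (#|star e| <= 2)%N.
Proof.
move=> /edgeP[a [b [_ [-> ab _ _ _]]]]; rewrite leqNgt; apply/negP.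
move=> /card_gt2P[T1 [T2 [T3 [[]]]]]; rewrite !star_pair.
move=> /and3P[TT1 a1 b1] /and3P[TT2 a2 b2] /and3P[TT3 a3 b3] [T12 T23 T31].
have [c1 [E1 o1]] := triangle_edge (mesh_triangle tr TT1) a1 b1 ab.
have [c2 [E2 o2]] := triangle_edge (mesh_triangle tr TT2) a2 b2 ab.
have [c3 [E3 o3]] := triangle_edge (mesh_triangle tr TT3) a3 b3 ab.
have h12 := triangles_opposite tr TT1 TT2 T12 E1 E2.
have h23 := triangles_opposite tr TT2 TT3 T23 E2 E3.
have h31 := triangles_opposite tr TT3 TT1 T31 E3 E1.
have : 0 < orient (p a) (p b) (p c1) / orient (p a) (p b) (p c2) *
           (orient (p a) (p b) (p c2) / orient (p a) (p b) (p c3)).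
  by rewrite nmulr_rgt0.
move: h31; rewrite -invr_lt0 invf_div mulrA divfK// => h /(lt_trans h).
by rewrite ltxx.
Qed.

Lemma simplex_pair a b x : a != b -> simplex p [set a; b]%SET x ->
  segment (p a) (p b) x.
Proof.
move=> ab [l [l0]]; rewrite !sum_set2// => l1 ->; exists (l b).
  by rewrite /= l0 -l1 lerDr l0.
by rewrite -l1 addrK.
Qed.

(** Links position to incidence: beyond an edge point lying in [Omega] there is a second triangle,
    and an inner edge point between two triangles lies in [Omega]. *)
Lemma interior_edgeP e : e \in edges Th ->
  (e \in interior_edges p Th Omega) = (#|star e| == 2).
Proof.
move=> eE; rewrite inE eE /=; have [a [b [T [-> ab TT aT bT]]]] := edgeP _ eE.
have eE' : [set a; b]%SET \in edges Th by apply/edgeP; exists a, b, T.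
have abT : [set a; b]%SET \subset T by rewrite finset.subUset !finset.sub1set aT.
apply/asboolP/eqP => [nsub|].
  have [y [sy ny]] : exists y, simplex p [set a; b]%SET y /\ ~ boundary Omega y.
    apply: contrapT => h; apply: nsub => z sz; apply: contrapT => nz.
    by apply: h; exists z.
  apply/eqP; rewrite eqn_leq star_le2//=.
  have oy : Omega y.
    have : closure Omega y by case/(simplex_carrier tr _ TT abT): sy.
    by move=> /(region_closureP reg)[].
  (* The point [y] may be an end of the edge; as [Omega] is open, it can be moved to an inner
     point. *)
  have [t t01 ot] : exists2 t, 0 < t < 1 & Omega ((1 - t) *: p a + t *: p b).
    case: (simplex_pair ab sy) => s /= /andP[s0 s1] yE.
    have := region_open reg; rewrite openE => /(_ y oy).
    move=> /(@near_ray _ _ ((1 / 2 - s) *: (p b - p a))) h.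
    have h0 : \forall d \near (0 : R)^'+, 0 < d by exact: nbhs_right_gt.
    have h1 : \forall d \near (0 : R)^'+, d < 1 by exact: nbhs_right_lt.
    have [d [[d0 d1] di]] := @filter_ex _ _ _ _ (filterI (filterI h0 h1) h).
    exists (s + d * (1 / 2 - s)); first by apply/andP; split; nra.
    move: di; rewrite -yE; congr (Omega _).
    by apply: pair_ext; rewrite /= !scaleRE; ring.
  have [_ ce] := edge_midpoint tr TT aT bT ab t01.
  have [T' [TT' T'T aT' bT']] := edge_second tr reg TT aT bT ab ot ce.
  by apply/card_gt1P; exists T, T'; rewrite !star_pair TT aT bT TT' aT' bT' eq_sym.
move=> /eqP/cards2P[T1 [T2 [T12 E]]] sub.
have : T1 \in star [set a; b]%SET by rewrite E !inE eqxx.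
have : T2 \in star [set a; b]%SET by rewrite E !inE eqxx orbT.
rewrite !star_pair => /and3P[TT2 a2 b2] /and3P[TT1 a1 b1].
have t01 : 0 < (1 / 2 : R) < 1 by apply/andP; split; lra.
have [cx ce] := edge_midpoint tr TT aT bT ab t01.
have ox := edge_interior tr reg TT1 TT2 T12 a1 b1 a2 b2 ab cx ce.
apply: region_boundary_notin ox => //; apply: sub.
by apply/(simplex_carrier tr _ TT abT); rewrite ce.
Qed.

Lemma boundary_edgeP e :
  (e \in boundary_edges) = (e \in edges Th) && (e \notin interior_edges p Th Omega).
Proof.
rewrite inE; case: (boolP (e \in edges Th)) => //= eE; rewrite interior_edgeP//.
by have := star_gt0 eE; have := star_le2 eE; case: #|star e| => // -[|[]].
Qed.

Lemma boundary_edge_edge e : e \in boundary_edges -> e \in edges Th.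
Proof. by rewrite inE => /andP[]. Qed.

Lemma boundary_edge_sub e : e \in boundary_edges -> simplex p e `<=` boundary Omega.
Proof.
by rewrite boundary_edgeP => /andP[eE]; rewrite inE eE /= => /asboolPn/contrapT.
Qed.

Lemma boundary_edge_vertex e v : e \in boundary_edges -> v \in e ->
  boundary Omega (p v).
Proof.
move=> eb ve; apply: (boundary_edge_sub eb).
move: (eb); rewrite inE => /andP[/edgeP[a [b [T [eE ab TT aT bT]]]] _].
apply/(vertex_simplex tr _ TT) => //.
by rewrite eE finset.subUset !finset.sub1set aT.
Qed.

Lemma boundary_vertexP v : boundary Omega (p v) <-> ~ Omega (p v).
Proof.
split=> [/(region_boundary_notin reg)//|nv].
by have [/(region_closureP reg)[]] := carrier_vertex tr v.
Qed.

(** The carrier of [x] has neither one element, as [x] is no vertex, nor three, as open triangles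
    lie in [Omega]; so it is an edge, and not an interior one. *)
Lemma boundary_cover_generic x : boundary Omega x -> (forall v, x != p v) ->
  exists2 e, e \in boundary_edges & simplex p e x.
Proof.
move=> bx nx; have cx : closure Omega x by apply/(region_closureP reg); right.
have [T TT sT] := (closure_mesh tr x).1 cx.
have cT := carrier_sub tr TT sT; have c0 := carrier_neq0 tr cx.
have nO := region_boundary_notin reg bx.
have c1 : #|carrier p Th x| != 1.
  by apply/cards1P => -[v /(carrier1 tr cx)/eqP]; rewrite (negbTE (nx v)).
have c3 : #|carrier p Th x| != 3.
  apply/eqP => c3; apply: nO; apply: (interior_region tr reg TT).
  apply/(interior_carrier tr _ TT); split => //.
  by apply/eqP; rewrite eqEcard cT (triangle_card tr TT) c3.
have : #|carrier p Th x| == 2.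
  have := subset_leq_card cT; rewrite (triangle_card tr TT).
  by move: c0 c1 c3; rewrite -cards_eq0; case: #|_| => // -[|[|[|[]]]].
move=> /cards2P[a [b [ab ce]]]; exists [set a; b]%SET; last first.
  apply/(simplex_carrier tr _ TT); last by rewrite ce.
  by rewrite -ce.
move: cT; rewrite ce finset.subUset !finset.sub1set => /andP[aT bT].
rewrite boundary_edgeP; have eE : [set a; b]%SET \in edges Th.
  by apply/edgeP; exists a, b, T.
rewrite eE interior_edgeP//=; apply/negP => /cards2P[T1 [T2 [T12 E]]].
have : T1 \in star [set a; b]%SET by rewrite E !inE eqxx.
have : T2 \in star [set a; b]%SET by rewrite E !inE eqxx orbT.
rewrite !star_pair => /and3P[TT2 a2 b2] /and3P[TT1 a1 b1].
exact: nO (edge_interior tr reg TT1 TT2 T12 a1 b1 a2 b2 ab cx ce).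
Qed.

Lemma simplex_pairE a b : a != b ->
  simplex p [set a; b]%SET = segment (p a) (p b).
Proof.
move=> ab; apply/seteqP; split => x; first exact: simplex_pair.
move=> [t /= /andP[t0 t1] <-]; exists (fun v => if v == a then 1 - t else t).
rewrite !sum_set2// eqxx eq_sym (negbTE ab); split => // [v|].
  by case: ifP => // _; rewrite subr_ge0.
by rewrite subrK.
Qed.

Lemma boundary_edge_closed e : e \in boundary_edges -> closed (simplex p e).
Proof.
rewrite inE => /andP[/edgeP[a [b [T [-> ab TT aT bT]]]] _].
by rewrite simplex_pairE//; exact: closed_segment.
Qed.

Lemma region_boundary_two x : exists2 y, boundary Omega y & y != x.
Proof.
case: reg => oO cO [n [q [[n3 qi _] ->]]].
have q0 : (0 < n)%N by apply: leq_trans n3.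
have q1 : (1 < n)%N by apply: leq_trans n3.
have [h|h] := eqVneq (q (Ordinal q0)) x.
  exists (q (Ordinal q1)); first by exists (Ordinal q1) => //; exact: segment_left.
  by rewrite -h; apply/eqP => /qi.
by exists (q (Ordinal q0)) => //; exists (Ordinal q0) => //; exact: segment_left.
Qed.

(** An uncovered point would be a mesh vertex isolated in the boundary, which is connected and has
    other points. *)
Lemma boundary_cover x : boundary Omega x ->
  exists2 e, e \in boundary_edges & simplex p e x.
Proof.
move=> bx; apply: contrapT => nx.
have Hx : \forall y \near x, forall e, e \in boundary_edges -> ~ simplex p e y.
  apply: (@filter_forall _ _ (fun e y => e \in boundary_edges -> ~ simplex p e y)
    (nbhs x) _) => e.
  have [eb|eb] := boolP (e \in boundary_edges); last exact: nearW.
  have : nbhs x (~` simplex p e).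
    apply: open_nbhs_nbhs; split; last by move=> se; apply: nx; exists e.
    by apply: closed_openC; exact: boundary_edge_closed.
  by apply: filterS.
have Hv : \forall y \near x, forall v, p v != x -> y != p v.
  apply: (@filter_forall _ _ (fun v y => p v != x -> y != p v) (nbhs x) _) => v.
  have [vx|vx] := boolP (p v == x); first exact: nearW.
  have : nbhs x (~` [set p v]).
    apply: open_nbhs_nbhs; split; last by move=> /= h; rewrite h eqxx in vx.
    exact/closed_openC/accessible_closed_set1/hausdorff_accessible/norm_hausdorff.
  by apply: filterS => y /= h _; apply/eqP.
have [y yb yx] := region_boundary_two x.
have : asbool (y = x) = asbool (x = x).
  apply: (locally_constant_connected (f := fun z => asbool (z = x))
    (region_boundary_connected reg)) => //.
  move=> z bz; have [->|zx] := pselect (z = x).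
    apply: filterS2 Hx Hv => t ht hv bt; congr asbool.
    suff -> : t = x by [].
    apply: contrapT => tx; have nt v : t != p v.
      by have [pv|/hv//] := eqVneq (p v) x; rewrite pv; apply/eqP.
    by have [e eb] := boundary_cover_generic bt nt; exact: ht.
  have : nbhs z (~` [set x]).
    by apply: open_nbhs_nbhs; split => //; exact/closed_openC/accessible_closed_set1/hausdorff_accessible/norm_hausdorff.
  apply: filterS => t /= tx _.
  by rewrite (asboolF zx) (asboolF tx).
by move=> h; case/eqP: yx; apply/asboolP; rewrite h; exact/asboolP.
Qed.

Definition boundary_neighbours v : {set V} :=
  [set b | [set v; b]%SET \in boundary_edges]%SET.

Lemma in_boundary_neighbours v b :
  (b \in boundary_neighbours v) = ([set v; b]%SET \in boundary_edges).
Proof. by rewrite inE. Qed.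

Lemma edge_neq v b : [set v; b]%SET \in edges Th -> v != b.
Proof.
by rewrite inE => /andP[+ _]; apply: contraTneq => ->; rewrite finset.setUid cards1.
Qed.

Lemma edge_ray_eq v b b' k : 0 < k ->
  [set v; b]%SET \in edges Th -> [set v; b']%SET \in edges Th ->
  p b - p v = k *: (p b' - p v) -> b = b'.
Proof.
(* With [k <= 1] the midpoint of the first edge is the point of parameter [k / 2] inside the second,
   and a point has only one carrier. *)
wlog k1 : b b' k / k <= 1.
  move=> H k0 e e' E; have [k1|k1] := leP k 1; first exact: H e e' E.
  apply/esym; apply: (H b' b k^-1) => //; rewrite ?invr_gt0//.
    by rewrite invf_le1// ltW.
  by rewrite E scalerA mulVf ?gt_eqF// scale1r.
move=> k0 e e' E; have vb := edge_neq e; have vb' := edge_neq e'.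
have in_tri d : [set v; d]%SET \in edges Th -> exists T, [/\ T \in Th, v \in T & d \in T].
  rewrite inE => /andP[_ /exists_inP[T TT]].
  by rewrite finset.subUset !finset.sub1set => /andP[? ?]; exists T.
have [T [TT vT bT]] := in_tri b e; have [T' [TT' vT' bT']] := in_tri b' e'.
have t01 : 0 < (1 / 2 : R) < 1 by apply/andP; split; lra.
have t01' : 0 < (k / 2 : R) < 1 by apply/andP; split; lra.
have [_ c1] := edge_midpoint tr TT vT bT vb t01.
have [_ c2] := edge_midpoint tr TT' vT' bT' vb' t01'.
have : b \in [set v; b']%SET.
  rewrite -c2; have -> : (1 - k / 2) *: p v + (k / 2) *: p b' =
    (1 - 1 / 2) *: p v + (1 / 2) *: p b.
    move: E => /(congr1 (fun z => p v + (1 / 2) *: z)); rewrite scalerA => E.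
    transitivity (p v + (1 / 2) *: (p b - p v)).
      by rewrite E; apply: pair_ext; rewrite /= !scaleRE; ring.
    by apply: pair_ext; rewrite /= !scaleRE; ring.
  by rewrite c1 !inE eqxx orbT.
by rewrite !inE eq_sym (negbTE vb) => /eqP.
Qed.

(* Near a boundary vertex the boundary consists of two rays, and each         *)
(* boundary edge takes up one of them.                                        *)
Lemma boundary_neighbours_le2 v : (#|boundary_neighbours v| <= 2)%N.
Proof.
rewrite leqNgt; apply/negP => /card_gt2P[b1 [b2 [b3 [[]]]]].
rewrite !in_boundary_neighbours => e1 e2 e3 [b12 b23 b31].
have vb : boundary Omega (p v).
  by apply: (boundary_edge_vertex e1); rewrite !inE eqxx.
have [d1 [d2 H]] := region_germ reg vb.
have ray b : [set v; b]%SET \in boundary_edges -> \forall d \near (0 : R)^'+,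
    exists2 t, 0 < t & p b - p v = t *: d1 \/ p b - p v = t *: d2.
  move=> eb; have eE := boundary_edge_edge eb.
  have vb' := edge_neq eE.
  have h0 : \forall d \near (0 : R)^'+, 0 < d by exact: nbhs_right_gt.
  have h1 : \forall d \near (0 : R)^'+, d < 1 by exact: nbhs_right_lt.
  have h := near_ray (p b - p v) H.
  apply: filterS2 (filterI h0 h1) h => d [d0' d1'].
  have -> : p v + d *: (p b - p v) = (1 - d) *: p v + d *: p b.
    by apply: pair_ext; rewrite /= !scaleRE; ring.
  have bd : boundary Omega ((1 - d) *: p v + d *: p b).
    apply: (boundary_edge_sub eb).
    move: eE; rewrite inE => /andP[_ /exists_inP[T TT]] eT.
    move: (eT); rewrite finset.subUset !finset.sub1set => /andP[vT bT].
    apply/(simplex_carrier tr _ TT eT).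
    have [//|cl ->] := edge_midpoint tr TT vT bT vb' (t := d); first by rewrite d0' d1'.
    by [].
  move=> /(_ bd)[t t0 tE].
  have tpos : 0 < t.
    rewrite lt_neqAle t0 andbT eq_sym; apply: contra vb' => /eqP t00.
    have : (1 - d) *: p v + d *: p b = p v.
      by case: tE => ->; rewrite t00 scale0r addr0.
    move=> E; apply/eqP/(mesh_inj tr); apply/eqP; rewrite eq_sym -subr_eq0.
    have : d *: (p b - p v) = 0.
      rewrite -(subrr (p v)) -[X in _ = X - _]E.
      by apply: pair_ext; rewrite /= !scaleRE; ring.
    by move=> /eqP; rewrite scaler_eq0 gt_eqF.
  have dE : p b - p v = d^-1 *: ((1 - d) *: p v + d *: p b - p v).
    have -> : (1 - d) *: p v + d *: p b - p v = d *: (p b - p v).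
      by apply: pair_ext; rewrite /= !scaleRE; ring.
    by rewrite scalerA mulVf ?gt_eqF// scale1r.
  exists (d^-1 * t); first by rewrite mulr_gt0// invr_gt0.
  rewrite dE -!scalerA; case: tE => ->; [left|right]; congr (_ *: _);
    by rewrite addrC addKr.
have {}ray b : [set v; b]%SET \in boundary_edges ->
    exists2 t, 0 < t & p b - p v = t *: d1 \/ p b - p v = t *: d2.
  by move=> /ray h; have [d] := @filter_ex _ _ _ _ h.
have same b b' t t' d : [set v; b]%SET \in boundary_edges ->
    [set v; b']%SET \in boundary_edges -> 0 < t -> 0 < t' -> b != b' ->
    p b - p v = t *: d -> p b' - p v = t' *: d -> False.
  move=> /boundary_edge_edge eb /boundary_edge_edge eb' t0 t0' /negP bb' E E'; apply: bb'; apply/eqP.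
  apply: (edge_ray_eq (k := t / t')) eb eb' _; first by rewrite divr_gt0.
  by rewrite E E' scalerA divfK// gt_eqF.
have [t1 t10 h1] := ray _ e1; have [t2 t20 h2] := ray _ e2.
have [t3 t30 h3] := ray _ e3.
case: h1 => h1; case: h2 => h2; case: h3 => h3;
  first [exact: same e1 e2 t10 t20 b12 h1 h2|exact: same e2 e3 t20 t30 b23 h2 h3|
         exact: same e3 e1 t30 t10 b31 h3 h1].
Qed.

End BoundaryEdges.

(** * Chains of edges and their winding numbers *)

Section Chains.
Variables (R : realType) (V : finType) (p : V -> R * R) (Th : {set {set V}}).
Variable Omega : set (R * R).
Hypothesis tr : triangulation p Th Omega.
Hypothesis reg : polygonal_region_no_holes Omega.
Implicit Types (T s e : {set V}) (x y u : R * R) (a b c v w : V).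

(* A chain of edges is an antisymmetric function of ordered pairs of          *)
(* vertices; [bd T] is the boundary of [T], oriented counterclockwise.        *)
Definition bd T a b : R :=
  if (a \in T) && (b \in T)
  then \sum_(w in T) Num.sg (orient (p a) (p b) (p w)) else 0.

Lemma bdC T a b : bd T b a = - bd T a b.
Proof.
rewrite /bd andbC; case: ifP => _; last by rewrite oppr0.
by rewrite -sumrN; apply: eq_bigr => w _; rewrite orient_swap sgrN.
Qed.

(** In the sum defining [bd] the terms at [a] and [b] are degenerate, so the third vertex alone
    contributes and need not be chosen. *)
Lemma bdE T a b c : T \in Th -> T = [set a; b; c]%SET ->
  bd T a b = Num.sg (orient (p a) (p b) (p c)).
Proof.
move=> TT TE; have o := triangle_orient tr TT TE; have [ab bc ac] := vertices_neq o.
rewrite /bd TE !inE !eqxx !orbT /= sum_set3//.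
have -> : orient (p a) (p b) (p a) = 0 by rewrite orientE; ring.
have -> : orient (p a) (p b) (p b) = 0 by rewrite orientE; ring.
by rewrite sgr0 !add0r.
Qed.

Lemma bd_diag T a : bd T a a = 0.
Proof.
have := bdC T a a; move=> h; have : bd T a a + bd T a a = 0 by rewrite {1}h addNr.
by move/eqP; rewrite -mulr2n mulrn_eq0 => /eqP.
Qed.

Lemma bd_support T a b : T \in Th -> bd T a b != 0 ->
  T \in star Th [set a; b]%SET /\ [set a; b]%SET \in edges Th.
Proof.
move=> TT; rewrite /bd star_pair TT /=; case: andP => [[aT bT]|]; last by rewrite eqxx.
move=> h; split => //; apply/edgeP; exists a, b, T; split => //.
apply: contraNneq h => ->; rewrite big1// => w _.
by have -> : orient (p b) (p b) (p w) = 0; [rewrite orientE; ring|rewrite sgr0].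
Qed.

Lemma bd_sqr T a b : T \in star Th [set a; b]%SET -> a != b -> bd T a b ^+ 2 = 1.
Proof.
rewrite star_pair => /and3P[TT aT bT] ab.
have [c [E o]] := triangle_edge (mesh_triangle tr TT) aT bT ab.
by rewrite (bdE TT E) sqr_sg o.
Qed.

Lemma bd_cycle T v : T \in Th -> \sum_u bd T v u = 0.
Proof.
move=> TT; have [vT|vT] := boolP (v \in T); last first.
  by rewrite big1// => u _; rewrite /bd (negbTE vT).
have [b [c [E o]]] := triangle_vertex (mesh_triangle tr TT) vT.
have [vb bc vc] := vertices_neq (lt0r_neq0 o).
rewrite (bigID (mem T)) /= [X in _ + X]big1 ?addr0 => [|u uT]; last first.
  by rewrite /bd (negbTE uT) andbF.
transitivity (bd T v v + bd T v b + bd T v c).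
  by rewrite {1}E sum_set3.
rewrite bd_diag (bdE TT E) (@bdE T v c b)//; last by rewrite E finset.setUAC.
have -> : orient (p v) (p c) (p b) = - orient (p v) (p b) (p c).
  by rewrite !orientE; ring.
by rewrite sgrN add0r subrr.
Qed.

Definition mesh_cycle (z : V -> V -> R) :=
  [/\ forall a b, z b a = - z a b, forall v, \sum_u z v u = 0 &
      forall a b, z a b != 0 -> [set a; b]%SET \in edges Th].

(** The sum runs over ordered pairs, so this is twice the usual winding number. *)
Definition chain_winding (z : V -> V -> R) : R * R -> R :=
  winding (fun ab : V * V => z ab.1 ab.2) (fun ab => p ab.1) (fun ab => p ab.2).

Lemma bd_mesh_cycle (F : {set V} -> R) :
  mesh_cycle (fun a b => \sum_(T in Th) F T * bd T a b).
Proof.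
split => [a b|v|a b].
- by rewrite -sumrN; apply: eq_bigr => T _; rewrite bdC mulrN.
- rewrite exchange_big big1// => T TT /=.
  by rewrite -mulr_sumr bd_cycle ?mulr0.
- apply: contraR => nE; rewrite big1// => T TT.
  apply/eqP; rewrite mulf_eq0; apply/orP; right.
  by apply: contraNT nE => /(bd_support TT)[].
Qed.

Lemma mesh_cycle_bd T : T \in Th -> mesh_cycle (bd T).
Proof.
move=> TT; split => [a b|v|a b]; [exact: bdC|exact: bd_cycle|].
by move=> /(bd_support TT)[].
Qed.

Lemma chain_winding_bd (F : {set V} -> R) x :
  chain_winding (fun a b => \sum_(T in Th) F T * bd T a b) x =
  \sum_(T in Th) F T * chain_winding (bd T) x.
Proof.
rewrite /chain_winding /winding; under eq_bigr do rewrite mulr_suml.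
rewrite exchange_big; apply: eq_bigr => T _ /=.
by rewrite mulr_sumr; apply: eq_bigr => ab _; rewrite mulrA.
Qed.

Section Cycle.
Variable z : V -> V -> R.
Hypothesis cz : mesh_cycle z.

Lemma mesh_weighted_cycle : weighted_cycle (fun ab : V * V => z ab.1 ab.2)
  (fun ab => p ab.1) (fun ab => p ab.2).
Proof.
have [zC z0 _] := cz; move=> f.
under eq_bigr do rewrite mulrBr.
rewrite sumrB -(pair_bigA _ (fun a b => z a b * f (p b))) /=.
rewrite -(pair_bigA _ (fun a b => z a b * f (p a))) /= exchange_big /=.
rewrite big1 => [|b _]; last first.
  rewrite -mulr_suml; under eq_bigr do rewrite zC.
  by rewrite sumrN z0 oppr0 mul0r.
by rewrite big1 ?subrr// => a _; rewrite -mulr_suml z0 mul0r.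
Qed.

Lemma chain_winding_near x :
  (forall a b, z a b != 0 -> ~ simplex p [set a; b]%SET x) ->
  \forall y \near x, chain_winding z y = chain_winding z x.
Proof.
move=> h; apply: (winding_near mesh_weighted_cycle) => -[a b] /= zab.
have [_ _ /(_ a b zab) eE] := cz.
by rewrite -simplex_pairE; [exact: h|exact: edge_neq eE].
Qed.

Lemma edge_sub e : e \in edges Th -> exists2 T, T \in Th & e \subset T.
Proof. by rewrite inE => /andP[_ /exists_inP[T TT eT]]; exists T. Qed.

Lemma edge_card e : e \in edges Th -> #|e| = 2.
Proof. by rewrite inE => /andP[/eqP]. Qed.

Lemma simplex_edge e x : e \in edges Th ->
  simplex p e x <-> closure Omega x /\ carrier p Th x \subset e.
Proof. by move=> /edge_sub[T TT]; exact: simplex_carrier. Qed.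

Lemma chain_winding_triangle T x y : T \in Th ->
  (simplex p T)° x -> (simplex p T)° y -> chain_winding z x = chain_winding z y.
Proof.
move=> TT xi yi; have tT := mesh_triangle tr TT.
apply: (locally_constant_connected (@connected_segment _ x y)); last 2 first.
- exact: segment_left.
- exact: segment_right.
move=> _ [t /= /andP[t0 t1] <-].
have ti : (simplex p T)° ((1 - t) *: x + t *: y).
  apply/(open_triangle_bary tT) => v vT; rewrite bary_line.
  have := (open_triangle_bary tT x).1 xi v vT.
  have := (open_triangle_bary tT y).1 yi v vT.
  have [->|t0'] := eqVneq t 0; first by rewrite subr0 mul1r mul0r addr0.
  move=> y0 x0; apply: ltr_wpDl; first by rewrite mulr_ge0 ?subr_ge0// ltW.
  by rewrite mulr_gt0// lt_neqAle eq_sym t0'.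
have [_ cE] := (interior_carrier tr _ TT).1 ti.
apply: filterS (chain_winding_near _) => // a b zab.
have [_ _ /(_ a b zab) eE] := cz.
move=> /(simplex_edge _ eE)[_]; rewrite cE => /subset_leq_card.
by rewrite (triangle_card tr TT) edge_card.
Qed.

Lemma chain_winding_jump a b t u : [set a; b]%SET \in edges Th -> 0 < t < 1 ->
  let m := (1 - t) *: p a + t *: p b in
  0 < orient (p a) (p b) (m + u) ->
  \forall d \near (0 : R)^'+,
    chain_winding z (m + d *: u) - chain_winding z (m - d *: u) = z a b *+ 2.
Proof.
move=> eE t01 m o0; have ab := edge_neq eE; have [zC _ zE] := cz.
have [T TT] := edge_sub eE; rewrite finset.subUset !finset.sub1set => /andP[aT bT].
have [cm ce] := edge_midpoint tr TT aT bT ab t01.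
pose k (i : V * V) : R := (i == (a, b))%:R - (i == (b, a))%:R.
have ne : ((a, b) == (b, a)) = false by apply/eqP => -[/eqP]; rewrite (negbTE ab).
have ne' : ((b, a) == (a, b)) = false by rewrite eq_sym.
have := winding_jump mesh_weighted_cycle (k := k) t01 o0 _ => J.
apply: filterS (J _) => [d ->|[a' b'] /= zab].
  rewrite /k (bigD1 (a, b))//= (bigD1 (b, a))/=; last by rewrite ne'.
  rewrite !eqxx ne ne' subr0 sub0r mulr1 mulrN1 (zC a b) opprK big1 => [|i].
    by rewrite addr0 mulr2n.
  by move=> /andP[/negbTE -> /negbTE ->]; rewrite subrr mulr0.
have eE' := zE _ _ zab; have ab' := edge_neq eE'.
have [aa|aa] := eqVneq (a', b') (a, b).
  by constructor 2; rewrite /k aa ne eqxx subr0; case: aa => -> ->.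
have [bb|bb] := eqVneq (a', b') (b, a).
  by constructor 3; rewrite /k bb ne' eqxx sub0r; case: bb => -> ->.
constructor 1; split; last by rewrite /k (negbTE aa) (negbTE bb) subrr.
rewrite -simplex_pairE// => /(simplex_edge _ eE')[_]; rewrite ce => sub.
have : [set a; b]%SET = [set a'; b']%SET.
  by apply/eqP; rewrite eqEcard sub !edge_card.
move=> E; have : a' \in [set a; b]%SET by rewrite E !inE eqxx.
have : b' \in [set a; b]%SET by rewrite E !inE eqxx orbT.
rewrite !inE => /orP[]/eqP b'E /orP[]/eqP a'E.
- by rewrite a'E b'E eqxx in ab'.
- by rewrite a'E b'E eqxx in bb.
- by rewrite a'E b'E eqxx in aa.
- by rewrite a'E b'E eqxx in ab'.
Qed.

Lemma chain_winding_far x : (forall v, (p v).1 < x.1) \/ (forall v, x.1 < (p v).1) ->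
  chain_winding z x = 0.
Proof.
move=> h; rewrite /chain_winding /winding big1// => -[a b] _ /=.
rewrite /crossing; case: h => h.
  by rewrite (lt_gtF (h a)) (lt_gtF (h b)) !andbF /= subrr mulr0.
by rewrite (lt_geF (h a)) (lt_geF (h b)) /= subrr mulr0.
Qed.

End Cycle.

(** Some coordinate, say of [v], is negative at [x] and nonnegative on [T]; so [x] can be moved
    horizontally far away without meeting [T]. *)
Lemma bd_winding_out T x : T \in Th -> ~ simplex p T x ->
  chain_winding (bd T) x = 0.
Proof.
move=> TT nx; have tT := mesh_triangle tr TT; have cz := mesh_cycle_bd TT.
have [v vx] : exists v, bary p T v x < 0.
  apply: contrapT => h; apply: nx; apply/(triangle_bary tT) => v.
  by rewrite leNgt; apply/negP => vx; apply: h; exists v.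
have [n [k nE]] := bary_affine p T v.
(* A move by [M] passes all vertices; its direction is the one in which the coordinate of [v] does
   not increase. *)
pose M := \sum_v `|(p v).1| + `|x.1| + 1.
have M0 : 0 < M by rewrite ltr_wpDl// addr_ge0// sumr_ge0.
pose y := x + (if n.1 <= 0 then M else - M) *: (1, 0).
have leM w : `|(p w).1| <= \sum_v `|(p v).1|.
  by rewrite (bigD1 w)//= lerDl sumr_ge0.
have -> : chain_winding (bd T) x = chain_winding (bd T) y.
  apply: (locally_constant_connected (@connected_segment _ x y)); last 2 first.
  - exact: segment_left.
  - exact: segment_right.
  move=> _ [t /= /andP[t0 t1] <-].
  apply: filterS (chain_winding_near cz _) => // a b zab.
  have [TS eE] := bd_support TT zab; move: TS; rewrite star_pair => /and3P[_ aT bT].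
  move=> /(simplex_edge _ eE)[cy ce].
  have : simplex p T ((1 - t) *: x + t *: y).
    apply/(triangle_carrier tr _ TT); split => //; apply: fintype.subset_trans ce _.
    by rewrite finset.subUset !finset.sub1set aT.
  move=> /(triangle_bary tT)/(_ v); rewrite bary_line leNgt => /negP; apply.
  have : bary p T v y <= bary p T v x.
    rewrite !nE /y /dot /= !scaleRE mulr1 mulr0.
    by case: ifPn => [n0|]; [|rewrite -ltNge => n0]; nra.
  by move=> yx; nra.
apply: chain_winding_far.
have -> : y.1 = x.1 + (if n.1 <= 0 then M else - M) by rewrite /y /= scaleRE mulr1.
case: ifPn => _; [left|right] => w; have := leM w.
  have := ler_norm (p w).1; have := ler_norm (- x.1); rewrite normrN /M; lra.
have := ler_norm (- (p w).1); have := ler_norm x.1; rewrite normrN /M; lra.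
Qed.

(** Outside the triangle the winding number is 0, and stepping in across one edge adds
    [bd T a b *+ 2]. *)
Lemma bd_winding_in T x : T \in Th -> (simplex p T)° x ->
  chain_winding (bd T) x = 2.
Proof.
move=> TT xi; have cz := mesh_cycle_bd TT; have tT := mesh_triangle tr TT.
have [a [b [c [E o]]]] := triangleP tT; have o' := lt0r_neq0 o.
have [ab bc ac] := vertices_neq o'.
have [aT bT] : a \in T /\ b \in T by rewrite E !inE !eqxx !orbT.
have eE : [set a; b]%SET \in edges Th by apply/edgeP; exists a, b, T.
have t01 : 0 < (1 / 2 : R) < 1 by apply/andP; split; lra.
have [cx ce] := edge_midpoint tr TT aT bT ab t01.
set m := _ + _ in cx ce.
have [_ ma mb mo] := carrier_edge tr TT aT bT ab cx ce.
have uE : m + (p c - m) = p c by rewrite addrC subrK.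
have J : \forall d \near (0 : R)^'+, chain_winding (bd T) (m + d *: (p c - m)) -
    chain_winding (bd T) (m - d *: (p c - m)) = 2.
  have <- : bd T a b *+ 2 = 2 by rewrite (bdE TT E) gtr0_sg.
  by apply: (chain_winding_jump cz eE t01); rewrite -/m uE.
have h := triangle_enter tr (u := p c - m) TT E ma mb mo.
rewrite uE divff// in h; have {}h := h ltr01.
have h0 : \forall d \near (0 : R)^'+, 0 < d by exact: nbhs_right_gt.
have [d [[d0 Jd] di]] := @filter_ex _ _ _ _ (filterI (filterI h0 J) h).
rewrite (chain_winding_triangle cz TT xi di) -Jd.
rewrite (bd_winding_out (x := m - _) TT) ?subr0// => /(triangle_bary tT)/(_ c).
rewrite -scaleNr bary_ray (bary_third m TT E)// mo mul0r.
have cT : c \in T by rewrite E !inE eqxx orbT.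
by rewrite bary_vertex// eqxx add0r subr0 mulr1 oppr_ge0 leNgt d0.
Qed.

Lemma sum_bd_winding (F : {set V} -> R) T x : T \in Th -> (simplex p T)° x ->
  chain_winding (fun a b => \sum_(T in Th) F T * bd T a b) x = F T * 2.
Proof.
move=> TT xi; rewrite chain_winding_bd (bigD1 T)//= bd_winding_in//.
rewrite big1 ?addr0// => T' /andP[TT' T'T].
rewrite bd_winding_out ?mulr0// => /(carrier_sub tr TT').
have [_ ->] := (interior_carrier tr _ TT).1 xi => sub.
by move/negP: T'T; apply; rewrite eq_sym eqEcard sub !(triangle_card tr).
Qed.

Lemma triangle_interior T : T \in Th -> exists x, (simplex p T)° x.
Proof.
move=> TT; have tT := mesh_triangle tr TT.
have T0 : (0 : R) < #|T|%:R by rewrite (triangle_card tr TT).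
pose x := \sum_(v in T) #|T|%:R^-1 *: p v.
exists x; apply/(open_triangle_bary tT) => v vT.
rewrite -(bary_uniq tT (l := fun=> #|T|%:R^-1))// ?invr_gt0//.
by rewrite sumr_const -[LHS]mulr_natl mulfV// gt_eqF.
Qed.

Lemma sum_bd_star (F : {set V} -> R) a b :
  \sum_(T in Th) F T * bd T a b = \sum_(T in star Th [set a; b]%SET) F T * bd T a b.
Proof.
rewrite (bigID (mem (star Th [set a; b]%SET))) /= [X in _ + X]big1 ?addr0.
  by apply: eq_bigl => T; rewrite star_pair; case: (T \in Th).
move=> T /andP[TT nT]; apply/eqP; rewrite mulf_eq0; apply/orP; right.
by apply: contraNT nT => /(bd_support TT)[].
Qed.

Lemma bd_opposite T1 T2 a b : a != b -> T1 != T2 ->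
  T1 \in star Th [set a; b]%SET -> T2 \in star Th [set a; b]%SET ->
  bd T2 a b = - bd T1 a b.
Proof.
move=> ab T12; rewrite !star_pair => /and3P[TT1 a1 b1] /and3P[TT2 a2 b2].
have [c1 [E1 o1]] := triangle_edge (mesh_triangle tr TT1) a1 b1 ab.
have [c2 [E2 o2]] := triangle_edge (mesh_triangle tr TT2) a2 b2 ab.
have := triangles_opposite tr TT1 TT2 T12 E1 E2.
rewrite (bdE TT1 E1) (bdE TT2 E2) -sgr_cp0 sgrM sgrV => /eqP h.
have : Num.sg (orient (p a) (p b) (p c2)) ^+ 2 = 1 by rewrite sqr_sg o2.
rewrite expr2 => h2.
by rewrite -[LHS]mul1r -[X in X * _]opprK -h mulNr -mulrA h2 mulr1.
Qed.

Lemma sum_bd_boundary (F : {set V} -> R) a b T :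
  [set a; b]%SET \in boundary_edges Th -> T \in star Th [set a; b]%SET ->
  \sum_(T in Th) F T * bd T a b = F T * bd T a b.
Proof.
rewrite sum_bd_star inE => /andP[_ /cards1P[T' ->]]; rewrite inE => /eqP ->.
by rewrite big_set1.
Qed.

Lemma sum_bd_interior (F : {set V} -> R) a b T1 T2 :
  [set a; b]%SET \in edges Th -> T1 != T2 ->
  T1 \in star Th [set a; b]%SET -> T2 \in star Th [set a; b]%SET ->
  \sum_(T in Th) F T * bd T a b = (F T1 - F T2) * bd T1 a b.
Proof.
move=> eE T12 s1 s2; rewrite sum_bd_star.
have -> : star Th [set a; b]%SET = [set T1; T2]%SET.
  apply/esym/eqP; rewrite eqEcard finset.subUset !finset.sub1set s1 s2 /=.
  by rewrite cards2 T12 (star_le2 tr).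
rewrite sum_set2// (bd_opposite _ T12 s1 s2) ?mulrN -?mulrBl//.
exact: edge_neq eE.
Qed.

Lemma edge_cases a b : [set a; b]%SET \in edges Th ->
  (exists2 T, [set a; b]%SET \in boundary_edges Th & T \in star Th [set a; b]%SET) \/
  (exists T1 T2, [/\ [set a; b]%SET \notin boundary_edges Th, T1 != T2,
     T1 \in star Th [set a; b]%SET & T2 \in star Th [set a; b]%SET]).
Proof.
move=> eE; have := star_gt0 eE; have := star_le2 tr eE.
rewrite leq_eqVlt => /orP[/eqP h _|h h'].
  right; have /cards2P[T1 [T2 [T12 E]]] : #|star Th [set a; b]%SET| == 2 by rewrite h.
  exists T1, T2; split => //; first by rewrite inE h andbF.
    by rewrite E finset.set21.
  by rewrite E finset.set22.
left; have /card_gt0P[T Ts] := h'; exists T => //.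
by rewrite inE eE eqn_leq -ltnS h h'.
Qed.

(** The factor 1 makes this an instance of the sums with coefficients [F T]. Interior edges cancel,
    so only boundary edges remain. *)
Definition bd_mesh a b : R := \sum_(T in Th) 1 * bd T a b.

Lemma bd_mesh_sqr a b : [set a; b]%SET \in boundary_edges Th -> bd_mesh a b ^+ 2 = 1.
Proof.
move=> eb; have eE := boundary_edge_edge eb.
have /card_gt0P[T Ts] := star_gt0 eE.
rewrite /bd_mesh (sum_bd_boundary _ eb Ts) mul1r bd_sqr//.
exact: edge_neq eE.
Qed.

Lemma bd_mesh_support a b : [set a; b]%SET \notin boundary_edges Th ->
  bd_mesh a b = 0.
Proof.
move=> nb; have [_ _ /(_ a b) h] := bd_mesh_cycle (fun=> 1).
have [//|nz] := eqVneq (bd_mesh a b) 0; have eE := h nz.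
have [[T eb]|[T1 [T2 [_ T12 s1 s2]]]] := edge_cases eE; first by rewrite eb in nb.
by rewrite /bd_mesh (sum_bd_interior _ eE T12 s1 s2) subrr mul0r.
Qed.

(** The germ of the polygon allows at most two, and the covering of the boundary gives one. Exactly
    one is impossible: [bd_mesh] is a cycle whose coefficients on boundary edges are 1 or -1, and
    those at [v] sum to 0. *)
Lemma boundary_neighbours2 v : boundary Omega (p v) ->
  exists b1 b2, b1 != b2 /\ boundary_neighbours Th v = [set b1; b2]%SET.
Proof.
move=> bv; suff /cards2P[b1 [b2 [h E]]] : #|boundary_neighbours Th v| == 2.
  by exists b1, b2.
rewrite eqn_leq (boundary_neighbours_le2 tr reg) /= ltnNge; apply/negP => le1.
have [e eb se] := boundary_cover tr reg bv.
have eE := boundary_edge_edge eb.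
have ve : v \in e.
  have [_ cv] := carrier_vertex tr v; move/(simplex_edge _ eE): se => [_].
  by rewrite cv finset.sub1set.
have [b eb'] : exists b, b \in boundary_neighbours Th v.
  have [a [b [_ [E _ _ _ _]]]] := edgeP _ _ eE.
  move: ve; rewrite E !inE => /orP[]/eqP vE.
    by exists b; rewrite in_boundary_neighbours vE -E.
  by exists a; rewrite in_boundary_neighbours vE finset.setUC -E.
have [_ /(_ v) + _] := bd_mesh_cycle (fun=> 1).
rewrite (bigD1 b)//= -/(bd_mesh v b) big1 => [|u ub]; last first.
  apply: bd_mesh_support; rewrite -in_boundary_neighbours.
  by apply: contra ub => ub; apply/eqP; exact: (card_le1_eqP le1).
rewrite addr0 => h; have := @bd_mesh_sqr v b.
rewrite -in_boundary_neighbours eb' h expr0n /= => /(_ isT) /eqP.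
by rewrite eq_sym oner_eq0.
Qed.

End Chains.

(** * Chains and cochains of the mesh *)

Lemma sum_pair (U : nmodType) (I J : finType) (h : I * J -> U) :
  \sum_j h j = \sum_a \sum_b h (a, b).
Proof. by rewrite (pair_bigA _ (fun a b => h (a, b))); apply: eq_bigr => -[]. Qed.

Section Homology.
Variables (R : realType) (V : finType) (p : V -> R * R) (Th : {set {set V}}).
Variable Omega : set (R * R).
Hypothesis tr : triangulation p Th Omega.
Hypothesis reg : polygonal_region_no_holes Omega.
Implicit Types (T s e : {set V}) (x : R * R) (a b c u v w : V).

(* If no boundary edge at [v] belonged to a triangle of the family [Q], the   *)
(* boundary of the sum of this family would avoid [v], while its winding      *)
(* number is nonzero near [v]; hence [v] would be an interior point.          *)
Lemma fan_boundary_edge (Q : pred {set V}) v :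
  boundary Omega (p v) ->
  (forall T T' b, T \in Th -> T' \in Th -> T != T' -> b != v ->
     v \in T -> b \in T -> v \in T' -> b \in T' -> Q T = Q T') ->
  (exists T, [/\ T \in Th, v \in T & Q T]) ->
  exists b T, [/\ b \in boundary_neighbours Th v, T \in Th, v \in T, b \in T & Q T].
Proof.
move=> bv Qinv [T0 [TT0 vT0 QT0]]; apply: contrapT => nb.
pose F T : R := ((v \in T) && Q T)%:R.
pose z a b := \sum_(T in Th) F T * bd p T a b.
have cz : mesh_cycle Th z by exact: (bd_mesh_cycle tr).
have [zC _ zE] := cz.
have zv b : z v b = 0.
  have [//|/[dup] nz /zE eE] := eqVneq (z v b) 0.
  have vb := edge_neq eE.
  have [[T eb sT]|[T1 [T2 [_ T12 s1 s2]]]] := edge_cases tr eE.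
    rewrite /z (sum_bd_boundary _ _ eb sT) /F; move: sT.
    rewrite star_pair => /and3P[TT vT bT]; rewrite vT /=.
    case: (boolP (Q T)) => QT; last by rewrite mul0r.
    by case: nb; exists b, T; rewrite in_boundary_neighbours.
  rewrite /z (sum_bd_interior tr _ eE T12 s1 s2) /F.
  move: s1 s2; rewrite !star_pair => /and3P[TT1 v1 b1] /and3P[TT2 v2 b2].
  rewrite v1 v2 (Qinv _ _ _ TT1 TT2 T12 _ v1 b1 v2 b2) ?subrr ?mul0r//.
  by rewrite eq_sym.
have near_v : \forall y \near p v, chain_winding p z y = chain_winding p z (p v).
  apply: chain_winding_near cz _ _ => a b zab /(simplex_edge tr _ (zE _ _ zab))[_].
  have [_ ->] := carrier_vertex tr v; rewrite finset.sub1set !inE.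
  move=> /orP[]/eqP vE; move: zab; rewrite -vE ?zv ?eqxx//.
  by rewrite zC zv oppr0 eqxx.
(* The value is read off at a point of [T0] close to [v], where the chain [F] has coefficient 1. *)
have wv : chain_winding p z (p v) = 2.
  have [x xi] := triangle_interior tr TT0.
  have h := near_ray (x - p v) near_v.
  have h0 : \forall d \near (0 : R)^'+, 0 < d by exact: nbhs_right_gt.
  have h1 : \forall d \near (0 : R)^'+, d < 1 by exact: nbhs_right_lt.
  have [d [[d0 d1] <-]] := @filter_ex _ _ _ _ (filterI (filterI h0 h1) h).
  rewrite (sum_bd_winding tr F TT0); first by rewrite /F vT0 QT0 mul1r.
  have tT := mesh_triangle tr TT0; apply/(open_triangle_bary tT) => w wT.
  rewrite bary_ray bary_vertex//; have := (open_triangle_bary tT x).1 xi w wT.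
  by case: (w == v) => /=; nra.
apply: (region_boundary_notin reg bv); apply: (region_interior_closure reg).
rewrite /interior /=; apply: filterS near_v => y; rewrite wv => wy.
apply/(closure_mesh tr); apply: contrapT => ny.
move: wy; rewrite chain_winding_bd big1 => [/eqP|T TT].
  by rewrite eq_sym pnatr_eq0.
rewrite (bd_winding_out tr) ?mulr0// => sT; apply: ny; exists T => //.
Qed.

(** The triangles at a boundary vertex form a single fan. For a nonempty family closed under
    crossing edges at [v], the boundary of its sum can involve at [v] only the two boundary edges,
    and the cycle condition ties their coefficients; so the family contains the triangle [T1] on the
    first of them. This is applied to the level sets of [G]. *)
Lemma fan_constant (K : eqType) (G : {set V} -> K) v :
  boundary Omega (p v) ->
  (forall T T' b, T \in Th -> T' \in Th -> T != T' -> b != v ->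
     v \in T -> b \in T -> v \in T' -> b \in T' -> G T = G T') ->
  forall T T', T \in Th -> T' \in Th -> v \in T -> v \in T' -> G T = G T'.
Proof.
move=> bv Ginv T T' TT TT' vT vT'.
have [b1 [b2 [b12 NE]]] := boundary_neighbours2 tr reg bv.
have e1 : [set v; b1]%SET \in boundary_edges Th.
  by rewrite -in_boundary_neighbours NE !inE eqxx.
have e2 : [set v; b2]%SET \in boundary_edges Th.
  by rewrite -in_boundary_neighbours NE !inE eqxx orbT.
have star1 b : [set v; b]%SET \in boundary_edges Th -> exists S,
    star Th [set v; b]%SET = [set S]%SET.
  by rewrite inE => /andP[_ /cards1P].
have [T1 S1] := star1 _ e1; have [T2 S2] := star1 _ e2.
have memS b S : star Th [set v; b]%SET = [set S]%SET ->
    [/\ S \in Th, v \in S & b \in S].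
  by move=> SE; apply/and3P; rewrite -star_pair SE inE.
have [TT1 v1 b1T] := memS _ _ S1; have [TT2 v2 b2T] := memS _ _ S2.
suff allT (Q : pred {set V}) : (exists T, [/\ T \in Th, v \in T & Q T]) ->
    (forall T T' b, T \in Th -> T' \in Th -> T != T' -> b != v ->
     v \in T -> b \in T -> v \in T' -> b \in T' -> Q T = Q T') -> Q T1.
  have /eqP <- : G T1 == G T.
    apply: (allT (fun S => G S == G T)); first by exists T.
    by move=> S S' b *; congr (_ == _); apply: Ginv; eauto.
  apply/eqP; apply: (allT (fun S => G S == G T')); first by exists T'.
  by move=> S S' b *; congr (_ == _); apply: Ginv; eauto.
move=> exQ Qinv; have [b [S [bN TS vS bS QS]]] := fan_boundary_edge bv Qinv exQ.
pose F (S : {set V}) : R := ((v \in S) && Q S)%:R.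
pose z a b := \sum_(S in Th) F S * bd p S a b.
have [zC z0 zE] : mesh_cycle Th z by exact: (bd_mesh_cycle tr).
have zv u : u \notin boundary_neighbours Th v -> z v u = 0.
  rewrite in_boundary_neighbours => nb.
  have [//|/[dup] nz /zE eE] := eqVneq (z v u) 0.
  have vb := edge_neq eE.
  have [[U eb sU]|[U1 [U2 [_ U12 s1 s2]]]] := edge_cases tr eE.
    by rewrite eb in nb.
  rewrite /z (sum_bd_interior tr _ eE U12 s1 s2) /F.
  move: s1 s2; rewrite !star_pair => /and3P[TU1 vU1 uU1] /and3P[TU2 vU2 uU2].
  rewrite vU1 vU2 (Qinv _ _ _ TU1 TU2 U12 _ vU1 uU1 vU2 uU2) ?subrr ?mul0r//.
  by rewrite eq_sym.
have sS1 : T1 \in star Th [set v; b1]%SET by rewrite S1 inE.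
have sS2 : T2 \in star Th [set v; b2]%SET by rewrite S2 inE.
have := z0 v; rewrite (bigD1 b1)//= (bigD1 b2)/=; last by rewrite eq_sym.
rewrite big1 ?addr0 => [|u /andP[u1 u2]]; last first.
  by apply: zv; rewrite NE !inE negb_or u1.
rewrite /z (sum_bd_boundary _ _ e1 sS1) (sum_bd_boundary _ _ e2 sS2) /F v1 v2 /=.
have q2 := bd_sqr tr sS2 (edge_neq (boundary_edge_edge e2)).
have QT12 : Q T1 || Q T2.
  have memS' b' S' : star Th [set v; b']%SET = [set S']%SET -> b' \in S ->
      S = S'.
    by move=> E b'S; apply/finset.set1P; rewrite -E star_pair TS vS.
  move: bN; rewrite NE !inE => /orP[]/eqP bE; rewrite bE in bS.
    by rewrite -(memS' _ _ S1 bS) QS.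
  by rewrite -(memS' _ _ S2 bS) QS orbT.
case: (boolP (Q T1)) QT12 => //= nQ1 ->; rewrite mul0r mul1r add0r => h.
by move: q2; rewrite h expr0n /= => /eqP; rewrite eq_sym oner_eq0.
Qed.

Lemma mesh_cycle_sub z1 z2 : mesh_cycle Th z1 -> mesh_cycle Th z2 ->
  mesh_cycle Th (fun a b => z1 a b - z2 a b : R).
Proof.
move=> [c1 s1 e1] [c2 s2 e2]; split => [a b|v|a b].
- by rewrite c1 c2 opprB opprK addrC.
- by rewrite sumrB s1 s2 subrr.
- have [->|/e1//] := eqVneq (z1 a b) 0; rewrite sub0r oppr_eq0; exact: e2.
Qed.

(* Every 1-cycle is a boundary: subtracting the triangles weighted by the     *)
(* winding number leaves a cycle on the boundary polygon, which has to be a   *)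
(* multiple of the boundary of the whole mesh.                                *)
Lemma cycle_boundary z : mesh_cycle Th z ->
  exists F : {set V} -> R, forall a b, z a b = \sum_(T in Th) F T * bd p T a b.
Proof.
move=> cz; pose g T := if pselect (exists x, (simplex p T)° x) is left h
  then projT1 (cid h) else 0.
have gi T : T \in Th -> (simplex p T)° (g T).
  move=> TT; rewrite /g; case: pselect => [h|[]]; first by case: cid.
  by have [x xi] := triangle_interior tr TT; exists x.
(* The division by 2 is there because [chain_winding (bd T)] equals 2 inside [T]. *)
pose F0 T := chain_winding p z (g T) / 2.
pose z' a b := z a b - \sum_(T in Th) F0 T * bd p T a b.
have cz' : mesh_cycle Th z' by apply: mesh_cycle_sub => //; exact: (bd_mesh_cycle tr).
(* Across an interior edge the winding number of [z] jumps by twice the coefficient of [z], and the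
   difference of the two values of [F0] is half of that jump. *)
have zin a b : [set a; b]%SET \in edges Th ->
    [set a; b]%SET \notin boundary_edges Th -> z' a b = 0.
  move=> eE nb; have ab := edge_neq eE.
  have [[T eb]|[T1 [T2 [_ T12 s1 s2]]]] := edge_cases tr eE; first by rewrite eb in nb.
  (* The two triangles carry the edge with opposite signs; [T1] is taken to be the one on its
     left. *)
  wlog b1 : T1 T2 T12 s1 s2 / bd p T1 a b = 1.
    move=> H; have /eqP := bd_sqr tr s1 ab; rewrite sqrf_eq1 => /orP[]/eqP b1.
      exact: (H T1 T2).
    apply: (H T2 T1) => //; first by rewrite eq_sym.
    by rewrite (bd_opposite tr ab T12 s1 s2) b1 opprK.
  rewrite /z' (sum_bd_interior tr _ eE T12 s1 s2) b1 mulr1 /F0 -mulrBl.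
  have b2 := bd_opposite tr ab T12 s1 s2; rewrite b1 in b2.
  move: (s1) (s2); rewrite !star_pair => /and3P[TT1 a1 b1'] /and3P[TT2 a2 b2'].
  have [c1 [E1 o1]] := triangle_edge (mesh_triangle tr TT1) a1 b1' ab.
  have [c2 [E2 o2]] := triangle_edge (mesh_triangle tr TT2) a2 b2' ab.
  have o1' : 0 < orient (p a) (p b) (p c1) by rewrite -sgr_cp0 -(bdE tr TT1 E1) b1.
  have o2' : orient (p a) (p b) (p c2) < 0 by rewrite -sgr_cp0 -(bdE tr TT2 E2) b2.
  have t01 : 0 < (1 / 2 : R) < 1 by apply/andP; split; lra.
  have [cx ce] := edge_midpoint tr TT1 a1 b1' ab t01.
  set m := _ + _ in cx ce.
  have [_ ma mb mo] := carrier_edge tr TT1 a1 b1' ab cx ce.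
  have [_ ma2 mb2 _] := carrier_edge tr TT2 a2 b2' ab cx ce.
  have uE : m + (p c1 - m) = p c1 by rewrite addrC subrK.
  have J : \forall d \near (0 : R)^'+, chain_winding p z (m + d *: (p c1 - m)) -
      chain_winding p z (m - d *: (p c1 - m)) = z a b *+ 2.
    by apply: (chain_winding_jump tr cz eE t01); rewrite -/m uE.
  have h1 : \forall d \near (0 : R)^'+, (simplex p T1)° (m + d *: (p c1 - m)).
    by apply: (triangle_enter tr TT1 E1) => //; rewrite uE divff.
  have h2 : \forall d \near (0 : R)^'+, (simplex p T2)° (m + d *: (- (p c1 - m))).
    apply: (triangle_enter tr TT2 E2) => //.
    have -> : orient (p a) (p b) (m - (p c1 - m)) =
      2 * orient (p a) (p b) m - orient (p a) (p b) (p c1).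
      by rewrite !orientE /=; ring.
    by rewrite mo mulr0 sub0r nmulr_rgt0 ?oppr_lt0// invr_lt0.
  have [d [[Jd d1] d2]] := @filter_ex _ _ _ _ (filterI (filterI J h1) h2).
  rewrite (chain_winding_triangle tr cz TT1 (gi _ TT1) d1).
  rewrite (chain_winding_triangle tr cz TT2 (gi _ TT2) d2).
  by rewrite scalerN Jd; field.
have [zC' zs' zE'] := cz'.
have zin' a b : [set a; b]%SET \notin boundary_edges Th -> z' a b = 0.
  by move=> nb; have [//|/zE' eE] := eqVneq (z' a b) 0; exact: zin.
have [bC bs bE] : mesh_cycle Th (bd_mesh p Th) by exact: (bd_mesh_cycle tr (fun=> 1)).
(* The ratio of [z'] to [bd_mesh] on a boundary edge: as [bd_mesh] is 1 or -1 there, the product is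
   the quotient, and it does not depend on the direction. Both directions are summed, hence the
   division by 2. *)
pose r e := (\sum_(a in e) \sum_(b in e) z' a b * bd_mesh p Th a b) / 2.
have rE a b : [set a; b]%SET \in edges Th ->
    r [set a; b]%SET = z' a b * bd_mesh p Th a b.
  move=> eE; have ab := edge_neq eE; rewrite /r sum_set2// !sum_set2//.
  have -> : bd_mesh p Th a a = 0.
    by rewrite /bd_mesh big1// => T _; rewrite bd_diag mulr0.
  have -> : bd_mesh p Th b b = 0.
    by rewrite /bd_mesh big1// => T _; rewrite bd_diag mulr0.
  by rewrite (zC' a b) (bC a b); field.
(* At a boundary vertex both cycles live on the same two edges with opposite coefficients, so the
   ratios agree. *)
have rv v b b' : [set v; b]%SET \in boundary_edges Th ->
    [set v; b']%SET \in boundary_edges Th ->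
    r [set v; b]%SET = r [set v; b']%SET.
  move=> eb eb'; have [->//|bb'] := eqVneq b b'.
  have bv : boundary Omega (p v).
    by apply: (boundary_edge_vertex tr reg eb); rewrite !inE eqxx.
  have [b1 [b2 [b12 NE]]] := boundary_neighbours2 tr reg bv.
  have {}NE : boundary_neighbours Th v = [set b; b']%SET.
    apply/esym/eqP; rewrite eqEcard finset.subUset !finset.sub1set.
    by rewrite !in_boundary_neighbours eb eb' NE !cards2 bb' b12.
  rewrite !rE ?boundary_edge_edge//.
  have S (y : V -> V -> R) : (forall a b, [set a; b]%SET \notin boundary_edges Th ->
      y a b = 0) -> \sum_u y v u = y v b + y v b'.
    move=> y0; rewrite (bigD1 b)//= (bigD1 b')/=; last by rewrite eq_sym.
    rewrite big1 ?addr0// => u /andP[u1 u2]; apply: y0.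
    by rewrite -in_boundary_neighbours NE !inE negb_or u1.
  have := zs' v; rewrite (S z')// => /eqP; rewrite addr_eq0 => /eqP ->.
  have := bs v; rewrite (S (bd_mesh p Th)); last exact: bd_mesh_support tr.
  by move=> /eqP; rewrite addr_eq0 => /eqP ->; rewrite mulrNN.
have rx e e' x : e \in boundary_edges Th -> e' \in boundary_edges Th ->
    simplex p e x -> simplex p e' x -> r e = r e'.
  move=> eb eb' /(simplex_edge tr _ (boundary_edge_edge eb))[cx ce].
  move=> /(simplex_edge tr _ (boundary_edge_edge eb'))[_ ce'].
  have /set0Pn[v vc] := carrier_neq0 tr cx.
  have edge_at f : f \in boundary_edges Th -> v \in f ->
      exists2 b, f = [set v; b]%SET & [set v; b]%SET \in boundary_edges Th.
    move=> fb; have [a [b [_ [E _ _ _ _]]]] := edgeP _ _ (boundary_edge_edge fb).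
    rewrite E !inE => /orP[]/eqP vE; first by exists b; rewrite vE -?E.
    by exists a; rewrite vE finset.setUC -?E.
  have [b -> h] := edge_at e eb (fintype.subsetP ce v vc).
  by have [b' -> h'] := edge_at e' eb' (fintype.subsetP ce' v vc); exact: rv.
have [x0 bx0] : exists x, boundary Omega x.
  by have [y yb _] := region_boundary_two reg 0; exists y.
have [e0 eb0 sx0] := boundary_cover tr reg bx0.
(* [r] is spread to a locally constant function [f] on the boundary points, so that connectedness of
   the polygon applies. *)
have rconst e : e \in boundary_edges Th -> r e = r e0.
  move=> eb; pose f x := if [pick e in boundary_edges Th | `[< simplex p e x >]]
    is Some e then r e else 0.
  have fE e' x : e' \in boundary_edges Th -> simplex p e' x -> f x = r e'.
    move=> eb' sx; rewrite /f; case: pickP => [e1 /andP[eb1 /asboolP s1]|/(_ e')].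
      exact: rx eb1 eb' s1 sx.
    by rewrite eb' => /asboolP.
  have [y sy] : exists y, simplex p e y.
    have [a [b [T [E ab TT aT bT]]]] := edgeP _ _ (boundary_edge_edge eb).
    by exists (p a); rewrite E simplex_pairE//; exact: segment_left.
  rewrite -(fE _ _ eb sy) -(fE _ _ eb0 sx0).
  apply: (locally_constant_connected (region_boundary_connected reg)) => //; last first.
    exact: (boundary_edge_sub tr reg eb sy).
  move=> x bx; have : \forall y \near x, forall e, e \in boundary_edges Th ->
      simplex p e y -> simplex p e x.
    apply: (@filter_forall _ _ (fun e y => e \in boundary_edges Th ->
      simplex p e y -> simplex p e x) (nbhs x) _) => e'.
    have [eb'|eb'] := boolP (e' \in boundary_edges Th); last exact: nearW.
    have [?|nx] := pselect (simplex p e' x); first exact: nearW.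
    have : nbhs x (~` simplex p e').
      apply: open_nbhs_nbhs; split => //; apply: closed_openC.
      exact: boundary_edge_closed eb'.
    by apply: filterS.
  apply: filterS => t ht bt; have [e' eb' st] := boundary_cover tr reg bt.
  by rewrite (fE _ _ eb' st) (fE _ _ eb' (ht _ eb' st)).
exists (fun T => F0 T + r e0) => a b.
under eq_bigr do rewrite mulrDl; rewrite big_split /= -mulr_sumr.
have -> : \sum_(T in Th) bd p T a b = bd_mesh p Th a b.
  by apply: eq_bigr => T _; rewrite mul1r.
apply/eqP; rewrite addrC -subr_eq -/(z' a b); apply/eqP.
have [eb|nb] := boolP ([set a; b]%SET \in boundary_edges Th); last first.
  by rewrite (bd_mesh_support tr nb) mulr0 zin'.
rewrite -(rconst _ eb) rE ?boundary_edge_edge// -mulrA -expr2.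
by rewrite (bd_mesh_sqr tr eb) mulr1.
Qed.

(** The winding number inside a triangle recovers its coefficient. *)
Lemma bd_injective (F : {set V} -> R) :
  (forall a b, \sum_(T in Th) F T * bd p T a b = 0) ->
  forall T, T \in Th -> F T = 0.
Proof.
move=> F0 T TT; have [x xi] := triangle_interior tr TT.
have := sum_bd_winding tr F TT xi; rewrite /chain_winding /winding big1.
  by move=> /esym/eqP; rewrite mulf_eq0 pnatr_eq0 orbF => /eqP.
by move=> ab _; rewrite F0 mul0r.
Qed.

(** Data constant on triangles define a locally constant function on the closure of [Omega], which
    is connected. *)
Lemma mesh_connected (K : Type) (f : V -> K) :
  (forall T a b, T \in Th -> a \in T -> b \in T -> f a = f b) ->
  forall a b, f a = f b.
Proof.
move=> fT a b.
pose g x := if [pick v in carrier p Th x] is Some v then f v else f a.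
have gE T v x : T \in Th -> v \in T -> simplex p T x -> g x = f v.
  move=> TT vT sx; rewrite /g; case: pickP => [w wc|c0].
    by apply: (fT T) => //; apply: (fintype.subsetP (carrier_sub tr TT sx)).
  have cx : closure Omega x by apply/(closure_mesh tr); exists T.
  by have /set0Pn[w] := carrier_neq0 tr cx; rewrite c0.
have gv v : g (p v) = f v.
  have [T TT vT] := vertex_mesh tr v; apply: (gE T) => //.
  exact/(vertex_simplex tr _ TT (subxx T)).
rewrite -(gv a) -(gv b).
have [ca _] := carrier_vertex tr a; have [cb _] := carrier_vertex tr b.
apply: (locally_constant_connected (connected_closure (region_connected reg))) => //.
move=> x cx; have := near_mesh tr x; apply: filterS => y hy cy.
have [T TT sy] := (closure_mesh tr y).1 cy.
have [c [d [e [E _]]]] := triangleP (mesh_triangle tr TT).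
have cT : c \in T by rewrite E !inE eqxx.
by rewrite (gE T c)// (gE T c)//; exact: hy.
Qed.

Lemma sum_bd_cochain (g : V -> V -> R) T a b c : T \in Th ->
  (forall a b, g b a = - g a b) -> T = [set a; b; c]%SET ->
  0 < orient (p a) (p b) (p c) ->
  \sum_d \sum_e bd p T d e * g d e = (g a b + g b c + g c a) *+ 2.
Proof.
move=> TT gC E o; have [ab bc ac] := vertices_neq (lt0r_neq0 o).
have red (h : V -> R) : (forall d, d \notin T -> h d = 0) ->
    \sum_d h d = h a + h b + h c.
  move=> h0; rewrite (bigID (mem T)) /= [X in _ + X]big1 ?addr0 => [|d]; last exact: h0.
  by rewrite E sum_set3.
rewrite red => [|d dT]; last by rewrite big1// => e _; rewrite /bd (negbTE dT) mul0r.
rewrite !red; try by move=> d dT; rewrite /bd (negbTE dT) andbF mul0r.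
rewrite !bd_diag !mul0r.
have E1 : T = [set b; c; a]%SET by rewrite -set3_rot.
have E2 : T = [set c; a; b]%SET by rewrite -set3_rot.
have b1 : bd p T a b = 1 by rewrite (bdE tr TT E) gtr0_sg.
have b2 : bd p T b c = 1 by rewrite (bdE tr TT E1) gtr0_sg// -orient_rot.
have b3 : bd p T c a = 1 by rewrite (bdE tr TT E2) gtr0_sg// orient_rot.
rewrite (bdC _ _ a b) (bdC _ _ b c) (bdC _ _ c a) b1 b2 b3.
rewrite (gC a b) (gC b c) (gC c a); ring.
Qed.

(** The dual of [cycle_boundary]: [g] is a coboundary once it kills all cycles, and cycles are
    combinations of triangle boundaries, which [g] kills by assumption. *)
Lemma cocycle_exact (g : V -> V -> R) :
  (forall a b, g b a = - g a b) ->
  (forall T a b c, T \in Th -> T = [set a; b; c]%SET ->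
     0 < orient (p a) (p b) (p c) -> g a b + g b c + g c a = 0) ->
  exists f : V -> R, forall a b, [set a; b]%SET \in edges Th -> g a b = f b - f a.
Proof.
move=> gC g0.
pose I a b : R := ([set a; b]%SET \in edges Th)%:R.
have IC a b : I b a = I a b by rewrite /I finset.setUC.
pose B (ab : V * V) k := I ab.1 ab.2 * ((k == ab.2)%:R - (k == ab.1)%:R).
have [z hz|f fE] := @fredholm R _ _ B (fun ab => I ab.1 ab.2 * g ab.1 ab.2); last first.
  exists f => a b eE; have := fE (a, b); rewrite /B /= /I eE mul1r => ->.
  under eq_bigr do rewrite mul1r mulrBl.
  rewrite sumrB; congr (_ - _).
    by rewrite (bigD1 b)//= eqxx mul1r big1 ?addr0// => k /negbTE ->; rewrite mul0r.
  by rewrite (bigD1 a)//= eqxx mul1r big1 ?addr0// => k /negbTE ->; rewrite mul0r.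
(* The null vector [z] is any function on ordered pairs; masked to the edges and antisymmetrised it
   becomes a mesh cycle, whose pairing with [g] is doubled. *)
pose z' a b := I a b * (z (a, b) - z (b, a)).
have cz : mesh_cycle Th z'.
  split => [a b|v|a b]; rewrite /z'.
  - by rewrite IC -mulrN opprB.
  - have := hz v; rewrite sum_pair /B /=.
    have E a b : z (a, b) * (I a b * ((v == b)%:R - (v == a)%:R)) =
      (v == b)%:R * (I a b * z (a, b)) - (v == a)%:R * (I a b * z (a, b)) by ring.
    under eq_bigr do under eq_bigr do rewrite E.
    under eq_bigr do rewrite sumrB; rewrite sumrB exchange_big /=.
    under eq_bigr do rewrite -mulr_sumr.
    under [X in _ - X]eq_bigr do rewrite -mulr_sumr.
    have pick1 (h : V -> R) : \sum_i (v == i)%:R * h i = h v.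
      rewrite (bigD1 v)//= eqxx mul1r big1 ?addr0// => i.
      by rewrite eq_sym => /negbTE ->; rewrite mul0r.
    rewrite !pick1 => /eqP; rewrite subr_eq0 => /eqP h.
    under eq_bigr do rewrite mulrBr.
    rewrite sumrB -h; apply/eqP; rewrite subr_eq0; apply/eqP.
    by apply: eq_bigr => i _; rewrite IC.
  - by rewrite /I; case: (_ \in _) => //; rewrite mul0r eqxx.
have [F FE] := cycle_boundary cz.
have : (\sum_a \sum_b z' a b * g a b) = 0.
  under eq_bigr do under eq_bigr do rewrite FE mulr_suml.
  under eq_bigr do rewrite exchange_big; rewrite exchange_big big1// => T TT /=.
  have [a [b [c [E o]]]] := triangleP (mesh_triangle tr TT).
  under eq_bigr do under eq_bigr do rewrite -mulrA.
  under eq_bigr do rewrite -mulr_sumr; rewrite -mulr_sumr.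
  by rewrite (sum_bd_cochain TT gC E o) (g0 _ _ _ _ TT E o) mul0rn mulr0.
have E a b : z' a b * g a b = z (a, b) * (I a b * g a b) + z (b, a) * (I b a * g b a).
  by rewrite /z' IC (gC a b); ring.
under eq_bigr do under eq_bigr do rewrite E.
under eq_bigr do rewrite big_split; rewrite big_split /=.
rewrite [X in _ + X]exchange_big /= -mulr2n => /eqP; rewrite mulrn_eq0 /= => /eqP.
by rewrite sum_pair.
Qed.

(** The dual of [bd_injective]. The solution found on ordered pairs is antisymmetrised and cut off
    outside the edges, which does not change its pairing with [bd T]. *)
Lemma cochain_surjective (y : {set V} -> R) : exists g : V -> V -> R,
  [/\ forall a b, g b a = - g a b,
      forall a b, [set a; b]%SET \notin edges Th -> g a b = 0 &
      forall T, T \in Th -> \sum_a \sum_b bd p T a b * g a b = y T].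
Proof.
pose B T (ab : V * V) := (T \in Th)%:R * bd p T ab.1 ab.2.
have [z hz|f fE] := @fredholm R _ _ B (fun T => (T \in Th)%:R * y T).
  rewrite big1// => T _; have [TT|] := boolP (T \in Th); last by rewrite mul0r mulr0.
  rewrite (bd_injective (F := z))// ?mul0r// => a b.
  have := hz (a, b); rewrite /B /= (bigID (mem Th)) /= [X in _ + X]big1 ?addr0.
    by move=> h; rewrite -[RHS]h; apply: eq_bigr => S ->; rewrite mul1r.
  by move=> S /negbTE ->; rewrite mul0r mulr0.
pose I a b : R := ([set a; b]%SET \in edges Th)%:R.
have IC a b : I b a = I a b by rewrite /I finset.setUC.
exists (fun a b => I a b * (f (a, b) - f (b, a)) / 2); split.
- by move=> a b; rewrite IC; field.
- by move=> a b /negbTE nE; rewrite /I nE !mul0r.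
move=> T TT; have := fE T; rewrite /B TT mul1r => ->.
rewrite sum_pair /=.
have E a b : bd p T a b * (I a b * (f (a, b) - f (b, a)) / 2) =
    (bd p T a b * f (a, b)) / 2 + (bd p T b a * f (b, a)) / 2.
  rewrite (bdC _ _ a b); have [->|/(bd_support TT)[_ eE]] := eqVneq (bd p T a b) 0.
    by rewrite oppr0 !mul0r addr0.
  by rewrite /I eE mulr1n; field.
under eq_bigr do under eq_bigr do rewrite E.
under eq_bigr do rewrite big_split; rewrite big_split /=.
rewrite [X in _ + X]exchange_big /= -big_split /=; apply: eq_bigr => a _.
by rewrite -big_split; apply: eq_bigr => b _ /=; field.
Qed.

End Homology.

(** * Euler's formula *)

Lemma linear_fctE (R : realType) (T : Type) (r : R) (f g : T -> R) x :
  (r *: f + g) x = r * f x + g x.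
Proof. by []. Qed.

Section Euler.
Variables (R : realType) (V : finType) (p : V -> R * R) (Th : {set {set V}}).
Variable Omega : set (R * R).
Hypothesis tr : triangulation p Th Omega.
Hypothesis reg : polygonal_region_no_holes Omega.
Implicit Types (T e : {set V}) (a b c v w : V) (f : V -> R) (h : {set V} -> R).

(** An arbitrary orientation of the edges, by the enumeration of [V]. It identifies functions on
    edges with antisymmetric functions of ordered pairs, so that 1-cochains form a space of
    dimension [#|edges Th|]. *)
Let sgn a b : R := Num.sg ((enum_rank b)%:R - (enum_rank a)%:R).

Let sgnC a b : sgn b a = - sgn a b.
Proof. by rewrite /sgn -sgrN opprB. Qed.

Let sgn_sqr a b : a != b -> sgn a b * sgn a b = 1.
Proof.
by move=> ab; rewrite -expr2 sqr_sg subr_eq0 eqr_nat (inj_eq val_inj)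
  (inj_eq enum_rank_inj) eq_sym ab.
Qed.

Let sgn_diag a : sgn a a = 0. Proof. by rewrite /sgn subrr sgr0. Qed.

Let ext h a b := sgn a b * h [set a; b]%SET.

Let extC h a b : ext h b a = - ext h a b.
Proof. by rewrite /ext sgnC finset.setUC mulNr. Qed.

Let restr (g : V -> V -> R) e : R :=
  if e \in edges Th then (\sum_(a in e) \sum_(b in e) sgn a b * g a b) / 2 else 0.

Let restrE g a b : (forall a b, g b a = - g a b) ->
  [set a; b]%SET \in edges Th -> restr g [set a; b]%SET = sgn a b * g a b.
Proof.
move=> gC eE; have ab := edge_neq eE; rewrite /restr eE sum_set2// !sum_set2//.
by rewrite !sgn_diag (sgnC a b) (gC a b); field.
Qed.

Let ext_restr g a b : (forall a b, g b a = - g a b) ->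
  [set a; b]%SET \in edges Th -> ext (restr g) a b = g a b.
Proof.
by move=> gC eE; rewrite /ext restrE// mulrA sgn_sqr ?mul1r//; exact: edge_neq eE.
Qed.

Let delta f : {set V} -> R := restr (fun a b => f b - f a).

Let delta_ext f a b : [set a; b]%SET \in edges Th -> ext (delta f) a b = f b - f a.
Proof. by move=> eE; rewrite /delta ext_restr// => ? ?; rewrite opprB. Qed.

Let d1 h T : R :=
  if T \in Th then \sum_a \sum_b bd p T a b * ext h a b else 0.

Let triangle_edges T a b c : T \in Th -> T = [set a; b; c]%SET ->
  a != b -> b != c -> a != c ->
  [/\ [set a; b]%SET \in edges Th, [set b; c]%SET \in edges Th &
      [set c; a]%SET \in edges Th].
Proof.
move=> TT E ab bc ac; split; apply/edgeP; [exists a, b, T|exists b, c, T|exists c, a, T];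
  by split; rewrite // ?E ?inE ?eqxx ?orbT// eq_sym.
Qed.

Let kernel_delta f : delta f = 0 -> forall a b, f a = f b.
Proof.
move=> f0; apply: (mesh_connected tr reg) => T a b TT aT bT.
have [->//|ab] := eqVneq a b.
have eE : [set a; b]%SET \in edges Th by apply/edgeP; exists a, b, T.
have := delta_ext f eE; rewrite f0 /ext mulr0 => /esym/eqP.
by rewrite subr_eq0 => /eqP.
Qed.

Let cochains (A : {set {set V}}) : set ({set V} -> R) :=
  [set h | forall e, e \notin A -> h e = 0].

Let cochains_lin A (r : R) h h' :
  cochains A h -> cochains A h' -> cochains A (r *: h + h').
Proof. by move=> u0 v0 e eA; rewrite linear_fctE u0// v0// mulr0 addr0. Qed.

Let cochains0 A : cochains A 0. Proof. by []. Qed.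

Let ext_lin (r : R) h h' c d :
  ext (r *: h + h') c d = r * ext h c d + ext h' c d.
Proof. by rewrite /ext linear_fctE; ring. Qed.

Let d1_lin (r : R) h h' : d1 (r *: h + h') = r *: d1 h + d1 h'.
Proof.
apply/funext => T; rewrite linear_fctE /d1; case: ifP => _; last by rewrite mulr0 addr0.
rewrite mulr_sumr -big_split /=; apply: eq_bigr => c _.
rewrite mulr_sumr -big_split /=; apply: eq_bigr => d _.
by rewrite ext_lin; ring.
Qed.

Let d1_cochains h : cochains (edges Th) h -> cochains Th (d1 h).
Proof. by move=> _ T nT; rewrite /d1 (negbTE nT). Qed.

Let delta_lin (r : R) f f' : delta (r *: f + f') = r *: delta f + delta f'.
Proof.
apply/funext => e; rewrite linear_fctE /delta /restr.
case: ifP => _; last by rewrite mulr0 addr0.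
rewrite mulrA -mulrDl; congr (_ / _).
rewrite mulr_sumr -big_split /=; apply: eq_bigr => c _.
rewrite mulr_sumr -big_split /=; apply: eq_bigr => d _.
by rewrite !linear_fctE; ring.
Qed.

Let d1_delta f : d1 (delta f) = 0.
Proof.
apply/funext => T; rewrite /d1; case: ifP => // TT.
have [a [b [c [E o]]]] := triangleP (mesh_triangle tr TT).
have [ab bc ac] := vertices_neq (lt0r_neq0 o).
have [e1 e2 e3] := triangle_edges TT E ab bc ac.
rewrite (sum_bd_cochain tr TT (extC _) E o) !delta_ext//.
by rewrite -[RHS](mul0rn _ 2); congr (_ *+ _); ring.
Qed.

(** The alternating sum of dimensions in the exact sequence of constants, 0-, 1- and 2-cochains:
    [d1] is onto, its kernel is the range of [delta], and the kernel of [delta] consists of the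
    constants. *)
Lemma euler : (#|V| + #|Th| = #|edges Th| + 1)%N.
Proof.
have [r1 [r1E _ dK surj1]] := rank_nullity (@cochains_lin (edges Th))
  (@cochains0 (edges Th)) (fun r h h' _ _ => d1_lin r h h')
  (D := cochains Th) d1_cochains
  (@cochains_lin Th) (@cochains0 Th)
  (has_dim_ffun R (edges Th)) (has_dim_ffun R Th).
have r1t : r1 = #|Th|.
  apply/surj1/seteqP; split => [_ [h hE <-] e eTh|y yTh].
    by rewrite /d1 (negbTE eTh).
  have [g [gC g0 gy]] := cochain_surjective tr y.
  exists (restr g) => [e eE|]; first by rewrite /restr (negbTE eE).
  apply/funext => T; rewrite /d1; case: (boolP (T \in Th)) => TT; last by rewrite yTh.
  rewrite -gy//; apply: eq_bigr => a _; apply: eq_bigr => b _.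
  have [eE|eE] := boolP ([set a; b]%SET \in edges Th).
    by rewrite ext_restr.
  by rewrite g0// /ext /restr (negbTE eE) mulr0.
set K := [set u | _] in dK.
have dV : has_dim [set: V -> R] #|V|.
  have := has_dim_ffun R [set: V]%SET; rewrite cardsT.
  by congr has_dim; apply/seteqP; split => // f _ i; rewrite inE.
have KL (r : R) h h' : K h -> K h' -> K (r *: h + h').
  move=> [cu u0] [cv v0]; split; first exact: cochains_lin.
  by rewrite d1_lin u0 v0 scaler0 addr0.
have K0 : K 0.
  by split => //; have := d1_lin (-1) 0 0; rewrite !scaleN1r !addNr.
have deltaK f : [set: V -> R] f -> K (delta f).
  split; last exact: d1_delta.
  by move=> e eE; rewrite /delta /restr (negbTE eE).
have [r0 [r0V _ dk surj0]] := rank_nullity (fun _ _ _ _ _ => I) (I : [set: V -> R] 0)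
  (fun r f f' _ _ => delta_lin r f f') deltaK KL
  K0 dV dK.
have r0E : r0 = (#|edges Th| - r1)%N.
  apply/surj0/seteqP; split => [_ [f _ <-]|h [hE h0]]; first exact: deltaK.
  have [T a b c TT E o|f fE] := cocycle_exact tr reg (extC h).
    have := congr1 (fun h => h T) h0; rewrite /d1 TT.
    rewrite (sum_bd_cochain tr TT (extC _) E o) => /eqP.
    by rewrite mulrn_eq0 /= => /eqP.
  exists f => //; apply/funext => e; have [eE|eE] := boolP (e \in edges Th); last first.
    by rewrite /delta /restr (negbTE eE) hE.
  have [a [b [_ [E ab _ _ _]]]] := edgeP _ _ eE; rewrite E in eE *.
  rewrite /delta restrE//; last by move=> ? ?; rewrite opprB.
  by rewrite -fE// /ext mulrA sgn_sqr// mul1r.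
have [v0 _] : exists v : V, true.
  have [y yb _] := region_boundary_two reg 0.
  have [e eb _] := boundary_cover tr reg yb.
  by have [a [_ _]] := edgeP _ _ (boundary_edge_edge eb); exists a.
have d1' : has_dim [set u | [set: V -> R] u /\ delta u = 0] 1.
  exists (fun=> fun=> 1); split => [i|c c0 i|u [_ u0]].
  - split => //; apply/funext => e; rewrite /delta /restr; case: ifP => // _.
    by rewrite big1 ?mul0r// => a _; rewrite big1// => b _; rewrite subrr mulr0.
  - have := congr1 (fun f => f v0) c0; rewrite big_ord1 (ord1 i).
    by rewrite scalrfctE /= scaleRE mulr1.
  - exists (fun=> u v0); rewrite big_ord1; apply/funext => v.
    by rewrite scalrfctE /= scaleRE mulr1 (kernel_delta u0 v v0).
have := has_dim_uniq dk d1'; rewrite r0E r1t in r0V *.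
by rewrite r1t in r1E; move: r0V r1E; lia.
Qed.

Lemma card_edges :
  #|edges Th| = (#|interior_edges p Th Omega| + #|boundary_edges Th|)%N.
Proof.
rewrite -(cardsID (interior_edges p Th Omega) (edges Th)); congr (_ + _)%N.
  apply: eq_card => e; rewrite finset.in_setI; apply: andb_idl.
  by rewrite inE => /andP[].
by apply: eq_card => e; rewrite finset.in_setD (boundary_edgeP tr reg) andbC.
Qed.

(** Incident pairs of a triangle and an edge, counted both ways. *)
Lemma card_triangle_edges :
  (3 * #|Th| = 2 * #|interior_edges p Th Omega| + #|boundary_edges Th|)%N.
Proof.
have -> : (3 * #|Th| = \sum_(T in Th) \sum_(e in edges Th) (e \subset T))%N.
  rewrite mulnC -sum_nat_const; apply: eq_bigr => T TT.
  have <- : #|[set e : {set V} | e \subset T & #|e| == 2%N]%SET| = 3%N.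
    by rewrite cards_draws (triangle_card tr TT).
  rewrite -sum1_card big_mkcond [RHS]big_mkcond; apply: eq_bigr => e _ /=.
  rewrite !inE; case: (boolP (e \subset T)) => eT /=; last by case: ifP.
  case: (#|e| == 2%N) => //=.
  by have -> : [exists T in Th, e \subset T] by apply/exists_inP; exists T.
rewrite exchange_big (bigID (mem (interior_edges p Th Omega))) /=; congr (_ + _)%N.
  transitivity (\sum_(e in interior_edges p Th Omega) 2)%N; last first.
    by rewrite sum_nat_const mulnC.
  apply: eq_big => e; first by rewrite [_ \in interior_edges _ _ _]inE andbA andbb.
  move=> /andP[eE]; rewrite (interior_edgeP tr reg)// => /eqP h.
  transitivity #|star Th e|; last exact: h.
  rewrite -sum1_card [RHS]big_mkcond [LHS]big_mkcond; apply: eq_bigr => T _ /=.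
  by rewrite [_ \in star _ _]inE; case: (T \in Th); case: (e \subset T).
rewrite -sum1_card; apply: eq_big => e; first by rewrite (boundary_edgeP tr reg).
move=> h; have : e \in boundary_edges Th by rewrite (boundary_edgeP tr reg).
rewrite inE => /andP[_ /eqP h1].
transitivity #|star Th e|; last exact: h1.
rewrite -sum1_card [RHS]big_mkcond [LHS]big_mkcond; apply: eq_bigr => T _ /=.
by rewrite [_ \in star _ _]inE; case: (T \in Th); case: (e \subset T).
Qed.

(** Each boundary vertex lies on two boundary edges and each boundary edge has two ends, so the
    boundary has as many vertices as edges. *)
Lemma card_boundary :
  (#|V| = #|interior_vertices p Omega| + #|boundary_edges Th|)%N.
Proof.
rewrite -(cardsC (interior_vertices p Omega)); congr (_ + _)%N.
apply/eqP; rewrite -(eqn_pmul2r (isT : 0 < 2)%N); apply/eqP.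
rewrite -!sum_nat_const.
transitivity (\sum_(v in ~: interior_vertices p Omega)
    \sum_(e in boundary_edges Th) (v \in e))%N.
  apply: eq_bigr => v; rewrite !inE => /asboolPn/(boundary_vertexP tr reg) bv.
  have [b1 [b2 [b12 NE]]] := boundary_neighbours2 tr reg bv.
  transitivity #|boundary_neighbours Th v|; first by rewrite NE cards2 b12.
  rewrite -(card_in_imset (f := fun b => [set v; b]%SET)); last first.
    move=> b b'; rewrite !in_boundary_neighbours => eb eb' E.
    have : b \in [set v; b']%SET by rewrite -E !inE eqxx orbT.
    have vb := edge_neq (boundary_edge_edge eb).
    by rewrite !inE eq_sym (negbTE vb) => /eqP.
  rewrite -sum1_card big_mkcond [RHS]big_mkcond; apply: eq_bigr => e _ /=.
  case: (boolP (e \in boundary_edges Th)) => eb /=; last first.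
    case: ifP => // /imsetP[b]; rewrite in_boundary_neighbours => eb' E.
    by rewrite E eb' in eb.
  case: (boolP (v \in e)) => ve; last first.
    by case: ifP => // /imsetP[b _ E]; rewrite E !inE eqxx in ve.
  have -> // : e \in [set [set v; b]%SET | b in boundary_neighbours Th v]%SET.
  have [a [b [_ [E _ _ _ _]]]] := edgeP _ _ (boundary_edge_edge eb).
  apply/imsetP; move: ve; rewrite E !inE => /orP[]/eqP vE.
    by exists b; rewrite vE// in_boundary_neighbours -E.
  exists a; last by rewrite vE finset.setUC.
  by rewrite in_boundary_neighbours vE finset.setUC -E.
rewrite exchange_big /=; apply: eq_bigr => e eb.
transitivity #|e|; last exact: edge_card (boundary_edge_edge eb).
rewrite -sum1_card big_mkcond [RHS]big_mkcond.
apply: eq_bigr => v _; rewrite finset.in_setC.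
case: (boolP (v \in e)) => ve; last by case: ifP.
have bv := boundary_edge_vertex tr reg eb ve.
by rewrite inE asboolF //; exact: (region_boundary_notin reg bv).
Qed.

End Euler.

(** * Polynomial functions on the plane *)

Lemma continuousX (R : realType) (T : topologicalType) (g : T -> R) n :
  continuous g -> continuous (fun x => g x ^+ n).
Proof.
move=> gc; elim: n => [|n IH] x; first exact: cvg_cst.
rewrite (_ : (fun x => _) = fun x => g x * g x ^+ n); last first.
  by apply/funext => y; rewrite exprS.
by apply: cvgM; [exact: gc|exact: IH].
Qed.

Section Polynomials.
Variable R : realType.
Implicit Types (a b d x y : R * R) (f g : R * R -> R) (m n i j : nat) (r : R).

Definition polyfun m f := polynomial_on m [set: R * R] f.

Definition monomial r i j : R * R -> R := fun x => r * x.1 ^+ i * x.2 ^+ j.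

Lemma polyfun_ind m (Q : (R * R -> R) -> Prop) :
  Q 0 -> (forall f g, Q f -> Q g -> Q (f + g)) ->
  (forall r i j, (i + j <= m)%N -> Q (monomial r i j)) ->
  forall f, polyfun m f -> Q f.
Proof.
move=> Q0 QD Qm f [c fE].
have -> : f = \sum_(i < m.+1) \sum_(j < m.+1 | (i + j <= m)%N) monomial (c i j) i j.
  apply/funext => x; rewrite fE// fct_sumE; apply: eq_bigr => i _.
  by rewrite fct_sumE.
elim/big_ind : _ => // i _; elim/big_ind : _ => // j ij; exact: Qm.
Qed.

Lemma polyfun_monomial m r i j : (i + j <= m)%N -> polyfun m (monomial r i j).
Proof.
move=> ij; exists (fun i' j' => if (i' == i) && (j' == j) then r else 0) => x _.
have im : (i < m.+1)%N by rewrite ltnS (leq_trans _ ij)// leq_addr.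
have jm : (j < m.+1)%N by rewrite ltnS (leq_trans _ ij)// leq_addl.
rewrite (bigD1 (Ordinal im))//= (bigD1 (Ordinal jm))//= !eqxx.
rewrite big1 => [|j' /andP[_]]; last first.
  by rewrite -val_eqE /= => /negbTE ->; rewrite !mul0r.
rewrite big1 ?addr0// => i' ; rewrite -val_eqE /= => /negbTE ->.
by rewrite big1// => j' _; rewrite !mul0r.
Qed.

Lemma polyfun_lin m r f g : polyfun m f -> polyfun m g -> polyfun m (r *: f + g).
Proof.
move=> [c fE] [c' gE]; exists (fun i j => r * c i j + c' i j) => x _.
rewrite linear_fctE fE// gE// mulr_sumr -big_split /=; apply: eq_bigr => i _.
rewrite mulr_sumr -big_split /=; apply: eq_bigr => j _; ring.
Qed.

Lemma polyfun0 m : polyfun m 0.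
Proof.
by exists (fun _ _ => 0) => x _; rewrite big1// => i _; rewrite big1// => j _;
  rewrite !mul0r.
Qed.

Lemma polyfunD m f g : polyfun m f -> polyfun m g -> polyfun m (f + g).
Proof. by move=> hf hg; rewrite -[f]scale1r; exact: polyfun_lin. Qed.

Lemma polyfunZ m r f : polyfun m f -> polyfun m (r *: f).
Proof. by move=> hf; rewrite -[_ *: _]addr0; apply: polyfun_lin => //; exact: polyfun0. Qed.

Lemma polyfunB m f g : polyfun m f -> polyfun m g -> polyfun m (f - g).
Proof. by move=> hf hg; rewrite addrC -scaleN1r; exact: polyfun_lin. Qed.

Lemma polyfun_sum m (I : Type) (s : seq I) (P : pred I) (F : I -> R * R -> R) :
  (forall k : I, P k -> polyfun m (F k)) -> polyfun m (\sum_(k <- s | P k) F k).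
Proof.
by move=> h; elim/big_ind : _ => //; [exact: polyfun0|exact: polyfunD].
Qed.

Lemma polyfunM m n f g : polyfun m f -> polyfun n g -> polyfun (m + n) (f * g).
Proof.
move=> pf pg; move: f pf; apply: polyfun_ind => [|f f' hf hf'|r i j ij].
- by rewrite mul0r; exact: polyfun0.
- by rewrite mulrDl; exact: polyfunD.
move: g pg; apply: polyfun_ind => [|g g' hg hg'|r' i' j' ij'].
- by rewrite mulr0; exact: polyfun0.
- by rewrite mulrDr; exact: polyfunD.
have -> : monomial r i j * monomial r' i' j' = monomial (r * r') (i + i') (j + j').
  by apply/funext => x; rewrite mulrfctE /monomial !exprD; ring.
by apply: polyfun_monomial; rewrite addnACA leq_add.
Qed.

Lemma polyfun_cst m r : polyfun m (cst r).
Proof.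
have -> : cst r = monomial r 0 0 by apply/funext => x; rewrite /monomial !expr0 !mulr1.
exact: polyfun_monomial.
Qed.

Lemma polyfun_affine m d r : polyfun m.+1 (fun x => dot d x + r).
Proof.
have -> : (fun x => dot d x + r) = monomial d.1 1 0 + (monomial d.2 0 1 + cst r).
  by apply/funext => x; rewrite /monomial /dot !addrfctE /cst !expr0 !expr1 !mulr1 addrA.
by do ?[apply: polyfunD]; do ?[apply: polyfun_monomial]; rewrite ?addn0 ?add0n//;
  exact: polyfun_cst.
Qed.

Lemma polynomial_onP m (A : set (R * R)) (v : R * R -> R) :
  polynomial_on m A v <-> exists2 f, polyfun m f & forall x, A x -> v x = f x.
Proof.
split=> [[c vE]|[f [c fE] vE]]; last by exists c => x Ax; rewrite vE// fE.
by exists (fun x => \sum_(i < m.+1) \sum_(j < m.+1 | (i + j <= m)%N)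
  c i j * x.1 ^+ i * x.2 ^+ j); [exists c|].
Qed.

Lemma is_derive_fst x d : is_derive x d (fun z : R * R => z.1) d.1.
Proof.
have df : differentiable (fst : R * R -> R) x.
  by apply: linear_differentiable => y; exact: cvg_fst.
split; first exact: diff_derivable.
by rewrite deriveE//; have := @diff_lin R (R * R)%type R fst x; move=> -> // y; exact: cvg_fst.
Qed.

Lemma is_derive_snd x d : is_derive x d (fun z : R * R => z.2) d.2.
Proof.
have df : differentiable (snd : R * R -> R) x.
  by apply: linear_differentiable => y; exact: cvg_snd.
split; first exact: diff_derivable.
by rewrite deriveE//; have := @diff_lin R (R * R)%type R snd x; move=> -> // y; exact: cvg_snd.
Qed.

(** Derivatives in every direction, not only along the axes, since functions are restricted to mesh
    edges later. *)
Definition gradient f f1 f2 :=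
  forall x d, is_derive x d f (d.1 * f1 x + d.2 * f2 x).

Lemma gradientD f f1 f2 g g1 g2 : gradient f f1 f2 -> gradient g g1 g2 ->
  gradient (f + g) (f1 + g1) (f2 + g2).
Proof.
move=> hf hg x d; apply: is_derive_eq (is_deriveD (hf x d) (hg x d)) _.
by rewrite !addrfctE; ring.
Qed.

Lemma gradientZ r f f1 f2 : gradient f f1 f2 -> gradient (r *: f) (r *: f1) (r *: f2).
Proof.
move=> hf x d; apply: is_derive_eq (is_deriveZ r (hf x d)) _.
by rewrite !scalrfctE !scaleRE; ring.
Qed.

Lemma gradient0 : gradient 0 0 0.
Proof.
move=> x d; apply: is_derive_eq (is_derive_cst (0 : R) x d) _.
by rewrite !mulr0 addr0.
Qed.

Lemma gradientB f f1 f2 g g1 g2 : gradient f f1 f2 -> gradient g g1 g2 ->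
  gradient (f - g) (f1 - g1) (f2 - g2).
Proof.
move=> hf hg; rewrite -!(scaleN1r g) -(scaleN1r g1) -(scaleN1r g2).
by apply: gradientD => //; exact: gradientZ.
Qed.

(** At exponent 0 the truncated predecessor is harmless, because the coefficient vanishes. *)
Lemma gradient_monomial r i j :
  gradient (monomial r i j) (monomial (r * i%:R) i.-1 j) (monomial (r * j%:R) i j.-1).
Proof.
move=> x d.
have hi := is_deriveX i (is_derive_fst x d); have hj := is_deriveX j (is_derive_snd x d).
have := is_deriveM (is_deriveM (is_derive_cst r x d) hi) hj.
set F := (X in is_derive x d X _).
have -> : F = monomial r i j.
  by apply/funext => z; rewrite /F /monomial !mulrfctE !exprfctE.
move=> h; apply: is_derive_eq h _.
have E1 : (cst r * (fst : R * R -> R) ^+ i) x = r * x.1 ^+ i.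
  by rewrite mulrfctE exprfctE.
have E2 : ((fst : R * R -> R) ^+ i) x = x.1 ^+ i by rewrite exprfctE.
have E3 : ((snd : R * R -> R) ^+ j) x = x.2 ^+ j by rewrite exprfctE.
rewrite [X in X *: _ + _](E1) [X in _ + X *: _](E3) [X in _ + _ *: (_ + X *: _)](E2).
rewrite /monomial !scaleRE /cst; move: (x.1 ^+ i) (x.1 ^+ i.-1) (x.2 ^+ j) (x.2 ^+ j.-1).
by move: (i%:R : R) (j%:R : R) => *; ring.
Qed.

Lemma gradient_uniq f f1 f2 g1 g2 : gradient f f1 f2 -> gradient f g1 g2 ->
  f1 = g1 /\ f2 = g2.
Proof.
move=> h h'; split; apply/funext => x.
  have := @derive_val _ _ _ _ _ _ _ (h x (1, 0)).
  rewrite (@derive_val _ _ _ _ _ _ _ (h' x (1, 0))) /=.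
  by rewrite !mul1r !mul0r !addr0.
have := @derive_val _ _ _ _ _ _ _ (h x (0, 1)).
rewrite (@derive_val _ _ _ _ _ _ _ (h' x (0, 1))) /=.
by rewrite !mul1r !mul0r !add0r.
Qed.

Lemma polyfun_gradient m f : polyfun m f ->
  exists f1 f2, [/\ polyfun m.-1 f1, polyfun m.-1 f2 & gradient f f1 f2].
Proof.
move: f; apply: polyfun_ind => [|f g [f1 [f2 [pf1 pf2 hf]]] [g1 [g2 [pg1 pg2 hg]]]|].
- by exists 0, 0; split; [exact: polyfun0|exact: polyfun0|exact: gradient0].
- exists (f1 + g1), (f2 + g2).
  by split; [exact: polyfunD|exact: polyfunD|exact: gradientD].
move=> r i j ij; exists (monomial (r * i%:R) i.-1 j), (monomial (r * j%:R) i j.-1).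
have z i' j' : monomial (r * 0%:R) i' j' = 0.
  by apply/funext => x; rewrite /monomial mulr0 !mul0r.
split; last exact: gradient_monomial.
  case: i ij => [|i] ij; first by rewrite z; exact: polyfun0.
  by apply: polyfun_monomial; move: ij => /=; lia.
case: j ij => [|j] ij; first by rewrite z; exact: polyfun0.
by apply: polyfun_monomial; move: ij => /=; lia.
Qed.

Lemma polyfun_continuous m f : polyfun m f -> continuous f.
Proof.
move: f; apply: polyfun_ind => [|f g hf hg|r i j _].
- exact: cst_continuous.
- by move=> x; apply: cvgD; [exact: hf|exact: hg].
- move=> x; rewrite /monomial; apply: cvgM; last first.
    by apply: (@continuousX _ _ (fun z : R * R => z.2)) => z; exact: cvg_snd.
  apply: cvgM; first exact: cvg_cst.
  by apply: (@continuousX _ _ (fun z : R * R => z.1)) => z; exact: cvg_fst.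
Qed.

Lemma polyfun_line m f a d : polyfun m f ->
  exists q : {poly R}, forall t : R, f (a + t *: d) = q.[t].
Proof.
move: f; apply: polyfun_ind => [|f g [q qE] [q' qE']|r i j _].
- by exists 0 => t; rewrite horner0.
- by exists (q + q') => t; rewrite hornerD -qE -qE'.
- exists (r%:P * (a.1%:P + d.1 *: 'X) ^+ i * (a.2%:P + d.2 *: 'X) ^+ j) => t.
  by rewrite /monomial !hornerE /= !scaleRE ![t * _]mulrC.
Qed.

Lemma poly_near0 (q : {poly R}) : (\forall t \near (0 : R)^'+, q.[t] = 0) -> q = 0.
Proof.
move=> h; have {h} [e e0 h] : exists2 e : R, 0 < e & forall t, 0 < t -> t < e -> q.[t] = 0.
  move: h; rewrite near_withinE => /nbhs_ballP[e /= e0 h]; exists e => // t t0 te.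
  by apply: h => //; rewrite /ball /= sub0r normrN gtr0_norm.
apply/eqP; apply: contraT => q0.
(* [size q] distinct points, more than a nonzero [q] has roots; the shift to [i.+2] keeps them
   strictly below [e]. *)
pose s := mkseq (fun i => e / i.+2%:R) (size q).
have : all (root q) s.
  apply/allP => _ /mapP[i _ ->]; apply/rootP; apply: h.
    by rewrite divr_gt0.
  by rewrite ltr_pdivrMr// ltr_pMr// ltr1n.
have us : uniq s.
  rewrite map_inj_uniq ?iota_uniq// => i i' /(mulfI (lt0r_neq0 e0))/invr_inj/eqP.
  by rewrite eqr_nat eqSS eqSS => /eqP.
by move=> /(max_poly_roots q0)/(_ us); rewrite size_mkseq ltnn.
Qed.

End Polynomials.

Section PolynomialCalculus.
Variable R : realType.
Implicit Types (a b d x y : R * R) (f g : R * R -> R) (m n i j : nat) (r t : R).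

Lemma polyfun_near0 m f x : polyfun m f -> (\forall y \near x, f y = 0) ->
  forall y, f y = 0.
Proof.
move=> pf fx y; have [q qE] := polyfun_line x (y - x) pf.
have q0 : q = 0.
  by apply: poly_near0; apply: filterS (near_ray (y - x) fx) => t; rewrite qE.
by have := qE 1; rewrite q0 horner0 scale1r addrC subrK.
Qed.

Lemma polyfun_segment0 m f a d : polyfun m f ->
  (forall t, 0 < t -> t < 1 -> f (a + t *: d) = 0) -> forall t, f (a + t *: d) = 0.
Proof.
move=> pf f0 t; have [q qE] := polyfun_line a d pf.
have -> : f (a + t *: d) = q.[t] by [].
suff -> : q = 0 by rewrite horner0.
apply: poly_near0; have h0 : \forall d \near (0 : R)^'+, 0 < d by exact: nbhs_right_gt.
have h1 : \forall d \near (0 : R)^'+, d < 1 by exact: nbhs_right_lt.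
by apply: filterS2 h0 h1 => s s0 s1; rewrite -qE f0.
Qed.

Lemma is_derive_line f a d t l : is_derive (a + t *: d) d f l ->
  is_derive t 1 (fun s => f (a + s *: d)) l.
Proof.
have E : (fun h : R => h^-1 *: ((f \o shift (a + t *: d)) (h *: d) - f (a + t *: d)))
    = (fun h : R => h^-1 *: (((fun s => f (a + s *: d)) \o shift t) (h *: 1) -
        f (a + t *: d))).
  apply/funext => h; congr (_ *: (f _ - _)); rewrite /= /GRing.scale /= mulr1.
  by apply: pair_ext; rewrite /= !scaleRE; ring.
by move=> [dv dE]; split; [rewrite /derivable -E|rewrite /derive -E].
Qed.

Lemma gradient_line_const f f1 f2 a d : gradient f f1 f2 ->
  (forall t, d.1 * f1 (a + t *: d) + d.2 * f2 (a + t *: d) = 0) -> f (a + d) = f a.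
Proof.
move=> gf f0; pose F s := f (a + s *: d).
have dF t : is_derive t 1 F 0.
  by have := is_derive_line (gf (a + t *: d) d); rewrite f0.
have cF : continuous F.
  by move=> t; apply/differentiable_continuous/derivable1_diffP; case: (dF t).
have [c _] := @MVT_segment R F (fun=> 0) 0 1 ler01 (fun t _ => dF t)
  (continuous_subspaceT cF).
by rewrite mul0r => /eqP; rewrite subr_eq0 /F scale1r scale0r addr0 => /eqP.
Qed.

Lemma gradient0_const f : gradient f 0 0 -> forall x y, f x = f y.
Proof.
move=> gf x y; rewrite -[x](subrK y) addrC.
by apply: gradient_line_const gf _ => t; rewrite !mulr0 addr0.
Qed.

(** [F] is a primitive of [f] in the second variable. Sharing [f1] between the last two gradients
    records that the mixed derivatives of [F] coincide, which is visible on monomials. *)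
Lemma polyfun_antiderivative m f : polyfun m f ->
  exists F F1 f1 f2 h, [/\ polyfun m.+1 F, polyfun m F1, gradient F F1 f,
    gradient f f1 f2 & gradient F1 h f1].
Proof.
move: f; apply: polyfun_ind =>
    [|f g [F [F1 [f1 [f2 [h [a1 a2 a3 a4 a5]]]]]] [G [G1 [g1 [g2 [h' [b1 b2 b3 b4 b5]]]]]]|].
- by exists 0, 0, 0, 0, 0; split; try exact: polyfun0; exact: gradient0.
- exists (F + G), (F1 + G1), (f1 + g1), (f2 + g2), (h + h').
  by split; try exact: polyfunD; exact: gradientD.
move=> r i j ij.
exists (monomial (r / j.+1%:R) i j.+1), (monomial (r / j.+1%:R * i%:R) i.-1 j.+1).
exists (monomial (r * i%:R) i.-1 j), (monomial (r * j%:R) i j.-1).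
exists (monomial (r / j.+1%:R * i%:R * i.-1%:R) i.-1.-1 j.+1).
have j0 : j.+1%:R != 0 :> R by rewrite pnatr_eq0.
split; last 3 first.
- have := @gradient_monomial R (r / j.+1%:R) i j.+1; congr gradient.
  by rewrite divfK.
- exact: gradient_monomial.
- have := @gradient_monomial R (r / j.+1%:R * i%:R) i.-1 j.+1; congr gradient.
  by rewrite mulrAC divfK.
- by apply: polyfun_monomial; rewrite addnS ltnS.
- case: i ij => [|i] ij.
    rewrite mulr0 (_ : monomial 0 _ _ = 0); first exact: polyfun0.
    by apply/funext => x; rewrite /monomial !mul0r.
  by apply: polyfun_monomial; rewrite /=; lia.
Qed.

(** With [F] a primitive of [f] in the second variable, the divergence condition makes [e = g + F1]
    independent of that variable; subtracting from [F] a primitive of [e] in the first variable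
    gives [h]. *)
Lemma polyfun_stream m f g f1 f2 g1 g2 : polyfun m f -> polyfun m g ->
  gradient f f1 f2 -> gradient g g1 g2 -> f1 + g2 = 0 ->
  exists2 h, polyfun m.+1 h & gradient h (- g) f.
Proof.
move=> pf pg gf gg fg0.
have [F [F1 [f1' [f2' [k [pF pF1 gF gf' gF1]]]]]] := polyfun_antiderivative pf.
have [f1E _] := gradient_uniq gf gf'; rewrite -{}f1E in gF1.
pose e := g + F1; have ge : gradient e (g1 + k) 0.
  by have := gradientD gg gF1; rewrite [g2 + f1]addrC fg0.
have pe : polyfun m e by exact: polyfunD.
have eE x : e x = e (x.1, 0).
  have -> : x = (x.1, 0) + (0, x.2) by apply: pair_ext; rewrite /= ?addr0 ?add0r.
  rewrite /= addr0; apply: gradient_line_const ge _ => t.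
  by rewrite /= mul0r mulr0 addr0.
have [G pG gG] : exists2 G, polyfun m.+1 G & gradient G (fun x => e (x.1, 0)) 0.
  move: (e) pe; apply: polyfun_ind => [|e1 e2 [G1 p1 q1] [G2 p2 q2]|r i j ij].
  - by exists 0; [exact: polyfun0|exact: gradient0].
  - exists (G1 + G2); first exact: polyfunD.
    by have := gradientD q1 q2; rewrite addr0.
  (* On the axis where [x.2] is 0 only the monomials with [j = 0] survive. *)
  exists (monomial (if j == 0%N then r / i.+1%:R else 0) i.+1 0).
    by apply: polyfun_monomial; rewrite addn0 ltnS (leq_trans _ ij)// leq_addr.
  have i0 : i.+1%:R != 0 :> R by rewrite pnatr_eq0.
  have := @gradient_monomial R (if j == 0%N then r / i.+1%:R else 0) i.+1 0.
  congr gradient; apply/funext => x; rewrite /monomial /= ?mulr0 ?mul0r//.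
  by case: j ij => [|j] _ /=; rewrite ?expr0 ?mulr1 ?divfK// exprS !mul0r mulr0.
exists (F - G); first exact: polyfunB.
have := gradientB gF gG; rewrite subr0; congr gradient.
by apply/funext => x; rewrite !addrfctE !opprfctE -eE /e addrfctE; ring.
Qed.

End PolynomialCalculus.

(** * Piecewise polynomials and stream functions *)

Section Hessian.
Variable R : realType.
Implicit Types f : R * R -> R.

(** The common [f12] expresses the symmetry of second derivatives, by which a rotated gradient has
    zero divergence. *)
Lemma polyfun_hessian m f : polyfun m f ->
  exists f1 f2 f11 f12 f22,
    [/\ polyfun m.-1 f1, polyfun m.-1 f2, gradient f f1 f2, gradient f1 f11 f12 &
        gradient f2 f12 f22].
Proof.
move: f; apply: polyfun_ind =>
  [|f g [f1 [f2 [f11 [f12 [f22 [a1 a2 a3 a4 a5]]]]]]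
    [g1 [g2 [g11 [g12 [g22 [b1 b2 b3 b4 b5]]]]]]|].
- by exists 0, 0, 0, 0, 0; split; try exact: polyfun0; exact: gradient0.
- exists (f1 + g1), (f2 + g2), (f11 + g11), (f12 + g12), (f22 + g22).
  by split; try exact: polyfunD; exact: gradientD.
move=> r i j ij; exists (monomial (r * i%:R) i.-1 j), (monomial (r * j%:R) i j.-1).
exists (monomial (r * i%:R * i.-1%:R) i.-1.-1 j).
exists (monomial (r * i%:R * j%:R) i.-1 j.-1).
exists (monomial (r * j%:R * j.-1%:R) i j.-1.-1).
have z i' j' : monomial (r * 0%:R) i' j' = 0.
  by apply/funext => x; rewrite /monomial mulr0 !mul0r.
split; try exact: gradient_monomial.
- case: i ij => [|i] ij; first by rewrite z; exact: polyfun0.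
  by apply: polyfun_monomial; move: ij => /=; lia.
- case: j ij => [|j] ij; first by rewrite z; exact: polyfun0.
  by apply: polyfun_monomial; move: ij => /=; lia.
- by rewrite mulrAC; exact: gradient_monomial.
Qed.

(** On an edge or at a vertex no single piece describes [u] near [x]. The piece may change from
    point to point, but finitely many difference quotients with one common limit are close to it
    simultaneously. *)
Lemma piecewise_is_derive (I : finType) (Q : pred I) (H : I -> R * R -> R)
    (u : R * R -> R) x d l :
  (\forall y \near x, exists2 i, Q i & u y = H i y) ->
  (forall i, Q i -> u x = H i x /\ is_derive x d (H i) l) -> is_derive x d u l.
Proof.
move=> near_u HQ.
suff cv : h^-1 *: ((u \o shift x) (h *: d) - u x) @[h --> (0 : R)^'] --> l.
  by split; [apply/cvg_ex; exists l|exact: cvg_lim cv].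
move=> W Wl.
have HW : \forall h \near (0 : R)^', forall i, Q i ->
    W (h^-1 *: ((H i \o shift x) (h *: d) - H i x)).
  apply: (@filter_forall _ I (fun i h => Q i ->
    W (h^-1 *: ((H i \o shift x) (h *: d) - H i x))) ((0 : R)^') _) => i.
  have [Qi|] := boolP (Q i); last by move=> _; exact: nearW.
  have [_ [dv dE]] := HQ i Qi.
  have : h^-1 *: ((H i \o shift x) (h *: d) - H i x) @[h --> (0 : R)^'] --> l.
    by rewrite -dE; exact: dv.
  move=> cH; have hW : \forall h \near (0 : R)^',
      W (h^-1 *: ((H i \o shift x) (h *: d) - H i x)) by exact: cH W Wl.
  by apply: filterS hW.
have near_h : \forall h \near (0 : R)^', exists2 i, Q i & u (h *: d + x) = H i (h *: d + x).
  have : (fun h : R => h *: d + x) @ (0 : R)^' --> x.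
    rewrite -[X in _ --> X]add0r -[in X in _ --> X](scale0r d).
    apply: cvgD; last exact: cvg_cst.
    by apply: cvgZr_tmp; apply: cvg_within_filter; exact: cvg_id.
  by move=> /(_ _ near_u).
change (\forall h \near (0 : R)^', W (h^-1 *: ((u \o shift x) (h *: d) - u x))).
apply: filterS2 HW near_h => h Wh [i Qi uE].
by have := Wh i Qi; rewrite /= -uE -(HQ i Qi).1.
Qed.

End Hessian.

Section Piecewise.
Variables (R : realType) (V : finType) (p : V -> R * R) (Th : {set {set V}}).
Variable Omega : set (R * R).
Hypothesis tr : triangulation p Th Omega.
Hypothesis reg : polygonal_region_no_holes Omega.
Implicit Types (T : {set V}) (x y d : R * R) (a b c v w : V) (H : {set V} -> R * R -> R).
Implicit Types (u : R * R -> R).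

Definition agreeing H := forall T T' x, T \in Th -> T' \in Th ->
  simplex p T x -> simplex p T' x -> H T x = H T' x.

Definition glue H x : R :=
  if [pick T in Th | `[< simplex p T x >]] is Some T then H T x else 0.

Lemma glueE H T x : agreeing H -> T \in Th -> simplex p T x -> glue H x = H T x.
Proof.
move=> aH TT sT; rewrite /glue; case: pickP => [T' /andP[TT' /asboolP sT']|/(_ T)].
  exact: aH.
by rewrite TT => /asboolP.
Qed.

Lemma glue_on H : function_on (closure Omega) (glue H).
Proof.
move=> x nx; rewrite /glue; case: pickP => // T /andP[TT /asboolP sT].
by case: nx; apply/(closure_mesh tr); exists T.
Qed.

Lemma pieces m u (A : {set V} -> set (R * R)) :
  (forall T, T \in Th -> polynomial_on m (A T) u) ->
  exists H, forall T, T \in Th -> polyfun m (H T) /\ forall x, A T x -> u x = H T x.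
Proof.
move=> up; have hP T : exists f, T \in Th -> polyfun m f /\ forall x, A T x -> u x = f x.
  have [TT|nT] := boolP (T \in Th); last by exists 0.
  by have /polynomial_onP[f pf uf] := up _ TT; exists f.
by have [H HP] := choice hP; exists H.
Qed.

(** Continuity is automatic: finitely many closed triangles cover the closure, and [u] is one
    function that is polynomial on each of them. *)
Lemma VhP m u : Vh p Th Omega m u <->
  function_on (closure Omega) u /\ forall T, T \in Th -> polynomial_on m (simplex p T) u.
Proof.
split=> [[]//|[uo up]]; split => //; apply/subspace_continuousP => x cx W Wx.
have [H HP] := pieces up.
have HW : \forall y \near x, forall T, T \in Th -> simplex p T x -> W (H T y).
  apply: (@filter_forall _ _ (fun T y => T \in Th -> simplex p T x -> W (H T y))
    (nbhs x) _) => T.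
  have [TT|] := boolP (T \in Th); last by move=> _; exact: nearW.
  have [sT|] := pselect (simplex p T x); last by move=> ?; exact: nearW.
  have [pf uf] := HP T TT.
  have cW : \forall y \near x, W (H T y).
    by apply: (polyfun_continuous pf); rewrite -uf.
  by apply: filterS cW.
change (\forall y \near within (closure Omega) (nbhs x), W (u y)).
rewrite near_withinE; apply: filterS2 HW (near_mesh tr x) => y hW hm.
move=> /(closure_mesh tr)[T TT sT]; have := hW T TT (hm T TT sT).
by rewrite (HP T TT).2.
Qed.

Lemma glue_polynomial m H T : agreeing H -> polyfun m (H T) -> T \in Th ->
  polynomial_on m (simplex p T) (glue H).
Proof.
move=> aH pH TT; apply/polynomial_onP; exists (H T) => // x; exact: glueE.
Qed.

Lemma glue_Vh m H : agreeing H -> (forall T, T \in Th -> polyfun m (H T)) ->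
  Vh p Th Omega m (glue H).
Proof.
move=> aH pH; apply/VhP; split; first exact: glue_on.
by move=> T TT; apply: glue_polynomial => //; exact: pH.
Qed.

Lemma polyfun_triangle0 m T (f : R * R -> R) : T \in Th -> polyfun m f ->
  (forall x, (simplex p T)° x -> f x = 0) -> f = 0.
Proof.
move=> TT pf f0; have [x xi] := triangle_interior tr TT.
apply/funext; apply: (polyfun_near0 pf (x := x)).
have : nbhs x (simplex p T)° by apply: open_nbhs_nbhs; split => //; exact: open_interior.
by apply: filterS.
Qed.

Lemma triangle_derive T u f f1 f2 x d : (forall x, simplex p T x -> u x = f x) ->
  gradient f f1 f2 -> (simplex p T)° x -> is_derive x d u (d.1 * f1 x + d.2 * f2 x).
Proof.
move=> uf gf xi; apply: near_eq_is_derive (gf x d).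
have : nbhs x (simplex p T)° by apply: open_nbhs_nbhs; split => //; exact: open_interior.
by apply: filterS => y /interior_subset/uf.
Qed.

Lemma triangle_partial T u f f1 f2 x : (forall x, simplex p T x -> u x = f x) ->
  gradient f f1 f2 -> (simplex p T)° x -> partial1 u x = f1 x /\ partial2 u x = f2 x.
Proof.
move=> uf gf xi; split.
  have /@derive_val := triangle_derive (1, 0) uf gf xi.
  by rewrite /partial1 /= mul1r mul0r addr0.
have /@derive_val := triangle_derive (0, 1) uf gf xi.
by rewrite /partial2 /= mul1r mul0r add0r.
Qed.

Lemma interior_continuous_eq T (F G : R * R -> R) x : T \in Th -> simplex p T x ->
  {for x, continuous F} -> {for x, continuous G} ->
  (forall y, (simplex p T)° y -> F y = G y) -> F x = G x.
Proof.
move=> TT sT cF cG FG; have tT := mesh_triangle tr TT.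
have [g gi] := triangle_interior tr TT.
have ray : (fun s : R => x + s *: (g - x)) @ (0 : R)^'+ --> x.
  rewrite -[X in _ --> X]addr0 -[in X in _ --> X](scale0r (g - x)).
  apply: cvgD; first exact: cvg_cst.
  by apply: cvgZr_tmp; apply: cvg_at_right_filter; exact: cvg_id.
have lim (K : R * R -> R) : {for x, continuous K} -> K (x + s *: (g - x)) @[s --> (0 : R)^'+] --> K x.
  by move=> cK; apply: cvg_comp ray cK.
apply: (@cvg_unique _ _ ((fun s : R => F (x + s *: (g - x))) @ (0 : R)^'+)).
- exact: norm_hausdorff.
- exact: lim.
have h0 : \forall d \near (0 : R)^'+, 0 < d by exact: nbhs_right_gt.
have h1 : \forall d \near (0 : R)^'+, d < 1 by exact: nbhs_right_lt.
change (F (x + s *: (g - x)) @[s --> (0 : R)^'+] --> G x).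
apply: cvg_trans (lim _ cG); apply: near_eq_cvg.
apply: filterS2 h0 h1 => s s0 s1; apply/esym/FG/(open_triangle_bary tT) => v vT.
rewrite bary_ray; have := (open_triangle_bary tT g).1 gi v vT.
have := (triangle_bary tT x).1 sT v; nra.
Qed.

Lemma common_carrier T T' x : T \in Th -> T' \in Th -> T != T' ->
  simplex p T x -> simplex p T' x ->
  (exists v, [/\ v \in T, v \in T' & x = p v]) \/
  (exists a b, [/\ a != b, a \in T, b \in T & a \in T'] /\
     [/\ b \in T', closure Omega x & carrier p Th x = [set a; b]%SET]).
Proof.
move=> TT TT' TT'n sT sT'; have cx : closure Omega x by apply/(closure_mesh tr); exists T.
have cT := carrier_sub tr TT sT; have cT' := carrier_sub tr TT' sT'.
have c0 := carrier_neq0 tr cx.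
have c3 : #|carrier p Th x| != 3.
  apply: contra TT'n => /eqP c3.
  have <- : carrier p Th x = T by apply/eqP; rewrite eqEcard cT (triangle_card tr TT) c3.
  by rewrite eqEcard cT' (triangle_card tr TT') c3.
have : (#|carrier p Th x| == 1) || (#|carrier p Th x| == 2).
  have := subset_leq_card cT; rewrite (triangle_card tr TT).
  by move: c0 c3; rewrite -cards_eq0; case: #|_| => // -[|[|[|[]]]].
move=> /orP[/cards1P[v cv]|/cards2P[a [b [ab ce]]]].
  left; exists v; rewrite (carrier1 tr cx cv).
  by rewrite cv !finset.sub1set in cT cT'.
right; exists a, b; move: cT cT'; rewrite ce !finset.subUset !finset.sub1set.
by move=> /andP[-> ->] /andP[-> ->].
Qed.

Lemma edge_segment a b x : a != b -> closure Omega x ->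
  carrier p Th x = [set a; b]%SET -> exists t, x = p a + t *: (p b - p a).
Proof.
move=> ab cx ce; have [T TT sT] := (closure_mesh tr x).1 cx.
have := carrier_sub tr TT sT; rewrite ce => eT.
have : simplex p [set a; b]%SET x by apply/(simplex_carrier tr _ TT eT); rewrite ce.
move=> /(simplex_pair ab)[t _ <-]; exists t.
by apply: pair_ext; rewrite /= !scaleRE; ring.
Qed.

Lemma edge_points T a b t : T \in Th -> a \in T -> b \in T -> a != b ->
  0 < t -> t < 1 ->
  simplex p T (p a + t *: (p b - p a)) /\
  closure Omega (p a + t *: (p b - p a)) /\
  carrier p Th (p a + t *: (p b - p a)) = [set a; b]%SET.
Proof.
move=> TT aT bT ab t0 t1.
have -> : p a + t *: (p b - p a) = (1 - t) *: p a + t *: p b.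
  by apply: pair_ext; rewrite /= !scaleRE; ring.
have [|cx ce] := edge_midpoint tr TT aT bT ab (t := t); first by rewrite t0 t1.
split => //; apply/(triangle_carrier tr _ TT); split => //.
by rewrite ce finset.subUset !finset.sub1set aT.
Qed.

(* The key point of the inclusion curl Sh <= Vh: the gradients of the         *)
(* polynomial pieces also agree at boundary vertices, where the function is   *)
(* not assumed to be differentiable.                                          *)
Lemma agreeing_of_continuous (F : R * R -> R) H m :
  (forall T, T \in Th -> polyfun m (H T)) ->
  (forall x, Omega x -> {for x, continuous F}) ->
  (forall T x, T \in Th -> (simplex p T)° x -> F x = H T x) -> agreeing H.
Proof.
move=> pH cF FH.
have FHO T x : T \in Th -> simplex p T x -> Omega x -> F x = H T x.
  move=> TT sT ox; apply: (interior_continuous_eq TT sT (cF x ox)).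
    by apply: polyfun_continuous; exact: pH.
  by move=> y; exact: FH.
move=> T T' x TT TT' sT sT'; have [->//|TT'n] := eqVneq T T'.
have cx : closure Omega x by apply/(closure_mesh tr); exists T.
have [ox|bx] := (region_closureP reg x).1 cx; first by rewrite -!FHO.
have [[v [vT vT' xE]]|[a [b [[ab aT bT aT'] [bT' _ ce]]]]] :=
    common_carrier TT TT' TT'n sT sT'; last first.
  have ox := edge_interior tr reg TT TT' TT'n aT bT aT' bT' ab cx ce.
  by rewrite -!FHO.
(* At a boundary vertex [fan_constant] reduces the claim to triangles sharing an edge. The pieces
   agree inside this edge, which lies in [Omega], and polynomials agreeing there agree at its
   end. *)
rewrite xE in bx *; apply: (fan_constant tr reg (G := fun S => H S (p v)) bx) => //.
move=> S S' b SS SS' SnS' bv vS bS vS' bS'.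
have vb : v != b by rewrite eq_sym.
apply/eqP; rewrite -subr_eq0; apply/eqP.
have pD : polyfun m (H S - H S') by apply: polyfunB; exact: pH.
have := polyfun_segment0 (a := p v) (d := p b - p v) pD; move=> h.
have := h _ 0; rewrite scale0r addr0; apply => t t0 t1.
have [s1 [c1 e1]] := edge_points SS vS bS vb t0 t1.
have [s2 _] := edge_points SS' vS' bS' vb t0 t1.
have ox := edge_interior tr reg SS SS' SnS' vS bS vS' bS' vb c1 e1.
by rewrite addrfctE opprfctE /= -(FHO S)// -(FHO S')// subrr.
Qed.

End Piecewise.

(** * The rotated gradient and stream functions *)

Section StreamFunction.
Variables (R : realType) (V : finType) (p : V -> R * R) (Th : {set {set V}}).
Variable Omega : set (R * R).
Hypothesis tr : triangulation p Th Omega.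
Hypothesis reg : polygonal_region_no_holes Omega.
Implicit Types (T : {set V}) (x y d : R * R) (a b c v w : V) (H : {set V} -> R * R -> R).
Implicit Types (u : R * R -> R) (z : (R * R -> R) * (R * R -> R)) (m : nat).

Local Notation Vh2 m := (Vh p Th Omega m `*` Vh p Th Omega m).

Lemma divhE z T f g f1 f2 g1 g2 x : T \in Th ->
  (forall x, simplex p T x -> z.1 x = f x) -> (forall x, simplex p T x -> z.2 x = g x) ->
  gradient f f1 f2 -> gradient g g1 g2 -> (simplex p T)° x ->
  divh p Th z x = f1 x + g2 x.
Proof.
move=> TT zf zg gf gg xi; rewrite /divh patchE ifT; last first.
  by rewrite inE; exists T.
by rewrite (triangle_partial zf gf xi).1 (triangle_partial zg gg xi).2.
Qed.

Lemma divh_out z x : ~ open_triangles p Th x -> divh p Th z x = 0.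
Proof. by move=> nx; rewrite /divh patchE ifF//; apply/negbTE; rewrite notin_setE. Qed.

(** At boundary points the derivatives would be those of the extension by zero; the values in the
    open triangles determine a piecewise polynomial [z] by continuity. *)
Definition is_curl u z := forall T x, T \in Th -> (simplex p T)° x ->
  partial2 u x = z.1 x /\ partial1 u x = - z.2 x.

Lemma curl_exists m u : Sh p Th Omega m.+1 u ->
  exists2 z, (Vh2 m z /\ divh p Th z = 0) & is_curl u z.
Proof.
move=> [uo uC up]; have [H HP] := pieces up.
have hP T : exists g : (R * R -> R) * (R * R -> R) *
    ((R * R -> R) * (R * R -> R) * (R * R -> R)), T \in Th ->
    [/\ polyfun m g.1.1, polyfun m g.1.2, gradient (H T) g.1.1 g.1.2,
        gradient g.1.1 g.2.1.1 g.2.1.2 & gradient g.1.2 g.2.1.2 g.2.2].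
  have [TT|_] := boolP (T \in Th); last by exists (0, 0, (0, 0, 0)).
  have [f1 [f2 [f11 [f12 [f22 h]]]]] := polyfun_hessian (HP T TT).1.
  by exists ((f1, f2), (f11, f12, f22)).
have [g gP] := choice hP => {hP}.
have part T x : T \in Th -> (simplex p T)° x ->
    partial1 u x = (g T).1.1 x /\ partial2 u x = (g T).1.2 x.
  by move=> TT; have [_ _ gr _ _] := gP T TT; apply: triangle_partial gr; exact: (HP T TT).2.
have a1 : agreeing p Th (fun T => (g T).1.1).
  apply: (agreeing_of_continuous tr reg (F := partial1 u) (m := m)).
  - by move=> T /gP[].
  - by move=> x /uC[].
  - by move=> T x TT xi; exact: (part T x TT xi).1.
have a2 : agreeing p Th (fun T => (g T).1.2).
  apply: (agreeing_of_continuous tr reg (F := partial2 u) (m := m)).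
  - by move=> T /gP[].
  - by move=> x /uC[].
  - by move=> T x TT xi; exact: (part T x TT xi).2.
have a1' : agreeing p Th (fun T => - (g T).1.1).
  by move=> T T' x TT TT' sT sT'; rewrite !opprfctE (a1 _ _ _ TT TT' sT sT').
exists (glue p Th (fun T => (g T).1.2), glue p Th (fun T => - (g T).1.1)).
  split; first split.
  - by apply: glue_Vh => // T /gP[].
  - apply: glue_Vh => // T /gP[p1 _ _ _ _].
    by rewrite -scaleN1r; exact: polyfunZ.
  apply/funext => x; have [[T TT xi]|nx] := pselect (open_triangles p Th x); last first.
    exact: divh_out.
  have [_ _ _ gr1 gr2] := gP T TT; have gr1' := gradientZ (-1) gr1.
  rewrite !scaleN1r in gr1'.
  rewrite (divhE TT _ _ gr2 gr1' xi); first by rewrite opprfctE subrr.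
    by move=> y sT /=; exact: glueE.
  by move=> y sT /=; exact: glueE a1' TT sT.
move=> T x TT xi; have sT := interior_subset xi.
have [-> ->] := part T x TT xi.
by rewrite /= (glueE a2 TT sT) (glueE a1' TT sT) opprfctE opprK.
Qed.

(** At a point of [Omega] all pieces through it have the same value and gradient, so
    [piecewise_is_derive] gives the partial derivatives; these are glued functions themselves, hence
    continuous. *)
Lemma Sh_of_pieces m (H F G : {set V} -> R * R -> R) :
  agreeing p Th H -> agreeing p Th F -> agreeing p Th G ->
  (forall T, T \in Th -> [/\ polyfun m.+1 (H T), polyfun m (F T), polyfun m (G T) &
     gradient (H T) (F T) (G T)]) ->
  Sh p Th Omega m.+1 (glue p Th H).
Proof.
move=> aH aF aG HP; split; first exact: glue_on; last first.
  by move=> T TT; apply: glue_polynomial => //; have [] := HP T TT.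
have der x d : Omega x -> is_derive x d (glue p Th H)
    (d.1 * glue p Th F x + d.2 * glue p Th G x).
  move=> ox; have Ox : nbhs x Omega by apply: open_nbhs_nbhs; split => //; exact: region_open reg.
  apply: (piecewise_is_derive (Q := fun T => (T \in Th) && `[< simplex p T x >]) (H := H)).
    apply: filterS2 Ox (near_mesh tr x) => y oy hy.
    have /(closure_mesh tr)[T TT sT] := subset_closure oy.
    exists T; first by rewrite TT; apply/asboolP; exact: hy.
    exact: glueE.
  move=> T /andP[TT /asboolP sT]; split; first exact: glueE.
  by rewrite (glueE aF TT sT) (glueE aG TT sT); have [_ _ _] := HP T TT; apply.
have cont K : agreeing p Th K -> (forall T, T \in Th -> polyfun m (K T)) ->
    forall x, Omega x -> {for x, continuous (glue p Th K)}.
  move=> aK pK x ox; have [_ cK _] := glue_Vh tr aK pK.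
  have /subspace_continuousP/(_ x (subset_closure ox)) := cK.
  rewrite /continuous_at; move=> h; apply: cvg_trans h.
  apply: cvg_app => W h.
  have {}h : \forall y \near x, closure Omega y -> W y by exact: h.
  change (\forall y \near x, W y).
  have Ox : nbhs x Omega by apply: open_nbhs_nbhs; split => //; exact: region_open reg.
  by apply: filterS2 h Ox => y hy oy; apply: hy; exact: subset_closure.
have part1 x : Omega x -> partial1 (glue p Th H) x = glue p Th F x.
  move=> ox; have /@derive_val := der x (1, 0) ox.
  by rewrite /partial1 /= mul1r mul0r addr0.
have part2 x : Omega x -> partial2 (glue p Th H) x = glue p Th G x.
  move=> ox; have /@derive_val := der x (0, 1) ox.
  by rewrite /partial2 /= mul1r mul0r add0r.
have near_cont K K' x : Omega x -> (forall y, Omega y -> K y = K' y) ->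
    {for x, continuous K'} -> {for x, continuous (K : R * R -> R)}.
  move=> ox KK' cK; have {}cK : K' y @[y --> x] --> K' x by exact: cK.
  rewrite -(KK' x ox) in cK; change (K y @[y --> x] --> K x).
  apply: cvg_trans cK; apply: near_eq_cvg.
  have Ox : nbhs x Omega by apply: open_nbhs_nbhs; split => //; exact: region_open reg.
  by apply: filterS Ox => y oy; rewrite KK'.
move=> x ox; split.
- by case: (der x (1, 0) ox).
- by case: (der x (0, 1) ox).
- apply: (near_cont _ _ _ ox part1); apply: cont ox => // T TT.
  by have [] := HP T TT.
- apply: (near_cont _ _ _ ox part2); apply: cont ox => // T TT.
  by have [] := HP T TT.
Qed.

Lemma stream_exists m z : Vh2 m z -> divh p Th z = 0 ->
  exists2 u, Sh p Th Omega m.+1 u & is_curl u z.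
Proof.
move=> [/(VhP tr)[z1o z1p] /(VhP tr)[z2o z2p]] dz.
have [F FP] := pieces z1p; have [G GP] := pieces z2p.
have hP T : exists h, T \in Th -> polyfun m.+1 h /\ gradient h (- G T) (F T).
  have [TT|_] := boolP (T \in Th); last by exists 0.
  have [pF zF] := FP T TT; have [pG zG] := GP T TT.
  have [f1 [f2 [pf1 _ gF]]] := polyfun_gradient pF.
  have [g1 [g2 [_ pg2 gG]]] := polyfun_gradient pG.
  have fg0 : f1 + g2 = 0.
    apply: (polyfun_triangle0 tr TT (polyfunD pf1 pg2)) => x xi.
    by have := divhE TT zF zG gF gG xi; rewrite dz => /esym.
  by have [h ph gh] := polyfun_stream pF pG gF gG fg0; exists h.
have [h hhP] := choice hP => {hP}.
(* Along a common edge two local stream functions differ by a constant: the tangential derivative of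
   the difference is a combination of [F T - F T'] and [G T - G T'], which vanish there because both
   pieces equal [z]. *)
have edge_const T T' a b K t : T \in Th -> T' \in Th -> a \in T -> b \in T ->
    a \in T' -> b \in T' -> a != b ->
    gradient K (- G T - - G T') (F T - F T') -> K (p a + t *: (p b - p a)) = K (p a).
  move=> TT TT' aT bT aT' bT' ab gK; apply: gradient_line_const gK _.
  set D1 := - G T - - G T'; set D2 := F T - F T' => r.
  pose E := (t *: (p b - p a)).1 *: D1 + (t *: (p b - p a)).2 *: D2.
  have pE : polyfun m E.
    have [pF _] := FP T TT; have [pG _] := GP T TT.
    have [pF' _] := FP T' TT'; have [pG' _] := GP T' TT'.
    apply: polyfun_lin; last by apply: polyfunZ; exact: polyfunB.
    by apply: polyfunB; rewrite -scaleN1r; exact: polyfunZ.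
  have : E (p a + (r * t) *: (p b - p a)) = 0.
    apply: (polyfun_segment0 pE) => s s0 s1.
    have [s1' _] := edge_points tr TT aT bT ab s0 s1.
    have [s2' _] := edge_points tr TT' aT' bT' ab s0 s1.
    rewrite /E linear_fctE scalrfctE scaleRE /D1 /D2 !addrfctE !opprfctE.
    rewrite -(FP T TT).2// -(FP T' TT').2// -(GP T TT).2// -(GP T' TT').2//; ring.
  by rewrite /E linear_fctE scalrfctE scaleRE scalerA.
have incr T T' a b : T \in Th -> T' \in Th -> a \in T -> b \in T -> a \in T' ->
    b \in T' -> h T (p b) - h T (p a) = h T' (p b) - h T' (p a).
  move=> TT TT' aT bT aT' bT'; have [->|ab] := eqVneq a b; first by rewrite !subrr.
  have [ph gh] := hhP T TT; have [ph' gh'] := hhP T' TT'.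
  have := edge_const _ _ _ _ _ 1 TT TT' aT bT aT' bT' ab (gradientB gh gh').
  by rewrite scale1r [p a + _]addrC subrK !addrfctE !opprfctE; lra.
(* The increments of the local stream functions along edges form a cochain, whose sum around each
   triangle is zero. *)
pose gam a b := if [pick T in Th | (a \in T) && (b \in T)] is Some T
  then h T (p b) - h T (p a) else 0.
have gamE T a b : T \in Th -> a \in T -> b \in T -> gam a b = h T (p b) - h T (p a).
  move=> TT aT bT; rewrite /gam; case: pickP => [T' /and3P[TT' aT' bT']|/(_ T)].
    exact: incr.
  by rewrite TT aT bT.
have gamC a b : gam b a = - gam a b.
  rewrite {1}/gam; case: pickP => [T /and3P[TT bT aT]|n].
    by rewrite (gamE T)// opprB.
  rewrite /gam; case: pickP => [T /and3P[TT bT aT]|]; last by rewrite oppr0.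
  by have := n T; rewrite TT aT bT.
have [T a b c TT E o|psi psiE] := cocycle_exact tr reg gamC.
  have [aT bT cT] : [/\ a \in T, b \in T & c \in T] by rewrite E !inE !eqxx !orbT.
  by rewrite !(gamE T)//; lra.
have psiT T a b : T \in Th -> a \in T -> b \in T ->
    psi a - h T (p a) = psi b - h T (p b).
  move=> TT aT bT; have [->//|ab] := eqVneq a b.
  have eE : [set a; b]%SET \in edges Th by apply/edgeP; exists a, b, T.
  by have := psiE a b eE; rewrite (gamE T)//; lra.
(* The constant to be added on [T] so that the vertex values become those of the potential [psi]. *)
pose c T := if [pick a in T] is Some a then psi a - h T (p a) else 0.
have cE T a : T \in Th -> a \in T -> c T = psi a - h T (p a).
  move=> TT aT; rewrite /c; case: pickP => [b bT|/(_ a)]; first exact: psiT.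
  by rewrite aT.
pose H T := h T + cst (c T).
have Hv T a : T \in Th -> a \in T -> H T (p a) = psi a.
  by move=> TT aT; rewrite /H addrfctE (cE T a)//= addrC subrK.
have gH T : T \in Th -> gradient (H T) (- G T) (F T).
  move=> TT x d; have [_ gh] := hhP T TT.
  have := is_deriveD (gh x d) (is_derive_cst (c T) x d).
  by move=> hd; apply: is_derive_eq hd _; rewrite addr0.
have aH : agreeing p Th H.
  move=> T T' x TT TT' sT sT'; have [->//|TT'n] := eqVneq T T'.
  have [[v [vT vT' ->]]|[a [b [[ab aT bT aT'] [bT' cx ce]]]]] :=
    common_carrier tr TT TT' TT'n sT sT'; first by rewrite !Hv.
  have [t xE] := edge_segment tr ab cx ce.
  have gD := gradientB (gH T TT) (gH T' TT').
  have := edge_const _ _ _ _ _ t TT TT' aT bT aT' bT' ab gD.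
  rewrite -xE !addrfctE !opprfctE !Hv// subrr => /eqP.
  by rewrite subr_eq0 => /eqP.
have aF : agreeing p Th F.
  by move=> T T' x TT TT' sT sT'; rewrite -(FP T TT).2// -(FP T' TT').2.
have aG : agreeing p Th (fun T => - G T).
  by move=> T T' x TT TT' sT sT'; rewrite !opprfctE -(GP T TT).2// -(GP T' TT').2.
exists (glue p Th H).
  apply: Sh_of_pieces aH aG aF _ => T TT; split.
  - have [ph _] := hhP T TT; apply: polyfunD => //; exact: polyfun_cst.
  - by rewrite -scaleN1r; apply: polyfunZ; exact: (GP T TT).1.
  - exact: (FP T TT).1.
  - exact: gH.
move=> T x TT xi; have sT := interior_subset xi.
have [-> ->] := triangle_partial (fun y => glueE aH TT) (gH T TT) xi.
by rewrite (FP T TT).2// (GP T TT).2// opprfctE.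
Qed.

Lemma Vh_lin m r u u' : Vh p Th Omega m u -> Vh p Th Omega m u' ->
  Vh p Th Omega m (r *: u + u').
Proof.
move=> /(VhP tr)[uo up] /(VhP tr)[uo' up']; apply/(VhP tr); split.
  by move=> x nx; rewrite linear_fctE uo// uo'// mulr0 addr0.
move=> T TT; have [H HP] := pieces up; have [H' HP'] := pieces up'.
apply/polynomial_onP; exists (r *: H T + H' T).
  by apply: polyfun_lin; [exact: (HP T TT).1|exact: (HP' T TT).1].
by move=> x sT; rewrite !linear_fctE (HP T TT).2// (HP' T TT).2.
Qed.

Lemma Vh0 m : Vh p Th Omega m 0.
Proof.
apply/(VhP tr); split => // T TT; apply/polynomial_onP.
by exists 0 => //; exact: polyfun0.
Qed.

Lemma Vh2_lin m r z z' : Vh2 m z -> Vh2 m z' -> Vh2 m (r *: z + z').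
Proof. by move=> [h1 h2] [h1' h2']; split; exact: Vh_lin. Qed.

Lemma divh_lin m r z z' : Vh2 m z -> Vh2 m z' ->
  divh p Th (r *: z + z') = r *: divh p Th z + divh p Th z'.
Proof.
move=> [/(VhP tr)[_ /pieces[F FP]] /(VhP tr)[_ /pieces[G GP]]].
move=> [/(VhP tr)[_ /pieces[F' FP']] /(VhP tr)[_ /pieces[G' GP']]].
apply/funext => x; rewrite linear_fctE.
have [[T TT xi]|nx] := pselect (open_triangles p Th x); last first.
  by rewrite !divh_out// mulr0 addr0.
have [pF zF] := FP T TT; have [pG zG] := GP T TT.
have [pF' zF'] := FP' T TT; have [pG' zG'] := GP' T TT.
have [f1 [f2 [_ _ gF]]] := polyfun_gradient pF.
have [g1 [g2 [_ _ gG]]] := polyfun_gradient pG.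
have [f1' [f2' [_ _ gF']]] := polyfun_gradient pF'.
have [g1' [g2' [_ _ gG']]] := polyfun_gradient pG'.
rewrite (divhE TT zF zG gF gG xi) (divhE TT zF' zG' gF' gG' xi).
rewrite (divhE (f := r *: F T + F' T) (g := r *: G T + G' T) TT _ _
  (gradientD (gradientZ r gF) gF') (gradientD (gradientZ r gG) gG') xi).
- by rewrite !linear_fctE; ring.
- by move=> y sT; rewrite linear_fctE -zF// -zF'.
- by move=> y sT; rewrite linear_fctE -zG// -zG'.
Qed.

Lemma divh_Dh m z : Vh2 m z -> Dh p Th m.-1 (divh p Th z).
Proof.
move=> [/(VhP tr)[_ /pieces[F FP]] /(VhP tr)[_ /pieces[G GP]]]; split.
  by move=> x nx; exact: divh_out.
move=> T TT; have [pF zF] := FP T TT; have [pG zG] := GP T TT.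
have [f1 [f2 [pf1 _ gF]]] := polyfun_gradient pF.
have [g1 [g2 [_ pg2 gG]]] := polyfun_gradient pG.
apply/polynomial_onP; exists (f1 + g2); first exact: polyfunD.
by move=> x xi; rewrite (divhE TT zF zG gF gG xi).
Qed.

Lemma glue_cst (r : R) m : Sh p Th Omega m.+1 (glue p Th (fun=> cst r)).
Proof.
apply: (Sh_of_pieces (F := fun=> 0) (G := fun=> 0)) => // T TT; split.
- exact: polyfun_cst.
- exact: polyfun0.
- exact: polyfun0.
- by move=> x d; apply: is_derive_eq (is_derive_cst r x d) _; rewrite !mulr0 addr0.
Qed.

Lemma glue_cstE (r : R) x : closure Omega x -> glue p Th (fun=> cst r) x = r.
Proof. by move=> /(closure_mesh tr)[T TT sT]; rewrite (@glueE _ _ _ _ _ T). Qed.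

Lemma glue0 : glue p Th (fun=> cst (0 : R)) = 0.
Proof.
apply/funext => x; have [cx|nx] := pselect (closure Omega x); first exact: glue_cstE.
exact: (glue_on tr).
Qed.

Lemma partial_lin m r u u' x : Sh p Th Omega m u -> Sh p Th Omega m u' -> Omega x ->
  [/\ derivable (r *: u + u') x (1, 0), derivable (r *: u + u') x (0, 1),
     partial1 (r *: u + u') x = r * partial1 u x + partial1 u' x &
     partial2 (r *: u + u') x = r * partial2 u x + partial2 u' x].
Proof.
move=> [_ /(_ x) uC _] [_ /(_ x) uC' _] ox.
have [d1 d2 _ _] := uC ox; have [d1' d2' _ _] := uC' ox.
have i1 := is_deriveD (is_deriveZ r (DeriveDef d1 erefl)) (DeriveDef d1' erefl).
have i2 := is_deriveD (is_deriveZ r (DeriveDef d2 erefl)) (DeriveDef d2' erefl).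
split; [exact: (@ex_derive _ _ _ _ _ _ _ i1)|exact: (@ex_derive _ _ _ _ _ _ _ i2)| |].
  exact: (@derive_val _ _ _ _ _ _ _ i1).
exact: (@derive_val _ _ _ _ _ _ _ i2).
Qed.

Lemma Sh_lin m r u u' : Sh p Th Omega m u -> Sh p Th Omega m u' ->
  Sh p Th Omega m (r *: u + u').
Proof.
move=> Su Su'; have [uo uC /pieces[H HP]] := Su; have [uo' uC' /pieces[H' HP']] := Su'.
split.
- by move=> x nx; rewrite linear_fctE uo// uo'// mulr0 addr0.
- move=> x ox; have [h1 h2 _ _] := partial_lin r Su Su' ox.
  have [_ _ c1 c2] := uC x ox; have [_ _ c1' c2'] := uC' x ox.
  have Ox : nbhs x Omega by apply: open_nbhs_nbhs; split => //; exact: region_open reg.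
  have near_cont (K K' K'' : R * R -> R) :
      (forall y, Omega y -> K y = r * K' y + K'' y) ->
      {for x, continuous K'} -> {for x, continuous K''} -> {for x, continuous K}.
    move=> KE cK' cK''; change (K y @[y --> x] --> K x); rewrite KE//.
    have : r * K' y + K'' y @[y --> x] --> r * K' x + K'' x.
      by apply: cvgD; [apply: cvgM; [exact: cvg_cst|exact: cK']|exact: cK''].
    apply: cvg_trans; apply: near_eq_cvg.
    by apply: filterS Ox => y oy; rewrite KE.
  split; [exact: h1|exact: h2| |].
    apply: (near_cont _ _ _ _ c1 c1') => y oy.
    by have [_ _ E _] := partial_lin r Su Su' oy; exact: E.
  apply: (near_cont _ _ _ _ c2 c2') => y oy.
  by have [_ _ _ E] := partial_lin r Su Su' oy; exact: E.
- move=> T TT; apply/polynomial_onP; exists (r *: H T + H' T).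
    by apply: polyfun_lin; [exact: (HP T TT).1|exact: (HP' T TT).1].
  by move=> x sT; rewrite !linear_fctE (HP T TT).2// (HP' T TT).2.
Qed.

Lemma Vh_interior0 m u : Vh p Th Omega m u ->
  (forall T x, T \in Th -> (simplex p T)° x -> u x = 0) -> u = 0.
Proof.
move=> /(VhP tr)[uo /pieces[F FP]] u0; apply/funext => x.
have [cx|nx] := pselect (closure Omega x); last exact: uo.
have [T TT sT] := (closure_mesh tr x).1 cx; have [pF uF] := FP T TT.
rewrite uF// (polyfun_triangle0 tr TT pF)// => y yi.
by rewrite -uF ?(u0 T)//; exact: interior_subset.
Qed.

Lemma curl_kernel m u : Sh p Th Omega m.+1 u -> is_curl u 0 ->
  exists r, u = r *: glue p Th (fun=> cst 1).
Proof.
move=> [uo _ /pieces[H HP]] cu.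
have cst_T T x y : T \in Th -> simplex p T x -> simplex p T y -> u x = u y.
  move=> TT sx sy; have [pH uH] := HP T TT.
  have [f1 [f2 [pf1 pf2 gH]]] := polyfun_gradient pH.
  have f10 : f1 = 0.
    apply: (polyfun_triangle0 tr TT pf1) => z zi.
    have [<- _] := triangle_partial uH gH zi.
    by have [_ ->] := cu T z TT zi; rewrite oppr0.
  have f20 : f2 = 0.
    apply: (polyfun_triangle0 tr TT pf2) => z zi.
    have [_ <-] := triangle_partial uH gH zi.
    by have [-> _] := cu T z TT zi.
  by rewrite !uH//; apply: gradient0_const; rewrite -{1}f10 -f20.
have vT T v : T \in Th -> v \in T -> simplex p T (p v).
  by move=> TT; move=> /(vertex_simplex tr v TT (subxx T)).
have conn := mesh_connected tr reg (f := fun v => u (p v)).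
have {}conn : forall a b, u (p a) = u (p b).
  by apply: conn => T a b TT aT bT; apply: (cst_T T) => //; exact: vT.
have [y yb _] := region_boundary_two reg 0.
have [T0 TT0 sy] : exists2 T, T \in Th & simplex p T y.
  by apply/(closure_mesh tr)/(region_closureP reg); right.
exists (u y); apply/funext => x; rewrite scalrfctE /= scaleRE.
have [cx|nx] := pselect (closure Omega x); last by rewrite uo// (glue_on tr)// mulr0.
rewrite glue_cstE// mulr1; have [T TT sx] := (closure_mesh tr x).1 cx.
have [a [a1 [a2 [E _]]]] := triangleP (mesh_triangle tr TT).
have [b [b1 [b2 [E0 _]]]] := triangleP (mesh_triangle tr TT0).
have aT : a \in T by rewrite E !inE eqxx.
have bT : b \in T0 by rewrite E0 !inE eqxx.
by rewrite (cst_T T x (p a) TT sx (vT _ _ TT aT)) (conn a b)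
  (cst_T T0 (p b) y TT0 (vT _ _ TT0 bT) sy).
Qed.

Lemma Sh_dim m n : has_dim [set z | Vh2 m z /\ divh p Th z = 0] n ->
  has_dim (Sh p Th Omega m.+1) n.+1.
Proof.
have K0 : Vh2 m 0 /\ divh p Th 0 = 0.
  have V0 : Vh2 m 0 by split; exact: Vh0.
  split => //; have := divh_lin (-1) V0 V0.
  by rewrite !scaleN1r !addNr.
apply: (@has_dim_extension R _ _ _ _ is_curl (glue p Th (fun=> cst 1))) => //.
- by move=> r u u'; exact: Sh_lin.
- by have := glue_cst 0 m; rewrite glue0.
- move=> r u u' z z' Su Su' _ _ cu cu' T x TT xi.
  have [_ _ -> ->] := partial_lin r Su Su' (interior_region tr reg TT xi).
  have [-> ->] := cu T x TT xi; have [-> ->] := cu' T x TT xi.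
  rewrite (_ : (r *: z + z').1 x = r * z.1 x + z'.1 x)//.
  by rewrite (_ : (r *: z + z').2 x = r * z.2 x + z'.2 x)//; split => //; ring.
- move=> r z z' [Vz z0] [Vz' z0']; split; first exact: Vh2_lin.
  by rewrite (divh_lin r Vz Vz') z0 z0' scaler0 addr0.
- by move=> u /curl_exists.
- by move=> z [Vz z0]; exact: stream_exists.
- by move=> u; exact: curl_kernel.
- exact: glue_cst.
- move=> T x TT xi; have [] := @triangle_partial R V p T (glue p Th (fun=> cst 1)) (cst 1) 0 0 x.
  + by move=> y sT; rewrite glue_cstE//; apply/(closure_mesh tr); exists T.
  + by move=> y d; apply: is_derive_eq (is_derive_cst (1 : R) y d) _; rewrite !mulr0 addr0.
  + exact: xi.
  by move=> -> ->; rewrite /= oppr0.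
- have [y yb _] := region_boundary_two reg 0; apply/eqP => o0.
  have : closure Omega y by apply/(region_closureP reg); right.
  by move=> /(glue_cstE 1); rewrite o0 => /eqP; rewrite eq_sym oner_eq0.
- move=> [u1 u2] [[/= Vu1 Vu2] _] cu; congr pair.
    apply: Vh_interior0 Vu1 _ => T x TT xi; have [/= E _] := cu T x TT xi.
    by rewrite -E; exact: derive_cst.
  apply: Vh_interior0 Vu2 _ => T x TT xi; have [_ /= E] := cu T x TT xi.
  have : partial1 (0 : R * R -> R) x = 0 by exact: derive_cst.
  by rewrite E => /eqP; rewrite oppr_eq0 => /eqP.
Qed.

End StreamFunction.

(** * Bernstein monomials *)

Lemma has_dim_index (R : realType) (U : lmodType R) (W : set U) (I : finType)
    (A : {set I}) (b : I -> U) :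
  (forall i, i \in A -> W (b i)) ->
  (forall c : I -> R, \sum_(i in A) c i *: b i = 0 -> forall i, i \in A -> c i = 0) ->
  (forall u, W u -> exists c : I -> R, u = \sum_(i in A) c i *: b i) ->
  has_dim W #|A|.
Proof.
move=> Wb fb sb; exists (fun j => b (enum_val j)); split.
- by move=> j; apply: Wb; exact: enum_valP.
- move=> c c0 j.
  pose c' i := \sum_(k < #|A| | enum_val k == i) c k.
  have c'E k : c' (enum_val k) = c k.
    by rewrite /c' (big_pred1 k)// => l; rewrite (inj_eq enum_val_inj).
  rewrite -c'E; apply: fb (enum_valP j).
  by rewrite big_enum_val -[RHS]c0; apply: eq_bigr => k _; rewrite c'E.
- move=> u /sb[c ->]; exists (fun j => c (enum_val j)).
  by rewrite big_enum_val.
Qed.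

Lemma digits_inj (N n : nat) (a b : 'I_n -> nat) :
  (forall i, a i < N)%N -> (forall i, b i < N)%N ->
  (\sum_(i < n) a i * N ^ i = \sum_(i < n) b i * N ^ i)%N -> forall i, a i = b i.
Proof.
elim: n a b => [|n IH] a b aN bN; first by move=> _ [].
have N0 : (0 < N)%N by apply: leq_ltn_trans (aN ord0).
have E (f : 'I_n.+1 -> nat) : (\sum_(i < n.+1) f i * N ^ i =
    (\sum_(i < n) f (lift ord0 i) * N ^ i) * N + f ord0)%N.
  rewrite big_ord_recl /= expn0 muln1 addnC big_distrl; congr (_ + _)%N.
  by apply: eq_bigr => i _; rewrite /= /bump /= add1n expnSr mulnA.
rewrite !E => h; have h0 : a ord0 = b ord0.
  by have := congr1 (modn^~ N) h; rewrite !modnMDl !modn_small.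
have h1 := congr1 (divn^~ N) h; rewrite !divnMDl// !divn_small// !addn0 in h1.
have IH1 := IH _ _ (fun i => aN (lift ord0 i)) (fun i => bN (lift ord0 i)) h1.
by move=> i; case: (unliftP ord0 i) => [j|] ->.
Qed.

Section MultiIndices.
Variables (R : realType) (V : finType) (m : nat).
Local Notation index := {ffun V -> 'I_m.+1}.
Implicit Types (al be : index) (s : {set V}) (l : V -> R) (v : V).

Definition support al : {set V} := [set v | (0 < al v)%N]%SET.

Definition indices s : {set index} :=
  [set al : index | (\sum_v al v == m)%N && (support al \subset s)]%SET.

(** A Bernstein polynomial without its multinomial factor, which affects neither span nor
    independence. *)
Definition bmono l al : R := \prod_v l v ^+ al v.

Lemma bmono0 l al v : v \in support al -> l v = 0 -> bmono l al = 0.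
Proof.
rewrite inE => vs l0; rewrite /bmono (bigD1 v)//= l0 expr0n.
by rewrite eqn0Ngt vs mul0r.
Qed.

Lemma bmono_off l al s : (forall v, v \notin s -> l v = 0) ->
  ~~ (support al \subset s) -> bmono l al = 0.
Proof. by move=> l0 /fintype.subsetPn[v vs /l0]; exact: bmono0. Qed.

Lemma eq_bmono l l' al : l =1 l' -> bmono l al = bmono l' al.
Proof. by move=> ll'; apply: eq_bigr => v _; rewrite ll'. Qed.

(* The substitution l v := t ^ (m+1)^(rank v), up to normalisation, sends     *)
(* distinct monomials to distinct powers of t.                                *)
Lemma bmono_free s (c : index -> R) : s != finset.set0 ->
  (forall l, (forall v, 0 <= l v) -> (forall v, v \notin s -> l v = 0) ->
     \sum_(v in s) l v = 1 -> \sum_(al in indices s) c al * bmono l al = 0) ->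
  forall al, al \in indices s -> c al = 0.
Proof.
move=> s0 H al als.
pose e be := (\sum_v be v * m.+1 ^ enum_rank v)%N.
have eE be : e be = (\sum_(i < #|V|) be (enum_val i) * m.+1 ^ i)%N.
  rewrite /e (reindex _ (onW_bij _ (@enum_val_bij V))) /=.
  by apply: eq_bigr => i _; rewrite enum_valK.
have e_inj : injective e.
  move=> be be'; rewrite !eE => h.
  apply/ffunP => v; apply/val_inj; rewrite -(enum_rankK v).
  exact: (digits_inj (fun i => ltn_ord (be (enum_val i)))
    (fun i => ltn_ord (be' (enum_val i))) h).
pose q : {poly R} := \sum_(be in indices s) c be *: 'X^(e be).
suff q0 : q = 0.
  have := congr1 (fun r : {poly R} => r`_(e al)) q0.
  rewrite /q coef_sum (bigD1 al)//= big1 => [|be /andP[_ ba]].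
    by rewrite coefZ coefXn eqxx mulr1 addr0 coef0.
  by rewrite coefZ coefXn (inj_eq e_inj) eq_sym (negbTE ba) mulr0.
apply: poly_near0; have : \forall t \near (0 : R)^'+, 0 < t by exact: nbhs_right_gt.
apply: filterS => t t0.
(* Dividing by [S] makes the weights sum to 1; all monomials have degree [m], so only a common
   factor [S ^+ m] appears. *)
pose S := \sum_(v in s) t ^+ (m.+1 ^ enum_rank v)%N.
have S0 : 0 < S.
  have /set0Pn[v vs] := s0; rewrite /S (bigD1 v)//= ltr_pwDl ?exprn_gt0//.
  by apply: sumr_ge0 => w _; rewrite exprn_ge0// ltW.
pose l v := if v \in s then t ^+ (m.+1 ^ enum_rank v)%N / S else 0.
have l0 v : 0 <= l v.
  by rewrite /l; case: ifP => // _; rewrite divr_ge0 ?exprn_ge0// ltW.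
have ls v : v \notin s -> l v = 0 by rewrite /l => /negbTE ->.
have l1 : \sum_(v in s) l v = 1.
  rewrite -(divff (lt0r_neq0 S0)) [in RHS]/S mulr_suml.
  by apply: eq_bigr => v vs; rewrite /l vs.
have := H l l0 ls l1.
have lE be : be \in indices s -> bmono l be = t ^+ e be / S ^+ m.
  rewrite inE => /andP[/eqP bm bs].
  have -> : S ^+ m = \prod_v S ^+ be v by rewrite prodrXr bm.
  rewrite /e -prodrXr -prodf_div; apply: eq_bigr => v _.
  have [vs|vs] := boolP (v \in s).
    by rewrite /l vs expr_div_n mulnC exprM.
  have -> : be v = 0%N :> nat.
    apply/eqP; rewrite eqn0Ngt; apply: contra vs => vb.
    by apply: (fintype.subsetP bs); rewrite inE.
  by rewrite !expr0 divr1.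
have -> : \sum_(be in indices s) c be * bmono l be = q.[t] / S ^+ m.
  rewrite /q horner_sum mulr_suml; apply: eq_bigr => be bs.
  by rewrite hornerZ hornerXn lE// mulrA.
by move=> /eqP; rewrite mulf_eq0 invr_eq0 expf_eq0 (gt_eqF S0) andbF orbF => /eqP.
Qed.

(** Letter counts of a word of length [m] in the vertices; a product of [m] sums over the vertices
    expands into one term per word. *)
Definition multiplicity (w : {ffun 'I_m -> V}) : index :=
  [ffun v => inord #|[set k | w k == v]%SET|].

Lemma multiplicityE w v : multiplicity w v = #|[set k | w k == v]%SET| :> nat.
Proof.
rewrite ffunE inordK// ltnS; apply: leq_trans (max_card _) _.
by rewrite card_ord.
Qed.

Lemma sum_multiplicity w : (\sum_v multiplicity w v = m)%N.
Proof.
under eq_bigr do rewrite multiplicityE -sum1_card.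
transitivity (\sum_(k : 'I_m) 1)%N; last by rewrite sum_nat_const card_ord muln1.
rewrite (partition_big w xpredT)//=; apply: eq_bigr => v _.
by apply: eq_bigl => k; rewrite inE.
Qed.

Lemma bmono_multiplicity l (w : {ffun 'I_m -> V}) : \prod_k l (w k) = bmono l (multiplicity w).
Proof.
rewrite (partition_big w xpredT)//=; apply: eq_bigr => v _.
rewrite multiplicityE -prodr_const; apply: eq_big => [k|k /eqP -> //].
by rewrite inE.
Qed.

End MultiIndices.

Section Bernstein.
Variables (R : realType) (V : finType) (p : V -> R * R) (T : {set V}).
Hypothesis tT : is_triangle p T.
Implicit Types (x : R * R) (f : R * R -> R).

Lemma bary_polyfun v : polyfun 1 (bary p T v).
Proof.
have [n [k E]] := bary_affine p T v.
rewrite (_ : bary p T v = fun x => dot n x + k); last exact/funext.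
exact: polyfun_affine.
Qed.

Lemma bmono_polyfun m (al : {ffun V -> 'I_m.+1}) : (\sum_v al v = m)%N ->
  polyfun m (fun x => bmono (fun v => bary p T v x) al).
Proof.
move=> alm; rewrite (_ : (fun x => _) = \prod_v (bary p T v) ^+ al v); last first.
  apply/funext => x; rewrite fct_prodE; apply: eq_bigr => v _.
  by rewrite exprfctE.
rewrite -[X in polyfun X]alm; elim/big_rec2 : _ => [|v n F _ pF]; first exact: polyfun_cst.
apply: polyfunM => //; elim: (nat_of_ord (al v)) => [|k IH].
  by rewrite expr0; exact: polyfun_cst.
by rewrite exprS -add1n; apply: polyfunM => //; exact: bary_polyfun.
Qed.

(** A monomial of degree at most [m] is a product of exactly [m] linear forms in the barycentric
    coordinates, missing factors being filled by 1, the sum of the coordinates. Expanding over words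
    and grouping by letter counts gives monomials of degree [m]. *)
Lemma bernstein_span m f : polyfun m f ->
  exists c : {ffun V -> 'I_m.+1} -> R, forall x,
    f x = \sum_(al in indices m T) c al * bmono (fun v => bary p T v x) al.
Proof.
move: f; apply: polyfun_ind => [|f g [c cE] [c' cE']|r i j ij].
- by exists (fun=> 0) => x; rewrite big1// => al _; rewrite mul0r.
- exists (fun al => c al + c' al) => x; rewrite addrfctE cE cE' -big_split /=.
  by apply: eq_bigr => al _; rewrite mulrDl.
(* The [k]-th factor is [x.1] for the first [i] values of [k], [x.2] for the next [j], and 1 for the
   rest; [a k v] is its value at the vertex [v]. *)
pose a (k : 'I_m) v : R :=
  if (k < i)%N then (p v).1 else if (k < i + j)%N then (p v).2 else 1.
pose L (k : 'I_m) x : R := if (k < i)%N then x.1 else if (k < i + j)%N then x.2 else 1.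
have sumT (F : V -> R) x : (\sum_v F v * bary p T v x) = \sum_(v in T) F v * bary p T v x.
  rewrite (bigID (mem T)) /= [X in _ + X]big1 ?addr0// => v vT.
  by rewrite bary0// mulr0.
have LE k x : L k x = \sum_v a k v * bary p T v x.
  have xE := bary_combination tT x; rewrite sumT /L /a.
  case: ifP => _.
    rewrite -{1}xE raddf_sum /=; apply: eq_bigr => v _.
    by rewrite mulrC.
  case: ifP => _.
    rewrite -{1}xE raddf_sum /=; apply: eq_bigr => v _.
    by rewrite mulrC.
  by rewrite -mulr_sumr (sum_bary tT x) mul1r.
have mono x : monomial r i j x = r * \prod_(k < m) L k x.
  rewrite /monomial -mulrA; congr (_ * _).
  have -> : \prod_(k < m) L k x = \prod_(0 <= k < m)
      (if (k < i)%N then x.1 else if (k < i + j)%N then x.2 else 1).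
    by rewrite big_mkord.
  have im : (i <= m)%N by apply: leq_trans ij; rewrite leq_addr.
  rewrite (big_cat_nat (leq0n i) im) /= (big_cat_nat (leq_addr j i) ij)//=.
  rewrite [X in _ = X * _](eq_big_nat _ _ (F2 := fun=> x.1)); last first.
    by move=> k /andP[_ ->].
  rewrite [X in _ = _ * (X * _)](eq_big_nat _ _ (F2 := fun=> x.2)); last first.
    by move=> k /andP[ik kj]; rewrite ltnNge ik kj.
  rewrite [X in _ = _ * (_ * X)](eq_big_nat _ _ (F2 := fun=> 1)); last first.
    move=> k /andP[ijk _]; rewrite ltnNge (leq_trans (leq_addr j i) ijk) /=.
    by rewrite ltnNge ijk.
  by rewrite !prodr_const_nat subn0 addKn expr1n mulr1.
exists (fun al => r * \sum_(w : {ffun 'I_m -> V} | multiplicity w == al)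
  \prod_k a k (w k)) => x.
rewrite mono; under eq_bigr do rewrite LE.
rewrite bigA_distr_bigA /= mulr_sumr.
rewrite (partition_big (@multiplicity V m) xpredT)//= (bigID (mem (indices m T))) /=.
rewrite [X in _ + X]big1 ?addr0 => [|al al0]; last first.
  rewrite big1// => w /eqP wal; rewrite big_split /= (bmono_multiplicity (fun v => bary p T v x)) wal.
  rewrite (@bmono_off _ _ _ _ _ T) ?mulr0//; first by move=> v; exact: bary0.
  by apply: contra al0 => sal; rewrite inE sal -wal sum_multiplicity eqxx.
apply: eq_bigr => al _; rewrite -mulrA mulr_suml mulr_sumr.
apply: eq_bigr => w /eqP wal; rewrite big_split /= (bmono_multiplicity (fun v => bary p T v x)) wal.
by [].
Qed.

End Bernstein.

Section Counting.
Variables (V : finType) (m : nat).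
Local Notation index := {ffun V -> 'I_m.+1}.
Implicit Types (al : index) (s t : {set V}) (v : V).

Lemma sum_support al s : support al \subset s -> (\sum_v al v = \sum_(v in s) al v)%N.
Proof.
move=> als; rewrite (bigID (mem s)) /= [X in (_ + X)%N]big1 ?addn0// => v vs.
by apply/eqP; rewrite eqn0Ngt; apply: contra vs => ?; apply: (fintype.subsetP als); rewrite inE.
Qed.

Lemma card_indices n s : #|s| = n.+1 -> #|indices m s| = 'C(n + m, n).
Proof.
(* Listing the values on [s] turns indices into tuples of [n.+1] numbers with sum [m], a stars and
   bars count. *)
move=> sn; pose g al : n.+1.-tuple 'I_m.+1 := tcast sn [tuple of map al (enum_tuple s)].
have gE al : tval (g al) = map al (enum s) by rewrite val_tcast.
have sumg al : support al \subset s -> (\sum_v al v = \sum_(i <- g al) i)%N.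
  by move=> /sum_support ->; rewrite gE big_map big_enum.
have ginj : {in indices m s &, injective g}.
  move=> al be; rewrite !inE => /andP[_ als] /andP[_ bes] E; apply/ffunP => v.
  have [vs|vs] := boolP (v \in s).
    have := congr1 val E; rewrite /= !gE => /eq_in_map/(_ v); apply.
    by rewrite mem_enum.
  have z (ga : index) : support ga \subset s -> ga v = ord0.
    move=> gas; apply/val_inj/eqP; rewrite /= eqn0Ngt; apply: contra vs => ?.
    by apply: (fintype.subsetP gas); rewrite inE.
  by rewrite !z.
rewrite -card_ord_partitions -(card_in_imset ginj); apply: eq_card => t.
rewrite inE; apply/imsetP/idP => [[al]|/eqP tm].
  by rewrite inE => /andP[alm als] ->; rewrite -sumg.
have senum : size (enum s) = n.+1 by rewrite -cardE.
pose al : index := [ffun v => nth ord0 t (seq.index v (enum s))].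
have gal : t = g al.
  apply/val_inj; rewrite /= gE; apply: (@eq_from_nth _ ord0).
    by rewrite size_tuple size_map senum.
  move=> i it; have si : (i < size (enum s))%N by move: it; rewrite size_tuple senum.
  have /hasP[v0 _ _] : has predT (enum s) by case: (enum s) si.
  by rewrite (nth_map v0)// ffunE index_uniq ?enum_uniq.
have als : support al \subset s.
  apply/fintype.subsetP => v; rewrite inE ffunE; apply: contraTT => vs.
  by rewrite nth_default// size_tuple memNindex ?senum// mem_enum.
by exists al; rewrite // inE als sumg// -gal tm eqxx.
Qed.

Lemma sum_subsets s (g : nat -> nat) :
  (\sum_(t : {set V} | t \subset s) g #|t| = \sum_(j < #|s|.+1) 'C(#|s|, j) * g j)%N.
Proof.
rewrite (partition_big (fun t => inord #|t| : 'I_#|s|.+1) xpredT)//=.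
apply: eq_bigr => j _; rewrite -cards_draws -sum_nat_cond_const.
have E t : t \subset s -> (inord #|t| == j :> 'I_#|s|.+1) = (#|t| == j).
  by move=> /subset_leq_card ts; rewrite -val_eqE /= inordK.
apply: eq_big => [t|t /andP[ts]]; last by rewrite E// => /eqP ->.
by case: (boolP (t \subset s)) => //= ts; rewrite E.
Qed.

(** Vandermonde's identity, in the range that faces of a triangle require, checked case by case. *)
Lemma binomial_sum k n : (0 < n)%N -> (n <= 3)%N ->
  (\sum_(j < n.+1) 'C(n, j) * (if val j is i.+1 then 'C(k, i) else 0) =
   'C(n.-1 + k.+1, n.-1))%N.
Proof.
case: n => [//|[|[|[|//]]]] _ _; rewrite !big_ord_recr big_ord0 /=.
- by rewrite !bin0.
- by rewrite add1n !bin0 !bin1 binn; lia.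
- rewrite !add2n (_ : 'C(3, 1) = 3)// (_ : 'C(3, 2) = 3)// binn !bin0 bin1.
  rewrite (binS k.+2 1) (binS k.+1 1) (binS k 1) !bin1.
  by move: 'C(k, 2) => c; lia.
Qed.

Definition exact_indices s : {set index} :=
  [set al : index | (\sum_v al v == m)%N && (support al == s)]%SET.

(** These are the compositions of [m] into [#|s|] positive parts. [card_indices] counts all supports
    inside [s] together, and induction removes the proper ones. *)
Lemma card_exact_indices s : (1 <= m)%N -> (#|s| <= 3)%N ->
  #|exact_indices s| = if #|s| is n.+1 then 'C(m.-1, n) else 0%N.
Proof.
move=> m1; pose x c := if c is n.+1 then 'C(m.-1, n) else 0%N.
rewrite -/(x #|s|); move En : #|s| => n; elim/ltn_ind: n s En => n IH s sn n3.
have [n0|n0] := posnP n.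
  rewrite n0 /=; apply: eq_card0 => al; rewrite inE; apply/negP => /andP[/eqP alm /eqP als].
  move: alm; rewrite (@sum_support _ s) ?als//.
  have -> : s = finset.set0 by apply/eqP; rewrite -cards_eq0 sn n0.
  by rewrite big_set0 => m0; move: m1; rewrite -m0.
have N1 : (\sum_(t : {set V} | t \subset s) #|exact_indices t| = 'C(n.-1 + m, n.-1))%N.
  rewrite -(@card_indices n.-1 s) ?prednK// -sum1_card.
  rewrite (partition_big (@support V m) (fun t => t \subset s)) => [|al] /=; last first.
    by rewrite inE => /andP[].
  apply: eq_bigr => t ts; rewrite -sum1_card; apply: eq_bigl => al; rewrite !inE.
  by case: (eqVneq (support al) t) => [->|]; rewrite ?ts ?andbT ?andbF.
have N2 := sum_subsets s x.
move: N1; rewrite (bigD1 s)//= => N1.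
move: N2; rewrite (bigD1 s)//=.
rewrite (eq_bigr (fun t => #|exact_indices t|)) => [|t /andP[ts tns]]; last first.
  have lt : (#|t| < n)%N by rewrite -sn proper_card// finset.properEneq tns ts.
  by rewrite (IH _ lt)// (leq_trans (ltnW lt)).
rewrite sn => N2; have : (x n + 'C(n.-1 + m, n.-1) = #|exact_indices s| +
  \sum_(j < n.+1) 'C(n, j) * x j)%N by rewrite -N1 -N2 addnCA.
suff -> : (\sum_(j < n.+1) 'C(n, j) * x j = 'C(n.-1 + m, n.-1))%N by move/addIn.
by have := binomial_sum m.-1 n0 n3; rewrite prednK.
Qed.

End Counting.

(** * Dimension counts *)

Lemma sum_subset (U : nmodType) (V : finType) (s T : {set V}) (F : V -> U) :
  s \subset T -> (forall v, v \notin s -> F v = 0) ->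
  \sum_(v in T) F v = \sum_(v in s) F v.
Proof.
move=> sT F0; rewrite (big_setID s) /= (finset.setIidPr sT) [X in _ + X]big1 ?addr0//.
by move=> v; rewrite inE => /andP[vs _]; exact: F0.
Qed.

Section Dimensions.
Variables (R : realType) (V : finType) (p : V -> R * R) (Th : {set {set V}}).
Variable Omega : set (R * R).
Hypothesis tr : triangulation p Th Omega.
Implicit Types (s T : {set V}) (x : R * R) (v : V) (m : nat).

Definition mesh_indices m : {set {ffun V -> 'I_m.+1}} :=
  [set al : {ffun V -> 'I_m.+1} | (\sum_v al v == m)%N &&
     [exists T in Th, support al \subset T]]%SET.

Lemma mesh_indicesP m (al : {ffun V -> 'I_m.+1}) :
  reflect (exists2 T, T \in Th & al \in indices m T) (al \in mesh_indices m).
Proof.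
rewrite inE; apply: (iffP andP) => [[alm /exists_inP[T TT alT]]|[T TT]].
  by exists T => //; rewrite inE alm.
by rewrite inE => /andP[-> alT]; split => //; apply/exists_inP; exists T.
Qed.

Lemma card_mesh_indices m : (1 <= m)%N -> #|mesh_indices m| =
  (#|V| + m.-1 * #|edges Th| + 'C(m.-1, 2) * #|Th|)%N.
Proof.
move=> m1; pose face s := [exists T in Th, s \subset T].
have face3 s : face s -> (#|s| <= 3)%N.
  by move=> /exists_inP[T TT sT]; have := subset_leq_card sT; rewrite (triangle_card tr TT).
have -> : #|mesh_indices m| = (\sum_(s | face s) #|exact_indices m s|)%N.
  rewrite -sum1_card (partition_big (@support V m) face) => [|al] /=; last first.
    by rewrite inE => /andP[].
  apply: eq_bigr => s fs; rewrite -sum1_card; apply: eq_bigl => al; rewrite !inE.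
  by case: (eqVneq (support al) s) => [->|]; [rewrite -/(face s) fs !andbT|rewrite !andbF].
pose x c := (if c is n.+1 then 'C(m.-1, n) else 0)%N.
rewrite (eq_bigr (fun s => x #|s|)) => [|s /face3]; last exact: card_exact_indices.
rewrite (bigID (fun s => #|s| == 1%N)) [X in (_ + X)%N = _](bigID (fun s => #|s| == 2%N)) /=.
rewrite [X in (_ + (_ + X))%N = _](bigID (fun s => #|s| == 3%N)) /= addnA.
rewrite [X in (_ + (_ + X))%N = _]big1 ?addn0 => [|s /andP[/andP[/andP[]]]]; last first.
  by move=> /face3; case: #|s| => [|[|[|[|]]]].
have sumE c (P : pred {set V}) n :
    (forall s, P s -> #|s| = c) -> #|[set s | P s]%SET| = n ->
    (\sum_(s | P s) x #|s| = n * x c)%N.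
  by move=> Pc <-; rewrite -sum_nat_cond_const; apply: eq_bigr => s /Pc ->.
congr (_ + _ + _)%N.
- rewrite (sumE 1%N _ #|V|) ?[x _]bin0 ?muln1// => [s /andP[_ /eqP]//|].
  rewrite -(card_imset _ (@set1_inj V)) -[RHS]/(#|finset.set1 @: _|).
  apply: eq_card => s; rewrite inE; apply/andP/imsetP => [[_ /cards1P[v ->]]|[v _ ->]].
    by exists v.
  by rewrite cards1; split=> //; have [T TT vT] := vertex_mesh tr v;
     apply/exists_inP; exists T; rewrite ?finset.sub1set.
- rewrite (sumE 2%N _ #|edges Th|) ?[x _]bin1 1?mulnC// => [s /andP[_ /eqP]//|].
  apply: eq_card => s; rewrite !inE; apply/andP/andP => [[/andP[fs _] s2]|[s2 fs]] //.
  by rewrite s2 [face s]fs (eqP s2).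
- rewrite (sumE 3%N _ #|Th|) 1?mulnC// => [s /andP[_ /eqP]//|].
  apply: eq_card => s; rewrite inE; apply/andP/idP => [[/andP[/andP[fs _] _] /eqP s3]|sT].
    have /exists_inP[T TT sT] := fs; suff -> : s = T by [].
    by apply/eqP; rewrite eqEcard sT s3 (triangle_card tr TT).
  rewrite (triangle_card tr sT); split=> //; rewrite !andbT.
  by apply/exists_inP; exists s.
Qed.

Definition bernstein m T (al : {ffun V -> 'I_m.+1}) x := bmono (fun v => bary p T v x) al.

Lemma agreeing_bernstein m (al : {ffun V -> 'I_m.+1}) :
  agreeing p Th (fun T => bernstein T al).
Proof.
by move=> T T' x TT TT' sT sT'; apply: eq_bmono => v; apply: (bary_eq tr).
Qed.

Lemma sum_fct (I : finType) (A : {set I}) (c : I -> R) (b : I -> R * R -> R) x :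
  (\sum_(i in A) c i *: b i) x = \sum_(i in A) c i * b i x.
Proof. by rewrite fct_sumE; apply: eq_bigr => i _; rewrite scalrfctE scaleRE. Qed.

Lemma sum_mesh_indices m T (c : {ffun V -> 'I_m.+1} -> R) (l : V -> R) : T \in Th ->
  (forall v, v \notin T -> l v = 0) ->
  \sum_(al in mesh_indices m) c al * bmono l al = \sum_(al in indices m T) c al * bmono l al.
Proof.
move=> TT l0; rewrite (bigID (mem (indices m T))) /= [X in _ + X]big1 ?addr0 => [|al].
  apply: eq_bigl => al; rewrite andbC.
  by case: (boolP (al \in indices m T)) => //= alT; apply/mesh_indicesP; exists T.
rewrite !inE => /andP[/andP[-> _]] /= alT.
by rewrite (bmono_off l0) ?mulr0.
Qed.

Lemma glue_bernstein m T al x : T \in Th -> simplex p T x ->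
  glue p Th (fun T => bernstein T al) x = bmono (fun v => bary p T v x) (al : {ffun V -> 'I_m.+1}).
Proof. by move=> TT sT; rewrite (glueE (@agreeing_bernstein m al) TT sT). Qed.

Lemma Vh_dim m : (1 <= m)%N -> has_dim (Vh p Th Omega m) #|mesh_indices m|.
Proof.
move=> m1; apply: (has_dim_index (b := fun al => glue p Th (fun T => bernstein T al))).
- move=> al; rewrite inE => /andP[/eqP alm _]; apply: (glue_Vh tr).
    exact: agreeing_bernstein.
  by move=> T TT; exact: (bmono_polyfun p T alm).
- move=> c c0 al /mesh_indicesP[T TT alT]; have tT := mesh_triangle tr TT.
  apply: (bmono_free _ _ alT); first by rewrite -card_gt0 (triangle_card tr TT).
  move=> l l0 lT l1; pose x : R * R := \sum_(v in T) l v *: p v.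
  have lE v : l v = bary p T v x.
    have [vT|vT] := boolP (v \in T); first exact: (bary_uniq tT l1).
    by rewrite lT// bary0.
  have sT : simplex p T x by exists l.
  have := congr1 (fun f : R * R -> R => f x) c0; rewrite sum_fct => c0x.
  rewrite -[RHS]c0x -(sum_mesh_indices _ TT lT); apply: eq_bigr => be _.
  by rewrite (glue_bernstein _ TT sT); congr (_ * _); exact: eq_bmono.
- move=> u /(VhP tr)[uo up]; have [H HP] := pieces up.
  have HC T : exists c : {ffun V -> 'I_m.+1} -> R, T \in Th -> forall x,
      H T x = \sum_(al in indices m T) c al * bmono (fun v => bary p T v x) al.
    have [TT|_] := boolP (T \in Th); last by exists (fun=> 0).
    have [c cE] := bernstein_span (mesh_triangle tr TT) (HP T TT).1.
    by exists c.
  have [C CE] := choice HC.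
  (* On the common face only the indices supported there survive, and the two pieces agree;
     independence of the monomials on this face makes the shared coefficients equal. *)
  have CC T T' al : T \in Th -> T' \in Th -> al \in indices m T -> al \in indices m T' ->
      C T al = C T' al.
    move=> TT TT' alT alT'; apply/eqP; rewrite -subr_eq0; apply/eqP.
    have alTT : al \in indices m (T :&: T')%SET.
      move: alT alT'; rewrite !inE => /andP[-> h] /andP[_ h'] /=.
      by rewrite finset.subsetI h.
    apply: (bmono_free (s := (T :&: T')%SET) (c := fun be => C T be - C T' be) _ _ alTT).
      (* The common face is nonempty, because an index of degree [m >= 1] has nonempty support. *)
      apply: contraL alTT => /eqP ->; rewrite inE; apply/negP => /andP[/eqP alm al0].
      by move: m1; rewrite -alm (sum_support al0) big_set0.
    move=> l l0 lT l1; pose x : R * R := \sum_(v in (T :&: T')%SET) l v *: p v.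
    have sx : simplex p (T :&: T')%SET x by exists l.
    have lE T0 : T0 \in Th -> (T :&: T')%SET \subset T0 ->
        H T0 x = \sum_(be in indices m (T :&: T')%SET) C T0 be * bmono l be.
      move=> TT0 sT0; have tT0 := mesh_triangle tr TT0.
      have lb v : bary p T0 v x = l v.
        have [vT0|vT0] := boolP (v \in T0); last first.
          by rewrite bary0// lT//; apply: contra vT0; exact: (fintype.subsetP sT0).
        apply/esym/(bary_uniq tT0) => //; first by rewrite -l1 (sum_subset sT0 lT).
        by rewrite (sum_subset sT0)// => w ws; rewrite lT// scale0r.
      rewrite CE//; under eq_bigr do rewrite (eq_bmono _ lb).
      rewrite (bigID (mem (indices m (T :&: T')%SET))) /= [X in _ + X]big1 ?addr0.
        apply: eq_bigl => be; rewrite andbC !inE.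
        case: (boolP (support be \subset _)) => [h|]; rewrite ?andbF//.
        by rewrite (fintype.subset_trans h sT0) !andbT andbb.
      move=> be; rewrite !inE => /andP[/andP[-> _]] /= bT.
      by rewrite (bmono_off lT) ?mulr0.
    under eq_bigr do rewrite mulrBl.
    rewrite sumrB -!lE ?finset.subsetIl ?finset.subsetIr//.
    have sT : simplex p T x.
      apply/(triangle_bary (mesh_triangle tr TT)) => v.
      have [] := (simplex_bary (mesh_triangle tr TT) x (finset.subsetIl T T')).1 sx.
      by move=> + _; apply.
    have sT' : simplex p T' x.
      apply/(triangle_bary (mesh_triangle tr TT')) => v.
      have [] := (simplex_bary (mesh_triangle tr TT') x (finset.subsetIr T T')).1 sx.
      by move=> + _; apply.
    by rewrite -(HP T TT).2// -(HP T' TT').2// subrr.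
  pose c al := if [pick T in Th | al \in indices m T] is Some T then C T al else 0.
  exists c; apply/funext => x; rewrite sum_fct.
  have [cx|ncx] := pselect (closure Omega x); last first.
    rewrite uo// big1// => al _; rewrite (glue_on tr) ?mulr0//.
  have [T TT sT] := (closure_mesh tr x).1 cx.
  under eq_bigr do rewrite (glue_bernstein _ TT sT).
  rewrite (sum_mesh_indices _ TT) => [|v]; last exact: bary0.
  rewrite (HP T TT).2// CE//; apply: eq_bigr => al alT; congr (_ * _).
  rewrite /c; case: pickP => [T' /andP[TT' alT']|/(_ T)]; last by rewrite TT alT.
  exact: CC.
Qed.

End Dimensions.

Section DiscontinuousDimension.
Variables (R : realType) (V : finType) (p : V -> R * R) (Th : {set {set V}}).
Variable Omega : set (R * R).
Hypothesis tr : triangulation p Th Omega.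
Implicit Types (s T : {set V}) (x : R * R) (v : V) (m : nat).

Lemma Dh_lin m r w w' : Dh p Th m w -> Dh p Th m w' -> Dh p Th m (r *: w + w').
Proof.
move=> [wo /pieces[H HP]] [wo' /pieces[H' HP']]; split.
  by move=> x nx; rewrite linear_fctE wo// wo'// mulr0 addr0.
move=> T TT; apply/polynomial_onP; exists (r *: H T + H' T).
  by apply: polyfun_lin; [exact: (HP T TT).1|exact: (HP' T TT).1].
by move=> x xi; rewrite !linear_fctE (HP T TT).2// (HP' T TT).2.
Qed.

Lemma Dh0 m : Dh p Th m 0.
Proof.
by split => // T TT; apply/polynomial_onP; exists 0 => //; exact: polyfun0.
Qed.

(** Pairs, because without continuity every triangle has its own copy of an index. *)
Definition triangle_indices m : {set {set V} * {ffun V -> 'I_m.+1}} :=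
  [set i : {set V} * {ffun V -> 'I_m.+1} | (i.1 \in Th) && (i.2 \in indices m i.1)]%SET.

Lemma card_triangle_indices m : #|triangle_indices m| = (#|Th| * 'C(m + 2, 2))%N.
Proof.
rewrite -sum1_card; under eq_bigl do rewrite inE.
rewrite -(pair_big_dep (mem Th) (fun T al => al \in indices m T) (fun _ _ => 1%N)) /=.
rewrite -sum_nat_const; apply: eq_bigr => T TT.
by rewrite sum1_card (card_indices m (n := 2%N) (triangle_card tr TT)) addnC.
Qed.

Definition open_bernstein m (i : {set V} * {ffun V -> 'I_m.+1}) x : R :=
  if `[< (simplex p i.1)° x >] then bernstein p i.1 i.2 x else 0.

Lemma sum_triangle_indices m (c : {set V} * {ffun V -> 'I_m.+1} -> R) T x : T \in Th ->
  (simplex p T)° x -> (\sum_(i in triangle_indices m) c i *: open_bernstein i) x =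
  \sum_(al in indices m T) c (T, al) * bernstein p T al x.
Proof.
move=> TT xi; rewrite sum_fct; under eq_bigl do rewrite inE.
transitivity (\sum_(T' in Th) \sum_(al in indices m T') c (T', al) * open_bernstein (T', al) x).
  by rewrite pair_big_dep /=; apply: eq_bigr => -[].
rewrite (bigD1 T)//= [X in _ + X]big1 ?addr0 => [|T' /andP[TT' TT'n]].
  by apply: eq_bigr => al _; rewrite /open_bernstein /= asboolT.
apply: big1 => al _; rewrite /open_bernstein /= asboolF ?mulr0// => xi'.
have [_ xT] := (interior_carrier tr x TT).1 xi.
have [_ xT'] := (interior_carrier tr x TT').1 xi'.
by move/eqP: TT'n; apply; rewrite -xT.
Qed.

Lemma polyfun_bernstein_sum m T (c : {ffun V -> 'I_m.+1} -> R) :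
  polyfun m (\sum_(al in indices m T) c al *: bernstein p T al).
Proof.
apply: polyfun_sum => al; rewrite inE => /andP[/eqP alm _].
by apply: polyfunZ; exact: (bmono_polyfun p T alm).
Qed.

Lemma Dh_dim m : has_dim (Dh p Th m) (#|Th| * 'C(m + 2, 2)).
Proof.
rewrite -card_triangle_indices; apply: (has_dim_index (b := @open_bernstein m)).
- move=> [T al]; rewrite inE => /andP[/= TT alT]; split.
    move=> x nx; rewrite /open_bernstein /= asboolF// => xi; apply: nx.
    by exists T.
  move=> T' TT'; apply/polynomial_onP; have [->|TT'n] := eqVneq T' T.
    exists (bernstein p T al).
      by apply: (bmono_polyfun p T); move: alT; rewrite inE => /andP[/eqP].
    by move=> x xi; rewrite /open_bernstein /= asboolT.
  exists 0; first exact: polyfun0.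
  move=> x xi'; rewrite /open_bernstein /= asboolF// => xi.
  have [_ xT] := (interior_carrier tr x TT).1 xi.
  have [_ xT'] := (interior_carrier tr x TT').1 xi'.
  by move/eqP: TT'n; apply; rewrite -xT.
- move=> c c0 [T al]; rewrite inE => /andP[/= TT alT].
  have tT := mesh_triangle tr TT.
  have f0 : \sum_(al in indices m T) c (T, al) *: bernstein p T al = 0.
    apply: (polyfun_triangle0 tr TT (polyfun_bernstein_sum _ _)) => x xi.
    by rewrite sum_fct -sum_triangle_indices// c0.
  apply: (bmono_free (c := fun al => c (T, al)) _ _ alT).
    by rewrite -card_gt0 (triangle_card tr TT).
  move=> l l0 lT l1; pose x : R * R := \sum_(v in T) l v *: p v.
  have lE v : bary p T v x = l v.
    have [vT|vT] := boolP (v \in T); last by rewrite lT// bary0.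
    by apply/esym; exact: (bary_uniq tT l1).
  have := congr1 (fun f : R * R -> R => f x) f0; rewrite sum_fct => f0x.
  by rewrite -[RHS]f0x; apply: eq_bigr => be _; rewrite -(eq_bmono _ lE).
- move=> w [wo /pieces[H HP]].
  have HC T : exists c : {ffun V -> 'I_m.+1} -> R, T \in Th -> forall x,
      H T x = \sum_(al in indices m T) c al * bmono (fun v => bary p T v x) al.
    have [TT|_] := boolP (T \in Th); last by exists (fun=> 0).
    have [c cE] := bernstein_span (mesh_triangle tr TT) (HP T TT).1.
    by exists c.
  have [C CE] := choice HC; exists (fun i => C i.1 i.2); apply/funext => x.
  have [[T TT xi]|nx] := pselect (open_triangles p Th x).
    by rewrite (sum_triangle_indices _ TT xi) (HP T TT).2// CE.
  rewrite wo// sum_fct big1// => -[T al]; rewrite inE => /andP[/= TT _].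
  by rewrite /open_bernstein /= asboolF ?mulr0// => xi; apply: nx; exists T.
Qed.

End DiscontinuousDimension.

(** * Strang's number and the equivalence *)

Section StrangNumber.
Variables (R : realType) (V : finType) (p : V -> R * R) (Th : {set {set V}}).
Variable Omega : set (R * R).
Hypothesis tr : triangulation p Th Omega.
Hypothesis reg : polygonal_region_no_holes Omega.

Lemma strang_numberE n : strang_number p Th Omega n.+2 =
  (2 * #|mesh_indices Th n.+1|).+1%:Z - (#|Th| * 'C(n + 2, 2))%N%:Z.
Proof.
rewrite /strang_number (card_mesh_indices tr)//=.
(* Both binomials are reduced to ['C(n, 2)], which the arithmetic below treats as an unknown. *)
have b1 : ('C(n + 2, 2) = 'C(n, 2) + 2 * n + 1)%N by rewrite addn2 !binS bin1 bin0; lia.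
have b2 : ('C(n.+2 + 2, 2) = 'C(n, 2) + 4 * n + 6)%N.
  by rewrite addn2 !binS !bin1 !bin0; lia.
have := euler tr reg; have := card_edges tr reg.
have := card_triangle_edges tr reg; have := card_boundary tr reg.
rewrite b1 b2 => h1 h2 h3 h4.
(* Euler's formula and the incidence counts leave two free numbers, those of triangles and of
   interior edges. *)
have E1 : #|interior_vertices p Omega|%:Z = #|interior_edges p Th Omega|%:Z + 1 - #|Th|%:Z by lia.
have E2 : #|edges Th|%:Z = 3 * #|Th|%:Z - #|interior_edges p Th Omega|%:Z by lia.
have E3 : #|V|%:Z = 2 * #|Th|%:Z - #|interior_edges p Th Omega|%:Z + 1 by lia.
by rewrite !(intS, PoszD, PoszM) E1 E2 E3; ring.
Qed.

Lemma strang_range m : (1 <= m)%N -> strang_conjecture p Th Omega m.+1 <->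
  [set divh p Th v | v in Vh p Th Omega m `*` Vh p Th Omega m] = Dh p Th m.-1.
Proof.
case: m => [//|n] _ /=; pose Vh2 := Vh p Th Omega n.+1 `*` Vh p Th Omega n.+1.
have dV : has_dim Vh2 (2 * #|mesh_indices Th n.+1|).
  rewrite mul2n -addnn; apply: has_dim_setX; try exact: Vh0 tr _.
    exact: (Vh_dim tr).
  exact: (Vh_dim tr).
have V0 : Vh2 0 by split; exact: (Vh0 tr).
have VL r z z' : Vh2 z -> Vh2 z' -> Vh2 (r *: z + z') by exact: (Vh2_lin tr).
have fL r z z' : Vh2 z -> Vh2 z' -> divh p Th (r *: z + z') =
    r *: divh p Th z + divh p Th z' by exact: (divh_lin tr).
have fD z : Vh2 z -> Dh p Th n (divh p Th z) by exact: (divh_Dh tr).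
have [r [rN rM dK rE]] := rank_nullity VL V0 fL fD (@Dh_lin _ _ _ _ n) (@Dh0 _ _ _ _ n)
  dV (Dh_dim tr n).
rewrite -rE; have dS := Sh_dim tr reg dK.
(* With [N = #|mesh_indices Th n.+1|] and [M] the dimension of [Dh], the dimension of [Sh] is
   [(2 * N - r).+1] and Strang's number is [2 * N + 1 - M]. They agree exactly when [r = M], the
   bound [rN] making the natural subtraction exact. *)
split=> [[d dSd]|rE'].
  rewrite strang_numberE (has_dim_uniq dSd dS); lia.
exists (2 * #|mesh_indices Th n.+1| - r).+1 => //.
rewrite strang_numberE; lia.
Qed.

End StrangNumber.

Theorem theorem3p3 (R : realType) (V : finType) (p : V -> (R * R)%type)
    (Th : {set {set V}}) (Omega : set (R * R)%type) (k : nat) :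
  (2 <= k)%N ->
  polygonal_region_no_holes Omega ->
  triangulation p Th Omega ->
  (forall v : V, ~ singular_vertex p Th v) ->
  strang_conjecture p Th Omega k <->
  [set divh p Th v | v in Vh p Th Omega (k - 1) `*` Vh p Th Omega (k - 1)] =
  Dh p Th (k - 2).
Proof.
move=> k2 reg tr _; case: k k2 => [//|k] k2.
by rewrite subn1 subn2 /=; exact: strang_range.
Qed.
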